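(* Let $k$ be a field, $I\subset k$ a subset and $n\ge1$. Let $\Gamma=I_1$ be the quiver with vertex set $I$ and with an arrow $i\to i+1$ whenever $i,i+1\in I$. Let $H_n(\Gamma)$ be the algebra attached to $\Gamma$ in the context and let $\bar H_n$ be the degenerate affine Hecke algebra of $\mathrm{GL}_n$. There is an equivalence of categories $$kH_n(\Gamma)\text{-}\mathrm{Mod}_0\ \xrightarrow{\ \sim\ }\ \bar{\mathcal C}_\Gamma,\qquad M\mapsto M,$$ where $X_i$ acts on $1_\nu M$ by $(x_i+\nu_i)$ and $T_i$ acts on $1_\nu M$ by - $(x_i-x_{i+1}+1)\tau_i+1$ if $\nu_i=\nu_{i+1}$; - $(x_i-x_{i+1}-1)^{-1}(\tau_i-1)$ if $\nu_{i+1}=\nu_i+1$; - $(x_i-x_{i+1}+\nu_{i+1}-\nu_i+1)(x_i-x_{i+1}+\nu_{i+1}-\nu_i)^{-1}(\tau_i-1)+1$ otherwise.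
   Context: **The algebra $H_n(\Gamma)$.** For $i\neq j$ in $I$ let $d_{ij}$ be the number of arrows $i\to j$ in $\Gamma$ (so $d_{ij}=1$ if $j=i+1$ and $d_{ij}=0$ otherwise). Put $P_{ij}(u,v)=(v-u)^{d_{ij}}$ for $i\ne j$, $Q_{ij}(u,v)=P_{ij}(u,v)P_{ji}(v,u)=(-1)^{d_{ij}}(u-v)^{d_{ij}+d_{ji}}$ for $i\neq j$, and $Q_{ii}=0$. Then $kH_n(\Gamma)=H_n(Q)$ over $k$, where, with $L=I^n$, $H_n(Q)$ is the (possibly non-unitary) $k$-algebra generated by $1_\nu$, $x_{i,\nu}$ ($1\le i\le n$), $\tau_{i,\nu}$ ($1\le i\le n-1$), $\nu\in L$, with relations: - $1_\nu1_{\nu'}=\delta_{\nu,\nu'}1_\nu$, $\tau_{i,\nu}=1_{s_i(\nu)}\tau_{i,\nu}1_\nu$, $x_{a,\nu}=1_\nu x_{a,\nu}1_\nu$, $x_{a,\nu}x_{b,\nu}=x_{b,\nu}x_{a,\nu}$; - $\tau_{i,s_i(\nu)}\tau_{i,\nu}=Q_{\nu_i,\nu_{i+1}}(x_{i,\nu},x_{i+1,\nu})$; $\tau_{i,s_j(\nu)}\tau_{j,\nu}=\tau_{j,s_i(\nu)}\tau_{i,\nu}$ if $|i-j|>1$; - $\tau_{i+1,s_is_{i+1}(\nu)}\tau_{i,s_{i+1}(\nu)}\tau_{i+1,\nu}-\tau_{i,s_{i+1}s_i(\nu)}\tau_{i+1,s_i(\nu)}\tau_{i,\nu}$ equals $(x_{i+2,\nu}-x_{i,\nu})^{-1}(Q_{\nu_i,\nu_{i+1}}(x_{i+2,\nu},x_{i+1,\nu})-Q_{\nu_i,\nu_{i+1}}(x_{i,\nu},x_{i+1,\nu}))$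 if $\nu_i=\nu_{i+2}$ and $0$ otherwise; - $\tau_{i,\nu}x_{a,\nu}-x_{s_i(a),s_i(\nu)}\tau_{i,\nu}$ equals $-1_\nu$ if $a=i$ and $\nu_i=\nu_{i+1}$; $1_\nu$ if $a=i+1$ and $\nu_i=\nu_{i+1}$; $0$ otherwise. Here $s_i=(i,i+1)$ acts on $I^n$ by permuting coordinates. The subscript $\nu$ is dropped from $x_{i,\nu}$ and $\tau_{i,\nu}$ when these act on $1_\nu M$. **$kH_n(\Gamma)\text{-}\mathrm{Mod}_0$**: the category of $kH_n(\Gamma)$-modules $M$ such that $M=\bigoplus_\nu1_\nu M$ and, for every $\nu$, the elements $x_{i,\nu}$ ($1\le i\le n$) act locally nilpotently on $1_\nu M$. **Degenerate affine Hecke algebra.** $\bar H_n=\mathbb Z[X_1,\dots,X_n]\otimes\mathbb Z\mathfrak S_n$ as an abelian group, both factors being subalgebras, $T_i$ denoting $s_i\in\mathfrak S_n$, with $T_iX_j=X_jT_i$ if $j-i\ne0,1$ and $T_iX_{i+1}-X_iT_i=1$. Put $k\bar H_n=k\otimes\bar H_n$. **$\bar{\mathcal C}_\Gamma$.** For a $k\bar H_n$-module $M$ and $a\in k^n$, $M_a$ is the $k[X_1,\dots,X_n]$-submodule of $M$ of elements with support contained in the closed point of $\mathbb A^n_k$ given by $a$. $\bar{\mathcal C}_\Gamma$ is the category of $k\bar H_n$-modules $M$ such that $M=\bigoplus_{a\in I^n}M_a$.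
   Formalization: The printed T_i violate the Hecke relations if char k≠2: here in the ''otherwise'' case the scalars on the −1 part use ν_i−ν_{i+1} instead of ν_{i+1}−ν_i, and for ν_{i+1}=ν_i−1 (char k≠2) the coefficient of τ_i is (y+1)(y−2)(y−1)^{-2}, y=x_i−x_{i+1}. *)

(* Defs.v *)
From HB Require Import structures.
From mathcomp Require Import all_boot all_order all_algebra all_fingroup.
From mathcomp Require Import generic_quotient.
From mathcomp Require Import mpoly.
From mathcomp Require Import boolp classical_sets.

Set Implicit Arguments.
Unset Strict Implicit.
Unset Printing Implicit Defensive.

Import GRing.Theory.
Local Open Scope ring_scope.
Local Open Scope quotient_scope.

Record category := Category {
  obj :> Type;
  hom : obj -> obj -> Type;
  idm : forall a, hom a a;
  comp : forall a b c, hom b c -> hom a b -> hom a c;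
  comp1m : forall a b (f : hom a b), comp (idm b) f = f;
  compm1 : forall a b (f : hom a b), comp f (idm a) = f;
  compmA : forall a b c d (f : hom c d) (g : hom b c) (h : hom a b),
    comp f (comp g h) = comp (comp f g) h }.

Record functor (C D : category) := Functor {
  fobj :> C -> D;
  fmap : forall a b, hom a b -> hom (fobj a) (fobj b);
  fmap_id : forall a, fmap (idm a) = idm (fobj a);
  fmap_comp : forall a b c (f : hom b c) (g : hom a b),
    fmap (comp f g) = comp (fmap f) (fmap g) }.

Definition functor_id (C : category) : functor C C :=
  @Functor C C id (fun _ _ f => f) (fun _ => erefl) (fun _ _ _ _ _ => erefl).

Section FunctorComp.
Variables (C D E : category) (G : functor D E) (F : functor C D).

Fact functor_comp_id a : fmap G (fmap F (idm a)) = idm (G (F a)).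
Proof. by rewrite !fmap_id. Qed.

Fact functor_comp_comp a b c (f : hom b c) (g : hom a b) :
  fmap G (fmap F (comp f g)) = comp (fmap G (fmap F f)) (fmap G (fmap F g)).
Proof. by rewrite !fmap_comp. Qed.

Definition functor_comp : functor C E :=
  @Functor C E (fun a => G (F a)) (fun _ _ f => fmap G (fmap F f))
    functor_comp_id functor_comp_comp.
End FunctorComp.

Definition nat_isomorphic (C D : category) (F G : functor C D) : Prop :=
  exists (u : forall a, hom (F a) (G a)) (v : forall a, hom (G a) (F a)),
    (forall a b (f : hom a b), comp (u b) (fmap F f) = comp (fmap G f) (u a)) /\
    (forall a, comp (v a) (u a) = idm (F a) /\ comp (u a) (v a) = idm (G a)).

Definition is_equivalence (C D : category) (F : functor C D) : Prop :=
  exists G : functor D C,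
    nat_isomorphic (functor_comp G F) (functor_id C) /\
    nat_isomorphic (functor_comp F G) (functor_id D).

(* [M] is the (internal, possibly infinite) direct sum of the subspaces [V j] *)
Definition direct_sum (k : fieldType) (M : lmodType k) (J : eqType)
    (V : J -> M -> Prop) : Prop :=
  (forall m, exists (s : seq J) (f : J -> M),
     (forall j, V j (f j)) /\ m = \sum_(j <- s) f j) /\
  (forall (s : seq J) (f : J -> M), uniq s -> (forall j, V j (f j)) ->
     \sum_(j <- s) f j = 0 -> forall j, j \in s -> f j = 0).

Section ModuleCategory.
Variables (k : fieldType) (B : Type) (T : Type) (space : T -> lmodType k).
Variable act : forall M : T, B -> space M -> space M.

Definition module_map (M N : T) (f : space M -> space N) : Prop :=
  linear f /\ forall b m, f (act b m) = act b (f m).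

Definition module_hom (M N : T) := {f : space M -> space N | module_map f}.

Fact module_hom_ext M N (f g : module_hom M N) : sval f = sval g -> f = g.
Proof.
by case: f g => [f hf] [g hg] /= e; case: _ / e hg => hg; congr exist;
  apply: Prop_irrelevance.
Qed.

Fact module_map_id M : @module_map M M id.
Proof. by []. Qed.

Fact module_map_comp M N P (f : module_hom N P) (g : module_hom M N) :
  module_map (sval f \o sval g).
Proof.
case: f g => [f [fl fa]] [g [gl ga]] /=; split => [c u v|b m] /=.
  by rewrite gl fl.
by rewrite ga fa.
Qed.

Definition module_comp M N P (f : module_hom N P) (g : module_hom M N) :
  module_hom M P := exist _ _ (module_map_comp f g).

Definition module_category : category.
Proof.
apply: (@Category T module_hom (fun M => exist _ _ (module_map_id M))
          module_comp) => *; exact: module_hom_ext.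
Defined.
End ModuleCategory.

Record nualg (k : fieldType) := NuAlg {
  nualg_sort :> lmodType k;
  nualg_mul : nualg_sort -> nualg_sort -> nualg_sort;
  nualg_mulA : associative nualg_mul;
  nualg_mul_linear_r : forall u, linear (nualg_mul u);
  nualg_mul_linear_l : forall u, linear (nualg_mul^~ u) }.

Notation "u ** v" := (nualg_mul u v) (at level 40, left associativity).

Record nualg_action (k : fieldType) (B : nualg k) (M : lmodType k) :=
  NuAlgAction {
    nu_act :> B -> M -> M;
    nu_act_linear_r : forall b, linear (nu_act b);
    nu_act_linear_l : forall m, linear (nu_act^~ m);
    nu_act_mul : forall b c m, nu_act (b ** c) m = nu_act b (nu_act c m) }.

(* The index [i : 'I_n.-1] of a simple transposition stands for the pair of
   adjacent positions [lo i] and [hi i] of ['I_n]. *)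
Definition lo n (i : 'I_n.-1) : 'I_n := widen_ord (leq_pred n) i.

Fact hi_subproof n (i : 'I_n.-1) : (i.+1 < n)%N.
Proof. by rewrite -ltn_predRL. Qed.

Definition hi n (i : 'I_n.-1) : 'I_n := Ordinal (hi_subproof i).

Definition simple n (i : 'I_n.-1) : 'S_n := tperm (lo i) (hi i).

Notation weight I n := {ffun 'I_n -> {z | z \in I}}.

Section Weights.
Variables (k : fieldType) (I : {pred k}) (n : nat).

Definition coordinate (nu : weight I n) (j : 'I_n) : k := val (nu j).

Definition permute (i : 'I_n.-1) (nu : weight I n) : weight I n :=
  [ffun j => nu (simple i j)].
End Weights.

Section QuiverPolynomials.
Variable k : fieldType.

(* number of arrows a -> b; only used for vertices a, b in I *)
Definition arrows (a b : k) : nat := if b == a + 1 then 1%N else 0%N.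

Definition klr_P (R : comNzRingType) (a b : k) (u v : R) : R :=
  (v - u) ^+ arrows a b.

Definition klr_Q (R : comNzRingType) (a b : k) (u v : R) : R :=
  if a == b then 0 else klr_P a b u v * klr_P b a v u.

Lemma klr_QE (R : comNzRingType) (a b : k) (u v : R) : a != b ->
  klr_Q a b u v =
  (-1) ^+ arrows a b * (u - v) ^+ (arrows a b + arrows b a)%N.
Proof.
move=> /negbTE ab; rewrite /klr_Q ab /klr_P -(opprB u v) (exprNn (u - v)).
by rewrite exprD mulrA.
Qed.

(* the divided difference in the braid relation is a polynomial *)
Lemma klr_Q_divided_difference (R : comNzRingType) (a b : k) (u v w : R) :
  exists D : R, (w - u) * D = klr_Q a b w v - klr_Q a b u v.
Proof.
have [->|ab] := eqVneq a b; first by exists 0; rewrite /klr_Q eqxx subrr mulr0.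
set m := (arrows a b + arrows b a)%N.
exists ((-1) ^+ arrows a b *
        \sum_(i < m) (w - v) ^+ (m.-1 - i) * (u - v) ^+ i).
rewrite !klr_QE // -mulrBr mulrCA; congr (_ * _).
by rewrite subrXX opprB addrA subrK.
Qed.
End QuiverPolynomials.

Section KLRRelations.
Variables (k : fieldType) (I : {pred k}) (n : nat).
Local Notation L := (weight I n).
Variables (B : nualg k) (e : L -> B) (x : 'I_n -> L -> B) (t : 'I_n.-1 -> L -> B).

(* p(x_{1,nu}, ..., x_{n,nu}) in 1_nu B 1_nu, whose unit is 1_nu *)
Definition klr_monomial (nu : L) (m : 'X_{1..n}) : B :=
  foldr (fun j b => iter (m j) (nualg_mul (x j nu)) b) (e nu) (enum 'I_n).

Definition klr_poly (nu : L) (p : {mpoly k[n]}) : B :=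
  \sum_(m <- msupp p) p@_m *: klr_monomial nu m.

Local Notation s := (@permute k I n).
Local Notation Q nu i j :=
  (@klr_Q k {mpoly k[n]} (coordinate nu i) (coordinate nu j)).

Record klr_relations : Prop := KlrRelations {
  klr_idem : forall nu nu', e nu ** e nu' = if nu == nu' then e nu else 0;
  klr_t_corner : forall i nu, t i nu = e (s i nu) ** t i nu ** e nu;
  klr_x_corner : forall a nu, x a nu = e nu ** x a nu ** e nu;
  klr_x_comm : forall a b nu, x a nu ** x b nu = x b nu ** x a nu;
  klr_quadratic : forall i nu,
    t i (s i nu) ** t i nu =
    klr_poly nu (Q nu (lo i) (hi i) 'X_(lo i) 'X_(hi i));
  klr_far : forall (i j : 'I_n.-1) (nu : L), (i.+1 < j)%N || (j.+1 < i)%N ->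
    t i (s j nu) ** t j nu = t j (s i nu) ** t i nu;
  klr_braid_eq : forall (i j : 'I_n.-1) (nu : L) (D : {mpoly k[n]}),
    j = i.+1 :> nat -> nu (lo i) = nu (hi j) ->
    ('X_(hi j) - 'X_(lo i)) * D =
      Q nu (lo i) (hi i) 'X_(hi j) 'X_(hi i) -
      Q nu (lo i) (hi i) 'X_(lo i) 'X_(hi i) ->
    t j (s i (s j nu)) ** t i (s j nu) ** t j nu -
    t i (s j (s i nu)) ** t j (s i nu) ** t i nu = klr_poly nu D;
  klr_braid_neq : forall (i j : 'I_n.-1) (nu : L),
    j = i.+1 :> nat -> nu (lo i) <> nu (hi j) ->
    t j (s i (s j nu)) ** t i (s j nu) ** t j nu -
    t i (s j (s i nu)) ** t j (s i nu) ** t i nu = 0;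
  klr_tx : forall i a (nu : L),
    t i nu ** x a nu - x (simple i a) (s i nu) ** t i nu =
    if nu (lo i) == nu (hi i) then
      if a == lo i then - e nu else if a == hi i then e nu else 0
    else 0 }.
End KLRRelations.

(* H_n(Gamma) as the algebra with these generators and relations: formal
   expressions in the generators, modulo the equalities that hold under every
   interpretation of the generators satisfying the relations. *)
Section KLRAlgebra.
Variables (k : fieldType) (I : {pred k}) (n : nat).
Local Notation L := (weight I n).

Inductive klr_term : Type :=
| TZero
| TAdd of klr_term & klr_term
| TOpp of klr_term
| TScale of k & klr_term
| TMul of klr_term & klr_term
| TIdem of L
| TX of 'I_n & L
| TT of 'I_n.-1 & L.

HB.instance Definition _ := gen_eqMixin klr_term.
HB.instance Definition _ := gen_choiceMixin klr_term.

Section Eval.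
Variables (B : nualg k) (e : L -> B) (x : 'I_n -> L -> B) (t : 'I_n.-1 -> L -> B).

Fixpoint klr_eval (r : klr_term) : B :=
  match r with
  | TZero => 0
  | TAdd r1 r2 => klr_eval r1 + klr_eval r2
  | TOpp r1 => - klr_eval r1
  | TScale c r1 => c *: klr_eval r1
  | TMul r1 r2 => klr_eval r1 ** klr_eval r2
  | TIdem nu => e nu
  | TX a nu => x a nu
  | TT i nu => t i nu
  end.
End Eval.

Definition klr_equal (r1 r2 : klr_term) : Prop :=
  forall (B : nualg k) (e : L -> B) x t, klr_relations e x t ->
    klr_eval e x t r1 = klr_eval e x t r2.

Definition klr_equalb (r1 r2 : klr_term) : bool := `[< klr_equal r1 r2 >].

Fact klr_equal_equiv : equiv_class_of klr_equalb.
Proof.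
split=> [r|r1 r2|r1 r2 r3]; first exact/asboolP.
  by apply: asbool_equiv_eq; split=> h B e x t R; rewrite h.
by move=> /asboolP h1 /asboolP h2; apply/asboolP => B e x t R; rewrite h1 ?h2.
Qed.

Canonical klr_equiv := EquivRelPack klr_equal_equiv.

Definition klr_carrier := {eq_quot klr_equiv}.

HB.instance Definition _ := Choice.on klr_carrier.
HB.instance Definition _ := EqQuotient.on klr_carrier.

Definition klr_class (r : klr_term) : klr_carrier := \pi_klr_carrier r.

Definition klr_interp (B : nualg k) (e : L -> B) x t (u : klr_carrier) : B :=
  klr_eval e x t (repr u).

Lemma klr_interpE (B : nualg k) (e : L -> B) x t r : klr_relations e x t ->
  klr_interp e x t (klr_class r) = klr_eval e x t r.
Proof.
move=> R; rewrite /klr_interp /klr_class; case: piP => r' /eqmodP /asboolP h.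
by rewrite (h _ _ _ _ R).
Qed.

Lemma klr_ext (u v : klr_carrier) :
  (forall (B : nualg k) (e : L -> B) x t, klr_relations e x t ->
     klr_interp e x t u = klr_interp e x t v) -> u = v.
Proof.
elim/quotW: u => r1; elim/quotW: v => r2 h.
apply/eqmodP/asboolP => B e x t R.
by rewrite -!klr_interpE // /klr_class h.
Qed.

Definition klr_zero := klr_class TZero.
Definition klr_add (u v : klr_carrier) := klr_class (TAdd (repr u) (repr v)).
Definition klr_opp (u : klr_carrier) := klr_class (TOpp (repr u)).
Definition klr_scale c (u : klr_carrier) := klr_class (TScale c (repr u)).
Definition klr_mul (u v : klr_carrier) := klr_class (TMul (repr u) (repr v)).

Section Interp.
Variables (B : nualg k) (e : L -> B) (x : 'I_n -> L -> B) (t : 'I_n.-1 -> L -> B).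
Hypothesis R : klr_relations e x t.
Local Notation F := (klr_interp e x t).

Lemma klr_interp_zero : F klr_zero = 0. Proof. exact: klr_interpE. Qed.
Lemma klr_interp_add u v : F (klr_add u v) = F u + F v.
Proof. exact: klr_interpE. Qed.
Lemma klr_interp_opp u : F (klr_opp u) = - F u. Proof. exact: klr_interpE. Qed.
Lemma klr_interp_scale c u : F (klr_scale c u) = c *: F u.
Proof. exact: klr_interpE. Qed.
Lemma klr_interp_mul u v : F (klr_mul u v) = F u ** F v.
Proof. exact: klr_interpE. Qed.
End Interp.

Let klr_interp_ops := (klr_interp_zero, klr_interp_add, klr_interp_opp,
  klr_interp_scale, klr_interp_mul).

Fact klr_addA : associative klr_add.
Proof. by move=> u v w; apply: klr_ext => *; rewrite !klr_interp_ops // addrA. Qed.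
Fact klr_addC : commutative klr_add.
Proof. by move=> u v; apply: klr_ext => *; rewrite !klr_interp_ops // addrC. Qed.
Fact klr_add0 : left_id klr_zero klr_add.
Proof. by move=> u; apply: klr_ext => *; rewrite !klr_interp_ops // add0r. Qed.
Fact klr_addN : left_inverse klr_zero klr_opp klr_add.
Proof. by move=> u; apply: klr_ext => *; rewrite !klr_interp_ops // addNr. Qed.

HB.instance Definition _ :=
  GRing.isZmodule.Build klr_carrier klr_addA klr_addC klr_add0 klr_addN.

Fact klr_scaleA a b v : klr_scale a (klr_scale b v) = klr_scale (a * b) v.
Proof. by apply: klr_ext => *; rewrite !klr_interp_ops // scalerA. Qed.
Fact klr_scale1 : left_id 1 klr_scale.
Proof. by move=> u; apply: klr_ext => *; rewrite !klr_interp_ops // scale1r. Qed.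
Fact klr_scaleDr : right_distributive klr_scale klr_add.
Proof. by move=> a u v; apply: klr_ext => *; rewrite !klr_interp_ops // scalerDr. Qed.
Fact klr_scaleDl v : {morph klr_scale^~ v : a b / a + b >-> a + b}.
Proof.
by move=> a b; apply: klr_ext => *; rewrite klr_interp_add // !klr_interp_ops // scalerDl.
Qed.

HB.instance Definition _ := GRing.Zmodule_isLmodule.Build k klr_carrier
  klr_scaleA klr_scale1 klr_scaleDr klr_scaleDl.

Lemma klr_interp_linear (B : nualg k) (e : L -> B) x t : klr_relations e x t ->
  linear (klr_interp e x t).
Proof. by move=> R c u v; rewrite klr_interp_add // klr_interp_scale. Qed.

Fact klr_mulA : associative klr_mul.
Proof. by move=> u v w; apply: klr_ext => *; rewrite !klr_interp_ops // nualg_mulA. Qed.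
Fact klr_mul_linear_r u : linear (klr_mul u).
Proof.
move=> c v w; apply: klr_ext => B e x t R.
by rewrite klr_interp_linear // !klr_interp_mul // klr_interp_linear //
  nualg_mul_linear_r.
Qed.
Fact klr_mul_linear_l u : linear (klr_mul^~ u).
Proof.
move=> c v w; apply: klr_ext => B e x t R.
by rewrite klr_interp_linear // !klr_interp_mul // klr_interp_linear //
  nualg_mul_linear_l.
Qed.

Definition klr_alg : nualg k :=
  @NuAlg k klr_carrier klr_mul klr_mulA klr_mul_linear_r klr_mul_linear_l.

Definition klr_e (nu : L) : klr_alg := klr_class (TIdem nu).
Definition klr_x (a : 'I_n) (nu : L) : klr_alg := klr_class (TX a nu).
Definition klr_t (i : 'I_n.-1) (nu : L) : klr_alg := klr_class (TT i nu).

Section Universal.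
Variables (B : nualg k) (e : L -> B) (x : 'I_n -> L -> B) (t : 'I_n.-1 -> L -> B).
Hypothesis R : klr_relations e x t.
Local Notation F := (klr_interp e x t : klr_alg -> B).

Lemma klr_interp_nualg_mul (u v : klr_alg) : F (u ** v) = F u ** F v.
Proof. exact: klr_interp_mul. Qed.
Lemma klr_interp0 : F 0 = 0. Proof. exact: klr_interp_zero. Qed.
Lemma klr_interpD (u v : klr_alg) : F (u + v) = F u + F v.
Proof. exact: klr_interp_add. Qed.
Lemma klr_interpN (u : klr_alg) : F (- u) = - F u.
Proof. exact: klr_interp_opp. Qed.
Lemma klr_interpZ c (u : klr_alg) : F (c *: u) = c *: F u.
Proof. exact: klr_interp_scale. Qed.
Lemma klr_interp_e nu : F (klr_e nu) = e nu. Proof. exact: klr_interpE. Qed.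
Lemma klr_interp_x a nu : F (klr_x a nu) = x a nu. Proof. exact: klr_interpE. Qed.
Lemma klr_interp_t i nu : F (klr_t i nu) = t i nu. Proof. exact: klr_interpE. Qed.

Lemma klr_interp_poly nu p : F (klr_poly klr_e klr_x nu p) = klr_poly e x nu p.
Proof.
rewrite /klr_poly (big_morph F klr_interpD klr_interp0); apply: eq_bigr => m _.
rewrite klr_interpZ; congr (_ *: _); rewrite /klr_monomial.
elim: (enum 'I_n) => [|a r IH] /=; first exact: klr_interp_e.
elim: (m a) => [|d IHd] //=.
by rewrite klr_interp_nualg_mul klr_interp_x IHd.
Qed.
End Universal.

Lemma klr_alg_relations : klr_relations klr_e klr_x klr_t.
Proof.
pose ops := (klr_interp_nualg_mul, klr_interp0, klr_interpD, klr_interpN,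
  klr_interp_e, klr_interp_x, klr_interp_t, klr_interp_poly).
split.
- move=> nu nu'; apply: klr_ext => B e x t R.
  by rewrite (fun_if (klr_interp e x t)) !ops // (klr_idem R).
- move=> i nu; apply: klr_ext => B e x t R.
  by rewrite !ops // -(klr_t_corner R).
- move=> a nu; apply: klr_ext => B e x t R.
  by rewrite !ops // -(klr_x_corner R).
- move=> a b nu; apply: klr_ext => B e x t R.
  by rewrite !ops // (klr_x_comm R).
- move=> i nu; apply: klr_ext => B e x t R.
  by rewrite !ops // (klr_quadratic R).
- move=> i j nu ij; apply: klr_ext => B e x t R.
  by rewrite !ops // (klr_far R).
- move=> i j nu D ij nuij hD; apply: klr_ext => B e x t R.
  by rewrite !ops // (klr_braid_eq R ij nuij hD).
- move=> i j nu ij nuij; apply: klr_ext => B e x t R.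
  by rewrite !ops // (klr_braid_neq R ij nuij).
- move=> i a nu; apply: klr_ext => B e x t R.
  rewrite !(fun_if (klr_interp e x t)) !ops //; exact: (klr_tx R).
Qed.
End KLRAlgebra.

Arguments klr_alg {k} I n.
Arguments klr_e {k I n}.
Arguments klr_x {k I n}.
Arguments klr_t {k I n}.

Section KLRMod0.
Variables (k : fieldType) (I : {pred k}) (n : nat).

(* m lies in 1_nu M *)
Definition weight_space (M : lmodType k) (act : nualg_action (klr_alg I n) M)
    (nu : weight I n) (m : M) : Prop :=
  exists m', m = act (klr_e nu) m'.

Record klr_mod0 := KlrMod0 {
  klr_space :> lmodType k;
  klr_act : nualg_action (klr_alg I n) klr_space;
  klr_mod0_sum : direct_sum (weight_space klr_act);
  klr_mod0_nilp : forall nu (i : 'I_n) (m : klr_space),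
    weight_space klr_act nu m ->
    exists N, iter N (klr_act (klr_x i nu)) m = 0 }.

Definition klr_mod0_category : category :=
  @module_category k (klr_alg I n) klr_mod0 klr_space klr_act.
End KLRMod0.

(* k \bar H_n: an algebra containing k[X_1,...,X_n] and k S_n as subalgebras,
   such that multiplication k[X_1,...,X_n] (x) k S_n -> dah_alg is bijective
   ([dah_basis]; the tensors are the families [c] of polynomials indexed by
   S_n), and subject to the two mixed relations.  These data are unique up to
   unique isomorphism. *)
Record deg_affine_hecke (k : fieldType) (n : nat) := DegAffineHecke {
  dah_alg :> algType k;
  dah_pol : {lrmorphism {mpoly k[n]} -> dah_alg};
  dah_perm : 'S_n -> dah_alg;
  dah_perm1 : dah_perm 1%g = 1;
  dah_permM : forall v w, dah_perm (v * w)%g = dah_perm v * dah_perm w;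
  dah_basis : forall h : dah_alg, exists! c : {ffun 'S_n -> {mpoly k[n]}},
    h = \sum_(w : 'S_n) dah_pol (c w) * dah_perm w;
  dah_TX_comm : forall (i : 'I_n.-1) (j : 'I_n), j != lo i -> j != hi i ->
    dah_perm (simple i) * dah_pol 'X_j = dah_pol 'X_j * dah_perm (simple i);
  dah_TX : forall i : 'I_n.-1,
    dah_perm (simple i) * dah_pol 'X_(hi i) -
    dah_pol 'X_(lo i) * dah_perm (simple i) = 1 }.

Definition dah_X k n (A : deg_affine_hecke k n) (j : 'I_n) : A := dah_pol A 'X_j.
Definition dah_T k n (A : deg_affine_hecke k n) (i : 'I_n.-1) : A :=
  dah_perm A (simple i).

Record alg_action (k : fieldType) (A : algType k) (M : lmodType k) :=
  AlgAction {
    al_act :> A -> M -> M;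
    al_act_linear_r : forall a, linear (al_act a);
    al_act_linear_l : forall m, linear (al_act^~ m);
    al_act1 : forall m, al_act 1 m = m;
    al_act_mul : forall a b m, al_act (a * b) m = al_act a (al_act b m) }.

Section Support.
Variables (k : fieldType) (n : nat).

Definition prime_ideal (P : {mpoly k[n]} -> Prop) : Prop :=
  [/\ P 0, forall p q, P p -> P q -> P (p + q), forall p q, P q -> P (p * q),
      ~ P 1 & forall p q, P (p * q) -> P p \/ P q].

Definition point_ideal (a : 'I_n -> k) (p : {mpoly k[n]}) : Prop := p.@[a] = 0.

Variables (A : deg_affine_hecke k n) (M : lmodType k) (act : alg_action A M).

(* P lies in the support V(Ann m) of m *)
Definition in_support (m : M) (P : {mpoly k[n]} -> Prop) : Prop :=
  prime_ideal P /\ forall p, act (dah_pol A p) m = 0 -> P p.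

Definition supported_at (a : 'I_n -> k) (m : M) : Prop :=
  forall P, in_support m P -> forall p, P p <-> point_ideal a p.
End Support.

Section CBar.
Variables (k : fieldType) (I : {pred k}) (n : nat) (A : deg_affine_hecke k n).

Record cbar_structure (M : lmodType k) := CbarStructure {
  cbar_act :> alg_action A M;
  cbar_sum : direct_sum
    (fun a : weight I n => supported_at cbar_act (coordinate a)) }.

Record cbar := Cbar {
  cbar_space :> lmodType k;
  cbar_str : cbar_structure cbar_space }.

Definition cbar_category : category :=
  @module_category k A cbar cbar_space (fun M => cbar_str M).

(* A functor kH_n(Gamma)-Mod_0 -> \bar C_Gamma of the form M |-> M: the vector
   spaces and the maps are unchanged, only the algebra acting is. *)
Section SameSpace.
Variable S : forall M : klr_mod0 I n, cbar_structure M.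

Definition same_space_obj (M : klr_mod0_category I n) : cbar_category :=
  Cbar (S M).

Definition preserves_maps : Prop :=
  forall (M N : klr_mod0_category I n) (f : hom M N) (a : A) (m : klr_space M),
    sval f (S M a m) = S N a (sval f m).

Hypothesis HS : preserves_maps.

Definition same_space_fmap (M N : klr_mod0_category I n) (f : hom M N) :
    hom (same_space_obj M) (same_space_obj N) :=
  exist _ (sval f) (conj (proj1 (svalP f)) (HS f)).

Definition same_space_functor : functor (klr_mod0_category I n) cbar_category.
Proof.
apply: (@Functor _ _ same_space_obj same_space_fmap) => *;
  exact: module_hom_ext.
Defined.
End SameSpace.
End CBar.

Section Formulas.
Variables (k : fieldType) (I : {pred k}) (n : nat) (M : klr_mod0 I n).
Local Notation L := (weight I n).
Local Notation act := (klr_act M).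

(* x_i - x_{i+1} + c on 1_nu M *)
Definition xdiff (i : 'I_n.-1) (nu : L) (c : k) (m : M) : M :=
  act (klr_x (lo i) nu) m - act (klr_x (hi i) nu) m + c *: m.

(* The inverse of x_i - x_{i+1} + c on 1_nu M; for c != 0 that operator is
   bijective there, the x's being commuting and locally nilpotent. *)
Definition xdiff_inv (i : 'I_n.-1) (nu : L) (c : k) (m : M) : M :=
  xget 0 [set u | weight_space act nu u /\ xdiff i nu c u = m].

Definition X_formula (j : 'I_n) (nu : L) (m : M) : M :=
  act (klr_x j nu) m + coordinate nu j *: m.

(* The action of T_i on m in 1_nu M, where tau_i m lies in 1_{s_i(nu)} M.  Write
   y = x_i - x_{i+1} and d = nu_{i+1} - nu_i.
   - In R (tau_i - 1) with R a rational function of y, R acts on tau_i m as an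
     operator on 1_{s_i(nu)} M and on m as an operator on 1_nu M.
   - X_i - X_{i+1} acts as y - d on 1_nu M and as y + d on 1_{s_i(nu)} M, so the
     last formula is
       (X_i - X_{i+1} + 1) (X_i - X_{i+1})^{-1} (tau_i - 1) + 1.
     With y + d on both summands, T_i X_{i+1} - X_i T_i = 1 would fail.
   - For d = -1 the coefficient y (y - 1)^{-1} of tau_i given by the last formula
     is not invertible and contradicts T_i^2 = 1.  As tau_i^2 = x_{i+1} - x_i for
     d = 1 <> -1, the formula for d = 1 and T_i^2 = 1 force the coefficient
     (y + 1) (y - 2) (y - 1)^{-2}. *)
Definition T_formula (i : 'I_n.-1) (nu : L) (m : M) : M :=
  let nu' := permute i nu in
  let tm := act (klr_t i nu) m in
  let d := coordinate nu (hi i) - coordinate nu (lo i) in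
  if d == 0 then xdiff i nu 1 tm + m
  else if d == 1 then xdiff_inv i nu' (- 1) tm - xdiff_inv i nu (- 1) m
  else if d == - 1 then
    xdiff i nu' 1 (xdiff i nu' (- 2) (xdiff_inv i nu' (- 1) (xdiff_inv i nu' (- 1) tm)))
    - xdiff i nu (- d + 1) (xdiff_inv i nu (- d) m) + m
  else
    xdiff i nu' (d + 1) (xdiff_inv i nu' d tm)
    - xdiff i nu (- d + 1) (xdiff_inv i nu (- d) m) + m.
End Formulas.

(* Main.v *)
Require Import Defs.
From HB Require Import structures.
From mathcomp Require Import all_boot all_order all_algebra all_fingroup.
From mathcomp Require Import generic_quotient.
From mathcomp Require Import ssrcomplements mpoly boolp classical_sets.
From mathcomp Require Import ring zify.
Set Implicit Arguments.
Unset Strict Implicit.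
Unset Printing Implicit Defensive.
Import GRing.Theory.

(** Modules in both categories are modules over the polynomials in
    [X_1, ..., X_n] that are direct sums of generalized eigenspaces [W_nu], for
    [nu] in [I^n].  In the source category [X_j] is [x_j + nu_j] on [1_nu M], and
    local nilpotency of the [x_j] makes [1_nu M] equal to [W_nu]
    ([weight_space_wspace]).  In the target category the support condition on a
    vector says that it lies in [W_nu], because the radical of its annihilator is
    the intersection of the primes containing it ([supported_atE]).  So the
    polynomial part and the decomposition are common to both sides, and what has
    to be compared are the operators [tau_i] and [T_i].

    On [W_nu] every polynomial that is nonzero at [nu] is invertible, so the local
    ring of rational functions regular at [nu] acts there ([frac_act]).  The
    formulas of the theorem then read [T_i = A tau_i + B] on [W_nu], where [A] and
    [B] are the values [tau_coef] and [const_coef] of rational functions in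
    [X_i - X_{i+1}] depending on [nu_{i+1} - nu_i] ([T_formulaE]); here [A] is
    applied after [tau_i], hence on [W_(s_i nu)].  If [nu_i] and [nu_{i+1}] differ,
    [B] has a pole only along [X_i = X_{i+1}], which does not contain [nu]; if they
    agree, [B = 1].  The function [A] has neither a zero nor a pole at [s_i nu]
    ([regular_tau_coef]), so [tau_i] can be recovered from [T_i].

    Both operators satisfy a commutation rule with rational functions: moving [f]
    across applies [s_i] to it and adds a Demazure term, always for [T_i], and only
    for [nu_i = nu_{i+1}] for [tau_i]; the two rules correspond to each other
    ([right_coef_hecke]).  Granting them, expand a relation for the [T_i] in terms
    of the [tau_i], with rational functions on the left.  The difference of its two
    sides is an invertible function times the difference of the two sides of the
    same relation for the [tau_i] ([related_quad], [related_far],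
    [related_braid]); for the braid relation this is an identity between
    coefficients, checked in an arbitrary field for each pattern of coincidences
    among the three weights involved ([braid_coefficientsP]).  Hence operators
    [tau_i] satisfying the relations of the one algebra and operators [T_i]
    satisfying those of the other determine each other ([hecke_of_klr],
    [klr_of_hecke]).

    Operators satisfying the relations are the same as actions of the algebras.
    For the degenerate affine Hecke algebra this uses its basis over the
    polynomials and the Coxeter presentation of the symmetric group
    ([action_of_operators], [coxeter_representation]); for the quiver Hecke algebra
    it is the universal property, applied to the endomorphisms of the space
    ([klr_of_operators]).  The resulting functor changes neither spaces nor maps.
    A linear map commutes with one action if and only if it commutes with the other
    ([hecke_map_of_klr_map], [klr_map_of_hecke_map]), so it is fully faithful; and
    every object of the target comes from a structure on the same space
    ([exists_klr]). *)

(** * Adjacent transpositions of positions *)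

Section AdjacentPositions.
Variable n : nat.
Implicit Types i j : 'I_n.-1.

Definition far i j := (i.+1 < j)%N || (j.+1 < i)%N.

Lemma lo_succ i j : j = i.+1 :> nat -> lo j = hi i.
Proof. by move=> ij; apply: val_inj. Qed.

Lemma far_sym i j : far i j = far j i.
Proof. by rewrite /far orbC. Qed.

Lemma simple_lo i : simple i (lo i) = hi i. Proof. exact: tpermL. Qed.
Lemma simple_hi i : simple i (hi i) = lo i. Proof. exact: tpermR. Qed.
Lemma simple_out i a : a != lo i -> a != hi i -> simple i a = a.
Proof. by move=> al ah; rewrite /simple tpermD // eq_sym. Qed.

Lemma far_lo i j : far i j -> simple i (lo j) = lo j.
Proof. by rewrite /far => ij; apply: simple_out; rewrite -val_eqE /=; lia. Qed.

Lemma far_hi i j : far i j -> simple i (hi j) = hi j.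
Proof. by rewrite /far => ij; apply: simple_out; rewrite -val_eqE /=; lia. Qed.

Lemma succ_simple_lo i j : j = i.+1 :> nat -> simple j (lo i) = lo i.
Proof. by move=> ij; apply: simple_out; rewrite -val_eqE /=; lia. Qed.

Lemma succ_simple_hi i j : j = i.+1 :> nat -> simple i (hi j) = hi j.
Proof. by move=> ij; apply: simple_out; rewrite -val_eqE /=; lia. Qed.

Lemma simple_braid i j : j = i.+1 :> nat ->
  (simple i * simple j * simple i = simple j * simple i * simple j)%g.
Proof.
move=> ij; have lh : lo i != hi j by rewrite -val_eqE /= ij neq_ltn ltnS leqnSn.
have V (l : 'I_n.-1) : (simple l)^-1%g = simple l by rewrite /simple tpermV.
transitivity (tperm (lo i) (hi j)).
  transitivity (simple j ^ simple i)%g; first by rewrite conjgE V mulgA.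
  rewrite {1}/simple tpermJ (lo_succ ij) simple_hi succ_simple_hi //.
transitivity (simple i ^ simple j)%g; last by rewrite conjgE V mulgA.
by rewrite {1}/simple tpermJ succ_simple_lo // -(lo_succ ij) simple_lo.
Qed.

Lemma simple_far i j : far i j -> (simple i * simple j = simple j * simple i)%g.
Proof.
move=> ij; have V (l : 'I_n.-1) : (simple l)^-1%g = simple l by rewrite /simple tpermV.
apply/commgP/conjg_fixP; rewrite {1}/simple tpermJ.
by rewrite far_lo ?far_hi 1?far_sym.
Qed.
End AdjacentPositions.

(** * The Coxeter presentation of the symmetric group *)

Section CoxeterWords.
Variable N : nat.
Implicit Types (u v w : seq nat).

(** A word is a list of natural numbers, the letter [i] standing for the
    transposition of [i] and [i + 1].  Two words are identified when they act
    equally in every model of the Coxeter relations. *)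
Record coxeter (X : Type) (T : nat -> X -> X) : Prop := Coxeter {
  cox_quad : forall i x, i < N -> T i (T i x) = x;
  cox_far : forall i j x, i < N -> j < N -> i.+1 < j -> T i (T j x) = T j (T i x);
  cox_braid : forall i x, i.+1 < N -> T i (T i.+1 (T i x)) = T i.+1 (T i (T i.+1 x)) }.

Definition word_act (X : Type) (T : nat -> X -> X) u x := foldr T x u.

Definition word_eq u v : Prop :=
  forall (X : Type) (T : nat -> X -> X), coxeter T ->
    forall x, word_act T u x = word_act T v x.

Lemma word_act_cat X (T : nat -> X -> X) u v x :
  word_act T (u ++ v) x = word_act T u (word_act T v x).
Proof. exact: foldr_cat. Qed.

Definition bounded m u := all (fun i => i < m) u.

Lemma word_far i u : i < N -> bounded N u ->
  all (fun j => (i.+1 < j) || (j.+1 < i)) u -> word_eq (i :: u) (rcons u i).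
Proof.
move=> iN + + X T cT x; elim: u => //= j u IH /andP[jN uN] /andP[ij iu].
rewrite -[RHS]/(T j _) -(IH uN iu) /=; case/orP: ij => ij.
  exact: (cox_far cT).
exact: esym (cox_far cT _ jN iN ij).
Qed.

(** Only two steps are not commutations: [i] meets [i - 1], [i] and the braid
    relation turns [i, i - 1, i] into [i - 1, i, i - 1]. *)
Lemma word_slide p i m : p < i -> i < m -> m <= N ->
  word_eq (i :: iota p (m - p)) (rcons (iota p (m - p)) i.-1).
Proof.
move=> pi im mN.
have -> : iota p (m - p) = iota p (i.-1 - p) ++ [:: i.-1; i] ++ iota i.+1 (m - i.+1).
  have -> : m - p = (i.-1 - p) + (2 + (m - i.+1)) by lia.
  rewrite iotaD iotaD; congr (_ ++ (_ ++ _)).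
    by rewrite /=; congr [:: _; _]; lia.
  by congr iota; lia.
move=> X T cT x; rewrite -cats1 -cat1s !word_act_cat.
have h1 y : word_act T [:: i] (word_act T (iota p (i.-1 - p)) y) =
    word_act T (iota p (i.-1 - p)) (word_act T [:: i] y).
  rewrite -!word_act_cat cats1 cat1s; apply: word_far => //; first by lia.
    by apply/allP => j; rewrite mem_iota; lia.
  by apply/allP => j; rewrite mem_iota; lia.
have h2 y : word_act T [:: i.-1] (word_act T (iota i.+1 (m - i.+1)) y) =
    word_act T (iota i.+1 (m - i.+1)) (word_act T [:: i.-1] y).
  rewrite -!word_act_cat cats1 cat1s; apply: word_far => //; first by lia.
    by apply/allP => j; rewrite mem_iota; lia.
  by apply/allP => j; rewrite mem_iota; lia.
rewrite h1 -h2 /=; congr (word_act T _ _).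
case: i pi im {h1 h2} => // i pi im /=.
by rewrite -(cox_braid cT) //; lia.
Qed.

(** Multiplying a normal form on the left by a letter shortens the cycle, extends
    it, or passes through it. *)
Lemma word_normal_form m u : m <= N -> bounded m u ->
  exists p u', [/\ p <= m, bounded m.-1 u' & word_eq u (iota p (m - p) ++ u')].
Proof.
move=> mN; elim: u => [_|i u IH /= /andP[im /IH[p [u' [pm bu' e]]]]].
  by exists m, [::]; rewrite subnn.
have ei : word_eq (i :: u) (i :: iota p (m - p) ++ u').
  by move=> X T cT x /=; rewrite (e X T cT).
have [lt|gt|eq] := ltngtP i p.
- have [ip|ip] := ltnP i.+1 p; last first.
    have ep : p = i.+1 by lia.
    exists i, u'; split=> //; first by lia.
    have -> : m - i = (m - p).+1 by lia.
    by rewrite /= -ep.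
  exists p, (i :: u'); split=> //=; first by rewrite bu' andbT; lia.
  have slide : word_eq (i :: iota p (m - p)) (rcons (iota p (m - p)) i).
    by apply: word_far; [lia| |]; apply/allP => j; rewrite mem_iota; lia.
  move=> X T cT x; rewrite (ei X T cT) -[i :: _]cat_cons word_act_cat (slide X T cT).
  by rewrite -cats1 !word_act_cat.
- exists p, (i.-1 :: u'); split=> //=; first by rewrite bu' andbT; lia.
  move=> X T cT x; rewrite (ei X T cT) -[i :: _]cat_cons word_act_cat (word_slide gt im mN cT).
  by rewrite -cats1 !word_act_cat.
exists p.+1, u'; split=> //; first by lia.
move=> X T cT x; rewrite (ei X T cT) eq.
have -> : m - p = (m - p.+1).+1 by lia.
by rewrite /= (cox_quad cT) //; lia.
Qed.

Definition swap (i x : nat) : nat :=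
  if x == i then i.+1 else if x == i.+1 then i else x.

Let swapE i x : x = i /\ swap i x = i.+1 \/ x = i.+1 /\ swap i x = i
  \/ x <> i /\ x <> i.+1 /\ swap i x = x.
Proof.
rewrite /swap; case: eqP => [->|xi]; first by left.
by case: eqP => [->|xi']; right; [left|right].
Qed.

Lemma swap_coxeter : coxeter swap.
Proof.
split=> [i x _|i j x _ _ ij|i x _].
- by move: (swapE i x) (swapE i (swap i x)); lia.
- by move: (swapE i x) (swapE j x) (swapE i (swap j x)) (swapE j (swap i x)); lia.
move: (swapE i x) (swapE i.+1 (swap i x)) (swapE i (swap i.+1 (swap i x))).
by move: (swapE i.+1 x) (swapE i (swap i.+1 x)) (swapE i.+1 (swap i (swap i.+1 x))); lia.
Qed.

Lemma swapK i : involutive (swap i).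
Proof. by move=> x; move: (swapE i x) (swapE i (swap i x)); lia. Qed.

Lemma word_swap_fixed m u x : bounded m u -> m < x -> word_act swap u x = x.
Proof.
elim: u => //= i u IH /andP[im /IH{}IH] mx; rewrite IH //.
by move: (swapE i x); lia.
Qed.

Lemma word_swap_cycle p d : word_act swap (iota p d) (p + d) = p.
Proof.
elim: d p => [|d IH] p; first exact: addn0.
by rewrite /= addnS -addSn IH; move: (swapE p p.+1); lia.
Qed.

Lemma word_swap_inj u : injective (word_act swap u).
Proof. by elim: u => //= i u IH x y /(can_inj (swapK i)) /IH. Qed.

(** The permutation given by a word determines its normal form, since [p] is the
    image of the last point; so equal permutations give equal actions. *)
Lemma word_eqP m u v : m <= N -> bounded m u -> bounded m v ->
  word_act swap u =1 word_act swap v -> word_eq u v.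
Proof.
elim: m u v => [|m IH] u v mN bu bv uv.
  by case: u bu {uv} => //; case: v bv.
have [p [u' [pm bu' eu]]] := word_normal_form mN bu.
have [q [v' [qm bv' ev]]] := word_normal_form mN bv.
have pE : word_act swap u m.+1 = p.
  rewrite (eu _ _ swap_coxeter) word_act_cat (word_swap_fixed bu') //.
  by rewrite -{2}(subnKC pm) word_swap_cycle.
have qE : word_act swap v m.+1 = q.
  rewrite (ev _ _ swap_coxeter) word_act_cat (word_swap_fixed bv') //.
  by rewrite -{2}(subnKC qm) word_swap_cycle.
have pq : p = q by rewrite -pE -qE uv.
have uv' : word_eq u' v'.
  apply: IH => //; first exact: ltnW.
  move=> x; apply: (@word_swap_inj (iota p (m.+1 - p))).
  rewrite -!word_act_cat -(eu _ _ swap_coxeter) uv (ev _ _ swap_coxeter).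
  by rewrite pq.
by move=> X T cT x; rewrite (eu _ _ cT) (ev _ _ cT) pq !word_act_cat uv'.
Qed.
End CoxeterWords.

Section SymmetricGroup.
Variable n : nat.

(** Letters out of range act trivially, so that words need no dependent types. *)
Definition extend_letters (X : Type) (T : 'I_n.-1 -> X -> X) (j : nat) (x : X) : X :=
  if insub j is Some i then T i x else x.

Lemma extend_lettersE X (T : 'I_n.-1 -> X -> X) (i : 'I_n.-1) : extend_letters T i = T i.
Proof. by rewrite /extend_letters; apply/funext => x; rewrite valK. Qed.

Lemma coxeter_extend X (T : 'I_n.-1 -> X -> X) :
  (forall i x, T i (T i x) = x) ->
  (forall i j x, far i j -> T i (T j x) = T j (T i x)) ->
  (forall (i j : 'I_n.-1) x, j = i.+1 :> nat -> T j (T i (T j x)) = T i (T j (T i x))) ->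
  coxeter n.-1 (extend_letters T).
Proof.
move=> Tq Tf Tb; split=> [i x hi|i j x hi hj ij|i x hi].
- by rewrite -[i]/(val (Ordinal hi)) !extend_lettersE.
- rewrite -[i]/(val (Ordinal hi)) -[j]/(val (Ordinal hj)) !extend_lettersE.
  by apply: Tf; rewrite /far /= ij.
rewrite -[i.+1]/(val (Ordinal hi)) -[i]/(val (Ordinal (ltnW hi))) !extend_lettersE.
by rewrite [RHS]Tb.
Qed.

Definition word_perm u : 'S_n :=
  word_act (extend_letters (fun i (s : 'S_n) => (simple i * s)%g)) u 1%g.

Lemma word_perm_act u s :
  word_act (extend_letters (fun i (s : 'S_n) => (simple i * s)%g)) u s = (word_perm u * s)%g.
Proof.
rewrite /word_perm; elim: u => [|j u IH] /=; first by rewrite mul1g.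
rewrite IH /extend_letters; by case: insubP => [i _ _|_] /=; rewrite ?mulgA.
Qed.

Lemma word_perm_cat u v : word_perm (u ++ v) = (word_perm u * word_perm v)%g.
Proof. by rewrite {1}/word_perm word_act_cat word_perm_act. Qed.

Lemma word_perm_cons (i : 'I_n.-1) u : word_perm (val i :: u) = (simple i * word_perm u)%g.
Proof. by rewrite {1}/word_perm /= extend_lettersE. Qed.

(** The product of permutations composes them from left to right, and words act
    from right to left, whence the inverse. *)
Lemma word_permV u (x : 'I_n) : bounded n.-1 u ->
  word_act swap u x = (word_perm u)^-1%g x :> nat.
Proof.
elim: u => [_|j u IH /andP[jn bu]]; first by rewrite /word_perm /= invg1 perm1.
have -> : word_perm (j :: u) = (simple (Ordinal jn) * word_perm u)%g.
  exact: word_perm_cons (Ordinal jn) u.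
rewrite invMg permM -[LHS]/(swap j (word_act swap u x)) (IH bu).
have -> : ((simple (Ordinal jn))^-1)%g = simple (Ordinal jn) by rewrite /simple tpermV.
set y := ((word_perm u)^-1)%g x; rewrite /swap /simple; case: tpermP => [->|->|/eqP h1 /eqP h2].
- by rewrite /= eqxx.
- by rewrite /= eqxx gtn_eqF.
by rewrite -!val_eqE /= in h1 h2; rewrite (negbTE h1) (negbTE h2).
Qed.

Lemma word_perm_surj_bounded m (w : 'S_n) : m <= n.-1 ->
  (forall x : 'I_n, m < x -> w x = x) -> exists2 u, bounded m u & word_perm u = w.
Proof.
elim: m w => [|m IH] w mn hw.
  exists [::] => //; rewrite /word_perm /=; symmetry.
  apply/permP => y; rewrite perm1; case: (posnP y) => [y0|/hw//].
  apply/val_inj; rewrite /= y0; have [//|wy] := posnP (w y).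
  have := hw _ wy; move/perm_inj => e; by rewrite e y0 in wy.
have mlt : m.+1 < n by lia.
pose M := Ordinal mlt; pose p := (w^-1)%g M.
have pm : p <= m.+1.
  rewrite leqNgt; apply/negP => h; have := hw _ h; rewrite permKV => e.
  by rewrite -e ltnn in h.
pose u0 := iota p (m.+1 - p).
have bu0 : bounded m.+1 u0 by apply/allP => j; rewrite mem_iota; lia.
have bu0' : bounded n.-1 u0 by apply/allP => j; rewrite mem_iota; lia.
have [x hx|u' bu' e] := IH ((word_perm u0)^-1 * w)%g (ltnW mn).
  rewrite permM; have [xm|xm] := ltnP m.+1 x.
    have -> : (word_perm u0)^-1%g x = x; last exact: hw.
    by apply/val_inj; rewrite /= -(word_permV x bu0') (word_swap_fixed bu0 xm).
  have -> : x = M by apply/val_inj => /=; lia.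
  have -> : (word_perm u0)^-1%g M = p; last by rewrite permKV.
  apply/val_inj; rewrite /= -(word_permV M bu0') /u0 /=.
  by rewrite -{2}(subnKC pm) word_swap_cycle.
exists (u0 ++ u'); last by rewrite word_perm_cat e mulKVg.
rewrite /bounded all_cat [all _ _]bu0; apply/allP => j /(allP bu') jm.
exact: leq_trans jm (leqnSn m).
Qed.

Lemma word_perm_surj (w : 'S_n) : exists2 u, bounded n.-1 u & word_perm u = w.
Proof. by apply: word_perm_surj_bounded => // x; have := ltn_ord x; lia. Qed.

Lemma perm_simple_ind (P : 'S_n -> Prop) : P 1%g ->
  (forall i w, P w -> P (simple i * w)%g) -> forall w, P w.
Proof.
move=> P1 PM w; have [u bu <-] := word_perm_surj w.
elim: u bu => [//|j u IH /andP[jn /IH hu]].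
by rewrite (word_perm_cons (Ordinal jn) u : word_perm (j :: u) = _); apply: PM.
Qed.

Lemma coxeter_representation X (T : 'I_n.-1 -> X -> X) :
  (forall i x, T i (T i x) = x) ->
  (forall i j x, far i j -> T i (T j x) = T j (T i x)) ->
  (forall (i j : 'I_n.-1) x, j = i.+1 :> nat -> T j (T i (T j x)) = T i (T j (T i x))) ->
  exists rho : 'S_n -> X -> X,
    [/\ forall x, rho 1%g x = x, forall v w x, rho (v * w)%g x = rho v (rho w x)
      & forall i x, rho (simple i) x = T i x].
Proof.
move=> Tq Tf Tb; have cT := coxeter_extend Tq Tf Tb.
have /choice[word hword] : forall w : 'S_n, exists u, bounded n.-1 u /\ word_perm u = w.
  by move=> w; have [u] := word_perm_surj w; exists u.
have eq_act u v : bounded n.-1 u -> bounded n.-1 v -> word_perm u = word_perm v ->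
    word_act (extend_letters T) u =1 word_act (extend_letters T) v.
  move=> bu bv uv; apply: (word_eqP (leqnn _) bu bv _ cT) => x.
  have [xn|nx] := ltnP x n.
    by rewrite -[x]/(val (Ordinal xn)) !word_permV // uv.
  have [xn1|xn1] := ltnP n.-1 x; first by rewrite !(word_swap_fixed (m := n.-1)).
  have n0 : n.-1 = 0 by lia.
  by move: bu bv; rewrite n0; case: (u) => //; case: (v).
exists (fun w => word_act (extend_letters T) (word w)); split=> [x|v w x|i x].
- by rewrite (eq_act _ [::]) //; case: (hword 1%g).
- rewrite -word_act_cat; apply: eq_act; first by case: (hword (v * w)%g).
    by rewrite /bounded all_cat; apply/andP; split; [case: (hword v)|case: (hword w)].
  by rewrite word_perm_cat; case: (hword v) (hword w) (hword (v * w)%g) => _ -> [_ ->] [].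
rewrite (eq_act _ [:: val i]); first by rewrite /= extend_lettersE.
- by case: (hword (simple i)).
- by rewrite /bounded /= ltn_ord.
by rewrite (word_perm_cons i) /word_perm /= mulg1; case: (hword (simple i)).
Qed.
End SymmetricGroup.

Local Open Scope ring_scope.

(** * Linear actions *)

HB.instance Definition _ (k : fieldType) (A : algType k) (M : lmodType k)
    (act : alg_action A M) (a : A) :=
  GRing.isLinear.Build k M M *:%R (act a) (al_act_linear_r act a).

HB.instance Definition _ (k : fieldType) (B : nualg k) (M : lmodType k)
    (act : nualg_action B M) (b : B) :=
  GRing.isLinear.Build k M M *:%R (act b) (nu_act_linear_r act b).

Section ActionTheory.
Variables (k : fieldType) (A : algType k) (M : lmodType k).
Variable act : alg_action A M.

Lemma al_actDl a b m : act (a + b) m = act a m + act b m.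
Proof. by have := al_act_linear_l act m 1 a b; rewrite /= !scale1r. Qed.
Lemma al_act0l m : act 0 m = 0.
Proof. by apply: (addrI (act 0 m)); rewrite -al_actDl !addr0. Qed.
Lemma al_actZl c a m : act (c *: a) m = c *: act a m.
Proof. by have := al_act_linear_l act m c a 0; rewrite /= al_act0l !addr0. Qed.
Lemma al_actNl a m : act (- a) m = - act a m.
Proof. by rewrite -(scaleN1r a) al_actZl scaleN1r. Qed.
Lemma al_actBl a b m : act (a - b) m = act a m - act b m.
Proof. by rewrite al_actDl al_actNl. Qed.
Lemma al_act_suml (J : Type) (r : seq J) (P : pred J) (F : J -> A) m :
  act (\sum_(j <- r | P j) F j) m = \sum_(j <- r | P j) act (F j) m.
Proof.
by rewrite (big_morph (act^~ m) (fun a b => al_actDl a b m) (al_act0l m)).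
Qed.
Lemma al_actC a b m : a * b = b * a -> act a (act b m) = act b (act a m).
Proof. by move=> e; rewrite -!al_act_mul e. Qed.
End ActionTheory.

Section NuActionTheory.
Variables (k : fieldType) (B : nualg k) (M : lmodType k).
Variable act : nualg_action B M.

Lemma nu_actDl a b m : act (a + b) m = act a m + act b m.
Proof. by have := nu_act_linear_l act m 1 a b; rewrite /= !scale1r. Qed.
Lemma nu_act0l m : act 0 m = 0.
Proof. by apply: (addrI (act 0 m)); rewrite -nu_actDl !addr0. Qed.
Lemma nu_actZl c a m : act (c *: a) m = c *: act a m.
Proof. by have := nu_act_linear_l act m c a 0; rewrite /= nu_act0l !addr0. Qed.
Lemma nu_actNl a m : act (- a) m = - act a m.
Proof. by rewrite -(scaleN1r a) nu_actZl scaleN1r. Qed.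
Lemma nu_actBl a b m : act (a - b) m = act a m - act b m.
Proof. by rewrite nu_actDl nu_actNl. Qed.
Lemma nu_act_suml (J : Type) (r : seq J) (P : pred J) (F : J -> B) m :
  act (\sum_(j <- r | P j) F j) m = \sum_(j <- r | P j) act (F j) m.
Proof.
by rewrite (big_morph (act^~ m) (fun a b => nu_actDl a b m) (nu_act0l m)).
Qed.
End NuActionTheory.

(** Polynomial identities are checked below on constants and variables, so the
    induction follows the ring operations instead of the monomial expansion. *)
Lemma mpoly_ring_ind n (R : comNzRingType) (P : {mpoly R[n]} -> Prop) :
  (forall c, P c%:MP) -> (forall i, P 'X_i) ->
  (forall p q, P p -> P q -> P (p + q)) ->
  (forall p q, P p -> P q -> P (p * q)) -> forall p, P p.
Proof.
move=> PC PX PD PM; elim/mpolyind => [|c m p _ _ Pp]; first by rewrite -mpolyC0.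
apply: (PD) => //; rewrite -mul_mpolyC; apply: (PM) => //.
rewrite mpolyXE_id; elim/big_ind: _ => [|//|i _]; first by rewrite -mpolyC1.
by elim: (m i) => [|d IH]; rewrite ?expr0 -?mpolyC1 // exprS; apply: PM.
Qed.

(** * Polynomials in commuting operators *)

(** The evaluation of a polynomial at commuting operators is not an instance of
    the evaluation of polynomials in a ring, because linear endomorphisms do not
    form a commutative ring and form the zero ring when [V = 0].  The order of
    composition in [op_monomial] is the one used by [klr_monomial]. *)
Section OperatorPolynomials.
Variables (k : fieldType) (n : nat) (V : lmodType k) (X : 'I_n -> V -> V).
Implicit Types (m : 'X_{1..n}) (p q : {mpoly k[n]}) (v : V).

Definition op_monomial m v := foldr (fun j u => iter (m j) (X j) u) v (enum 'I_n).

Definition op_poly p v := \sum_(m <- msupp p) p@_m *: op_monomial m v.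

Hypothesis X_linear : forall j, linear (X j).
Hypothesis XC : forall i j v, X i (X j v) = X j (X i v).

Let iter_linear d j : linear (iter d (X j)).
Proof. by elim: d => [//|d IH] c u v; rewrite !iterS IH X_linear. Qed.

Let mon_linear m : linear (op_monomial m).
Proof.
rewrite /op_monomial => c u v; elim: (enum _) => //= j r ->.
by rewrite iter_linear.
Qed.

Let iter_C d d' i j v : iter d (X i) (iter d' (X j) v) = iter d' (X j) (iter d (X i) v).
Proof.
elim: d => [//|d IH]; rewrite !iterS IH.
by elim: {IH} d' => [//|d' IH]; rewrite !iterS XC IH.
Qed.

Let mon0 v : op_monomial 0%MM v = v.
Proof.
by rewrite /op_monomial; elim: (enum _) => //= j r ->; rewrite mnm0E.
Qed.

Let monD m1 m2 v : op_monomial (m1 + m2)%MM v = op_monomial m1 (op_monomial m2 v).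
Proof.
have H d i r w : iter d (X i) (foldr (fun j u => iter (m1 j) (X j) u) w r) =
    foldr (fun j u => iter (m1 j) (X j) u) (iter d (X i) w) r.
  by elim: r => //= j r <-; rewrite iter_C.
rewrite /op_monomial; elim: (enum _) => //= j r ->.
by rewrite mnmDE iterD H.
Qed.

Let monU i v : op_monomial U_(i)%MM v = X i v.
Proof.
rewrite /op_monomial; have := enum_uniq 'I_n; have := mem_enum 'I_n i.
have H r : i \notin r -> foldr (fun j u => iter (U_(i)%MM j) (X j) u) v r = v.
  elim: r => //= j r IH; rewrite inE negb_or mnm1E => /andP[/negbTE-> ir] /=.
  exact: IH.
elim: (enum _) => //= j r IH; rewrite inE mnm1E => /orP[/eqP e|ir] /andP[jr ur].
  by rewrite -e in jr *; rewrite eqxx /= H.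
rewrite (IH ir ur); case: eqP => [e|//]; by rewrite -e ir in jr.
Qed.

Lemma op_poly_width w p v : (msize p <= w)%N ->
  op_poly p v = \sum_(m : 'X_{1..n < w}) p@_m *: op_monomial m v.
Proof.
move=> pw; rewrite /op_poly; pose I : subFinType _ := 'X_{1..n < w}.
rewrite (big_mksub I) //=; first last.
  by move=> x /msize_mdeg_lt /leq_trans; apply.
  by rewrite msupp_uniq.
by rewrite big_rmcond //= => i; move/memN_msupp_eq0 ->; rewrite scale0r.
Qed.

Let opl v : linear (op_poly^~ v).
Proof.
move=> c p q /=; pose w := maxn (msize (c *: p + q)) (maxn (msize p) (msize q)).
rewrite !(@op_poly_width w) ?leq_max ?leqnn ?orbT //.
rewrite scaler_sumr -big_split; apply: eq_bigr => m _ /=.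
by rewrite mcoeffD mcoeffZ scalerDl scalerA.
Qed.

Let opr p : linear (op_poly p).
Proof.
move=> c u v; rewrite /op_poly scaler_sumr -big_split; apply: eq_bigr => m _ /=.
by rewrite mon_linear scalerDr !scalerA mulrC.
Qed.

Let opX m v : op_poly 'X_[m] v = op_monomial m v.
Proof. by rewrite /op_poly msuppX big_seq1 mcoeffX eqxx scale1r. Qed.

Let op1 v : op_poly 1 v = v.
Proof. by rewrite -mpolyX0 opX mon0. Qed.

Let op0 v : op_poly 0 v = 0.
Proof. by rewrite /op_poly msupp0 big_nil. Qed.

Let opM p q v : op_poly (p * q) v = op_poly p (op_poly q v).
Proof.
elim/mpolyind: p => [|c m p _ _ IHp]; first by rewrite mul0r !op0.
rewrite mulrDl -scalerAl !opl {}IHp; congr (c *: _ + _).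
elim/mpolyind: q => [|d m' q _ _ IHq].
  by rewrite mulr0 op0; have := opr 'X_[m] (-1) 0 0; rewrite scaler0 addr0 => ->; rewrite scaleN1r addNr.
rewrite mulrDr -scalerAr !opl opr IHq -mpolyXD; congr (_ *: _ + _).
by rewrite !opX monD.
Qed.

Definition op_poly_action : alg_action {mpoly k[n]} V :=
  AlgAction opr opl op1 opM.

Lemma op_poly_actionX j v : op_poly_action 'X_j v = X j v.
Proof. by rewrite /= opX monU. Qed.
End OperatorPolynomials.

(** * Generalized weight spaces *)

Section WeightSpaces.
Variables (k : fieldType) (n : nat) (V : lmodType k).
Variable pa : alg_action {mpoly k[n]} V.
Implicit Types (a b : 'I_n -> k) (p q : {mpoly k[n]}) (v : V).

(** The generalized eigenspace at [a].  Quantifying over all the polynomials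
    vanishing at [a], and not only over the [X_j - a_j], makes it immediate that
    a polynomial nonzero at [a] is invertible there. *)
Definition wspace a v : Prop :=
  forall p, p.@[a] = 0 -> exists N, pa (p ^+ N) v = 0.

Lemma paC p q v : pa p (pa q v) = pa q (pa p v).
Proof. by apply: al_actC; rewrite mulrC. Qed.

Lemma pa_const c v : pa c%:MP v = c *: v.
Proof. by rewrite -[c%:MP]mulr1 mul_mpolyC al_actZl al_act1. Qed.

Lemma nilp_mul r p N v : pa (p ^+ N) v = 0 -> pa ((r * p) ^+ N) v = 0.
Proof. by move=> h; rewrite exprMn al_act_mul h linear0. Qed.

Lemma nilp_leq p N M v : (N <= M)%N -> pa (p ^+ N) v = 0 -> pa (p ^+ M) v = 0.
Proof. by move=> NM h; rewrite -(subnK NM) exprD al_act_mul h linear0. Qed.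

Lemma nilp_add p q N M v : pa (p ^+ N) v = 0 -> pa (q ^+ M) v = 0 ->
  pa ((p + q) ^+ (N + M)) v = 0.
Proof.
move=> hp hq; rewrite exprDn al_act_suml big1 // => i _.
rewrite -mulr_natl [p ^+ _ * _]mulrC !al_act_mul.
have [Mi|iM] := leqP M i.
  by rewrite [pa (q ^+ _) _]paC (nilp_leq Mi hq) !linear0.
have -> : pa (p ^+ (N + M - i)) v = 0.
  by apply: nilp_leq hp; rewrite -addnBA ?leq_addr // ltnW.
by rewrite !linear0.
Qed.

Lemma wspace_coordinates a v :
  (forall j, exists N, pa (('X_j - (a j)%:MP) ^+ N) v = 0) -> wspace a v.
Proof.
move=> h p pa0; rewrite -[p]subr0 -mpolyC0 -pa0 {pa0}.
elim/mpoly_ring_ind: p => [c|i|p q [N hp] [M hq]|p q [N hp] [M hq]].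
- by exists 1%N; rewrite mevalC subrr expr1 al_act0l.
- by rewrite mevalXU.
- exists (N + M)%N; rewrite mevalD mpolyCD opprD addrACA.
  exact: nilp_add.
exists (N + M)%N; rewrite mevalM mpolyCM.
have -> : p * q - p.@[a]%:MP * q.@[a]%:MP =
    q * (p - p.@[a]%:MP) + p.@[a]%:MP * (q - q.@[a]%:MP) by ring.
by apply: nilp_add; apply: nilp_mul.
Qed.

Lemma wspace_pa a p v : wspace a v -> wspace a (pa p v).
Proof. by move=> h q /h[N e]; exists N; rewrite paC e linear0. Qed.

Lemma wspace0 a : wspace a 0.
Proof. by move=> p _; exists 0%N; rewrite linear0. Qed.

Lemma wspaceZ a c v : wspace a v -> wspace a (c *: v).
Proof. by move=> h q /h[N e]; exists N; rewrite linearZ /= e scaler0. Qed.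

Lemma wspaceD a u v : wspace a u -> wspace a v -> wspace a (u + v).
Proof.
move=> hu hv p p0; have [N eN] := hu p p0; have [M eM] := hv p p0.
exists (maxn N M); rewrite linearD /=.
by rewrite (nilp_leq _ eN) ?leq_maxl // (nilp_leq _ eM) ?leq_maxr // addr0.
Qed.

Lemma wspaceN a v : wspace a v -> wspace a (- v).
Proof. by rewrite -scaleN1r; apply: wspaceZ. Qed.

Lemma wspaceB a u v : wspace a u -> wspace a v -> wspace a (u - v).
Proof. by move=> hu hv; apply/wspaceD/wspaceN. Qed.

(** If [q] is nonzero at [a], it acts as a nonzero scalar plus a locally nilpotent
    operator, so its inverse on a vector is a truncated geometric series. *)
Lemma wspace_unit a q v : wspace a v -> q.@[a] != 0 ->
  exists r, pa r (pa q v) = v.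
Proof.
move=> hv q0; pose c := q.@[a]; pose u := c%:MP - q.
have [|N hN] := hv u; first by rewrite mevalB mevalC subrr.
have := subrXX c%:MP u N; rewrite opprB addrCA subrr addr0.
set s := \sum_(i < N) _ => e.
exists (c ^- N *: s); rewrite -al_act_mul -scalerAl [s * q]mulrC -e.
have -> : c%:MP ^+ N = (c ^+ N)%:MP :> {mpoly k[n]} by rewrite rmorphXn.
by rewrite al_actZl al_actBl hN subr0 pa_const scalerA mulVf ?scale1r // expf_neq0.
Qed.

Lemma wspace_inj a q v : wspace a v -> q.@[a] != 0 -> pa q v = 0 -> v = 0.
Proof. by move=> hv /(wspace_unit hv)[r h] e; rewrite -h e linear0. Qed.

(** For each [j0] a product of powers of the [X_i - a_i] kills all the other
    terms and is nonzero at the point of [j0]. *)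
Lemma wspace_indep (J : eqType) (c : J -> 'I_n -> k) :
  (forall j j', c j =1 c j' -> j = j') ->
  forall (s : seq J) (f : J -> V), uniq s -> (forall j, wspace (c j) (f j)) ->
  \sum_(j <- s) f j = 0 -> forall j, j \in s -> f j = 0.
Proof.
move=> c_inj s f us hf f0 j0 js.
have [q q0 hq] : exists2 q, q.@[c j0] != 0 &
    forall j, j \in s -> j != j0 -> pa q (f j) = 0.
  elim: {us f0 js} s => [|j s [q q0 hq]].
    by exists 1 => //; rewrite meval1 oner_neq0.
  have [->|jj0] := eqVneq j j0.
    exists q => // j'; rewrite inE => /orP[/eqP->|/hq//]; by rewrite eqxx.
  have [i /eqP ci] : exists i, c j i <> c j0 i.
    by apply: contrapT => /forallNP h; move/eqP: jj0; apply; apply: c_inj => i; apply: contrapT.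
  have [|N hN] := hf j ('X_i - (c j i)%:MP).
    by rewrite mevalB mevalXU mevalC subrr.
  exists (q * ('X_i - (c j i)%:MP) ^+ N).
    rewrite mevalM mulf_neq0 // rmorphXn expf_neq0 //=.
    by rewrite mevalB mevalXU mevalC subr_eq0 eq_sym.
  move=> j'; rewrite inE => /orP[/eqP->|j's] ne.
    by rewrite al_act_mul hN linear0.
  by rewrite mulrC al_act_mul hq // linear0.
apply: (wspace_inj (hf j0) q0).
have := congr1 (pa q) f0; rewrite linear0 (bigD1_seq j0) //= linearD linear_sum /=.
rewrite big_seq_cond big1 ?addr0 // => j /andP[]; exact: hq.
Qed.

Lemma wspace_disjoint a b v i : a i != b i -> wspace a v -> wspace b v -> v = 0.
Proof.
move=> ab ha hb; have [|N hN] := ha ('X_i - (a i)%:MP).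
  by rewrite mevalB mevalXU mevalC subrr.
apply: (wspace_inj hb _ hN).
by rewrite rmorphXn expf_neq0 //= mevalB mevalXU mevalC subr_eq0 eq_sym.
Qed.
End WeightSpaces.

(** * Supports *)

Section PrimeAvoidance.
Variables (k : fieldType) (n : nat).
Implicit Types (J P : {mpoly k[n]} -> Prop) (p q f : {mpoly k[n]}).

Definition ideal J : Prop :=
  [/\ J 0, forall p q, J p -> J q -> J (p + q) & forall p q, J q -> J (p * q)].

(** An ideal that is maximal among those avoiding the powers of [f] is prime:
    enlarging it by [p] or by [q] captures a power of [f], and the product of
    the two powers lies in the ideal as soon as [p q] does. *)
Lemma prime_avoiding_powers J f : ideal J -> (forall N, ~ J (f ^+ N)) ->
  exists P, [/\ prime_ideal P, forall p, J p -> P p & ~ P f].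
Proof.
move=> idJ Jf.
pose G (S : set {mpoly k[n]}) : Prop :=
  ideal (fun p => J p \/ S p) /\ forall N, ~ (J (f ^+ N) \/ S (f ^+ N)).
(* [G] concerns [J] together with [S], so that the empty chain is no exception *)
have [F FG totF|S [[idS Sf] maxS]] := @Zorn_bigcup _ G.
  pose U := (\bigcup_(X in F) X)%classic.
  have two p q : J p \/ U p -> J q \/ U q -> (J p /\ J q) \/
      exists2 S, F S & (J p \/ S p) /\ (J q \/ S q).
    move=> [Jp|[S FS Sp]] [Jq|[S' FS' Sq]]; [by left| | |]; right.
    - by exists S' => //; split; [left|right].
    - by exists S => //; split; [right|left].
    by have [/(_ _ Sp)|/(_ _ Sq)] := totF _ _ FS FS';
      [exists S'|exists S] => //; split; right.
  split; last first.
    by move=> N [/Jf//|[S FS Sf]]; have [_ /(_ N)[]] := FG _ FS; right.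
  case: (idJ) => J0 JD JM; split; first by left.
    move=> p q Up Uq; have [[Jp Jq]|[S FS [Sp Sq]]] := two p q Up Uq.
      by left; apply: JD.
    have [[_ /(_ p q Sp Sq) SD _] _] := FG _ FS.
    by case: SD => [|Spq]; [left|right; exists S].
  move=> p q [Jq|[S FS Sq]]; first by left; apply: JM.
  have [[_ _ /(_ p q (or_intror Sq)) SM] _] := FG _ FS.
  by case: SM => [|Spq]; [left|right; exists S].
pose P p := J p \/ S p.
have [P0 PD PM] : ideal P by [].
have grow p : ~ P p -> exists N r, P (f ^+ N - r * p).
  move=> Pp; apply: contrapT => no.
  pose S' : set {mpoly k[n]} := fun x : {mpoly k[n]} => exists r, P (x - r * p).
  have PS' x : P x -> S' x by move=> Px; exists 0; rewrite mul0r subr0.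
  have JS' x : J x \/ S' x -> S' x by case=> // Jx; apply: PS'; left.
  apply: (maxS S').
    split=> [|sub]; first by move=> x Sx; apply: PS'; right.
    apply: Pp; right; apply: sub; exists 1; by rewrite mul1r subrr.
  split; last by move=> N /JS'[r Pr]; apply: no; exists N, r.
  split; first by right; apply: PS'.
    move=> x y /JS'[r xr] /JS'[r' yr']; right; exists (r + r').
    by rewrite mulrDl opprD addrACA; apply: PD.
  move=> x y /JS'[r yr]; right; exists (x * r).
  by rewrite -mulrA -mulrBr; apply: PM.
exists P; split=> [|p Jp|Pf]; [|by left|by apply: (Sf 1%N); rewrite expr1].
split=> // [P1|p q Ppq]; first by apply: (Sf 0%N); rewrite expr0.
apply: contrapT => /not_orP[/grow[N [r hp]] /grow[M [r' hq]]].
apply: (Sf (N + M)%N); rewrite -/(P _).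
have -> : f ^+ (N + M) = f ^+ N * (f ^+ M - r' * q) + (r' * q) * (f ^+ N - r * p)
    + r' * r * (p * q) by rewrite exprD; ring.
by apply: (PD); [apply: PD; apply: PM|apply: PM].
Qed.
End PrimeAvoidance.

Section SupportedAt.
Variables (k : fieldType) (n : nat) (A : deg_affine_hecke k n) (M : lmodType k).
Variable act : alg_action A M.

Definition pol_act (p : {mpoly k[n]}) (m : M) : M := act (dah_pol A p) m.

Fact pol_act_linear_r p : linear (pol_act p).
Proof. exact: al_act_linear_r. Qed.
Fact pol_act_linear_l m : linear (pol_act^~ m).
Proof. by move=> c p q; rewrite /pol_act linearP al_act_linear_l. Qed.
Fact pol_act1 m : pol_act 1 m = m.
Proof. by rewrite /pol_act rmorph1 al_act1. Qed.
Fact pol_act_mul p q m : pol_act (p * q) m = pol_act p (pol_act q m).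
Proof. by rewrite /pol_act rmorphM al_act_mul. Qed.

Definition pol_action : alg_action {mpoly k[n]} M :=
  AlgAction pol_act_linear_r pol_act_linear_l pol_act1 pol_act_mul.

(** A power of every polynomial vanishing at [a] kills [m] if and only if [a] is
    the only point of the support of [m]: otherwise some prime ideal containing
    the annihilator of [m] avoids that polynomial. *)
Lemma supported_atE (a : 'I_n -> k) m : supported_at act a m <-> wspace pol_action a m.
Proof.
split=> [supp f f0|wm P [pP hP] p].
  apply: contrapT => /forallNP fN.
  have [||P [pP JP Pf]] := @prime_avoiding_powers k n (fun p => pol_action p m = 0) f.
  - split=> [|p q hp hq|p q hq]; first exact: al_act0l.
      by rewrite al_actDl hp hq addr0.
    by rewrite al_act_mul hq linear0.
  - exact: fN.
  by apply: Pf; apply/(supp P).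
have [P0 PD PM P1 Pprime] := pP.
have sub q : point_ideal a q -> P q.
  move=> /wm[N]; move/hP; elim: N => [|N IH]; first by rewrite expr0 => /P1.
  by rewrite exprS => /Pprime[].
split=> [Pp|]; last exact: sub.
apply/eqP; apply: contrapT => /negP p0; apply: P1.
have -> : 1 = (p.@[a])^-1%:MP * p - (p.@[a])^-1%:MP * (p - p.@[a]%:MP).
  by rewrite -mulrBr opprB addrC subrK -mpolyCM mulVf // mpolyC1.
rewrite -mulNr; apply: PD; apply: PM => //; apply: sub.
by rewrite /point_ideal mevalB mevalC subrr.
Qed.
End SupportedAt.

(** * Linear maps out of a direct sum *)

(** The index set of the decomposition may be infinite, so components are
    obtained by choosing, for each vector, a finite decomposition; independence
    makes the choice immaterial. *)
Section Glue.
Variables (k : fieldType) (M : lmodType k) (J : eqType) (W : J -> M -> Prop).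
Hypothesis W_sum : direct_sum W.
Hypothesis W0 : forall j, W j 0.
Hypothesis W_linear : forall j c u v, W j u -> W j v -> W j (c *: u + v).

Let sum_widen (U : lmodType k) (s t : seq J) (h : J -> U) :
  uniq s -> uniq t -> {subset s <= t} -> (forall j, j \notin s -> h j = 0) ->
  \sum_(j <- t) h j = \sum_(j <- s) h j.
Proof.
move=> us ut st h0; rewrite (bigID (mem s)) /= [X in _ + X]big1 ?addr0 //.
rewrite -big_filter; apply: perm_big; apply: uniq_perm => //.
  by rewrite filter_uniq.
by move=> j; rewrite mem_filter; case: (boolP (j \in s)) => //= /st.
Qed.

Fact decomposition m : exists sh : seq J * (J -> M),
  [/\ uniq sh.1, forall j, W j (sh.2 j), forall j, j \notin sh.1 -> sh.2 j = 0
    & m = \sum_(j <- sh.1) sh.2 j].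
Proof.
have [s [f [Wf ->]]] := W_sum.1 m.
elim: s => [|i s [[s' h] /= [us Wh h0 e]]].
  by exists ([::], fun=> 0); split=> //=; rewrite !big_nil.
pose h' j := if j == i then f i + h i else h j.
have Wh' j : W j (h' j).
  rewrite /h'; case: eqP => [->|_] //; rewrite -[f i]scale1r; exact: W_linear.
rewrite big_cons e; have [is'|is'] := boolP (i \in s').
  exists (s', h'); split=> //= [j js'|].
    by rewrite /h'; case: eqP => [ji|_]; [rewrite ji is' in js'|exact: h0].
  rewrite !(bigD1_seq i) //= {1}/h' eqxx addrA; congr (_ + _).
  by apply: eq_bigr => j /negbTE ji; rewrite /h' ji.
exists (i :: s', h'); split=> //=; first by rewrite is'.
  by move=> j; rewrite inE negb_or /h' => /andP[/negbTE-> /h0].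
rewrite big_cons {1}/h' eqxx (h0 i) // addr0; congr (_ + _).
rewrite !big_seq; apply: eq_bigr => j js'; rewrite /h'.
by case: eqP => [ji|//]; rewrite ji (negbTE is') in js'.
Qed.

Definition component_supp m : seq J := (sval (cid (decomposition m))).1.
Definition component j m : M := (sval (cid (decomposition m))).2 j.

Fact component_spec m :
  [/\ uniq (component_supp m), forall j, W j (component j m),
      forall j, j \notin component_supp m -> component j m = 0
    & m = \sum_(j <- component_supp m) component j m].
Proof. exact: svalP (cid (decomposition m)). Qed.

Lemma component_unique m (s : seq J) (h : J -> M) : uniq s ->
  (forall j, W j (h j)) -> (forall j, j \notin s -> h j = 0) ->
  m = \sum_(j <- s) h j -> forall j, component j m = h j.
Proof.
move=> us Wh h0 e j; have [us' Wc c0 e'] := component_spec m.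
pose t := undup (component_supp m ++ s).
have [jt|] := boolP (j \in t); last first.
  by rewrite mem_undup mem_cat negb_or => /andP[/c0-> /h0->].
apply/eqP; rewrite -subr_eq0; apply/eqP.
have [_ /(_ t (fun j => component j m - h j))] := W_sum; apply=> //.
- exact: undup_uniq.
- by move=> i; rewrite addrC -scaleN1r; apply: W_linear.
rewrite sumrB (@sum_widen _ (component_supp m) t) ?undup_uniq //; last first.
  by move=> i it; rewrite mem_undup mem_cat it.
rewrite (@sum_widen _ s t) ?undup_uniq // -?e -?e' ?subrr // => i it.
by rewrite mem_undup mem_cat it orbT.
Qed.

Lemma componentW j m : W j (component j m).
Proof. by have [] := component_spec m. Qed.

Lemma component_linear j : linear (component j).
Proof.
move=> c u v; have [us Wu u0 eu] := component_spec u.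
have [vs Wv v0 ev] := component_spec v.
pose t := undup (component_supp u ++ component_supp v).
apply: (@component_unique _ t (fun j => c *: component j u + component j v)).
- exact: undup_uniq.
- by move=> i; apply: W_linear.
- move=> i; rewrite mem_undup mem_cat negb_or => /andP[/u0-> /v0->].
  by rewrite scaler0 addr0.
rewrite big_split -scaler_sumr /=.
rewrite (@sum_widen _ (component_supp u) t) ?undup_uniq //; last first.
  by move=> i it; rewrite mem_undup mem_cat it.
rewrite (@sum_widen _ (component_supp v) t) ?undup_uniq // -?eu -?ev // => i it.
by rewrite mem_undup mem_cat it orbT.
Qed.

Lemma component_id j v : W j v -> component j v = v.
Proof.
move=> Wv; rewrite (@component_unique v [:: j] (fun i => if i == j then v else 0)) //.
- by rewrite eqxx.
- by move=> i; case: eqP => [->|].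
- by move=> i; rewrite inE => /negbTE->.
- by rewrite big_seq1 eqxx.
Qed.

Lemma component_neq i j v : i != j -> W j v -> component i v = 0.
Proof.
move=> ij Wv; rewrite (@component_unique v [:: j] (fun i => if i == j then v else 0)) //.
- by rewrite (negbTE ij).
- by move=> l; case: eqP => [->|].
- by move=> l; rewrite inE => /negbTE->.
- by rewrite big_seq1 eqxx.
Qed.

(** Each [W' j] is the sum of [W j] and of a part lying in the other [W i],
    which vanishes by independence. *)
Lemma summand_recognition (W' : J -> M -> Prop) :
  (forall j v, W j v -> W' j v) ->
  (forall j c u v, W' j u -> W' j v -> W' j (c *: u + v)) ->
  (forall (s : seq J) (f : J -> M), uniq s -> (forall j, W' j (f j)) ->
     \sum_(j <- s) f j = 0 -> forall j, j \in s -> f j = 0) ->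
  forall j v, W' j v -> W j v.
Proof.
move=> WW' W'_linear W'_indep j v Wv; have [us Wc c0 e] := component_spec v.
pose s := undup (j :: component_supp v).
have us' : uniq s by apply: undup_uniq.
have js : j \in s by rewrite mem_undup inE eqxx.
pose f i := component i v + (if i == j then - v else 0).
suff /(_ j js) : forall i, i \in s -> f i = 0.
  by rewrite /f eqxx => /eqP; rewrite subr_eq0 => /eqP <-.
apply: W'_indep => // [i|].
  rewrite /f -[component i v]scale1r; apply: (W'_linear); first exact: WW'.
  case: eqP => [->|_]; last exact/WW'/W0.
  by rewrite -[- v]addr0 -scaleN1r; apply: (W'_linear) => //; apply/WW'/W0.
rewrite big_split (@sum_widen _ (component_supp v) s) //=; last first.
  by move=> i it; rewrite mem_undup inE it orbT.
rewrite -e (bigD1_seq j) //= eqxx big1 ?addr0 ?subrr // => i /negbTE ij.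
by rewrite ij.
Qed.

Lemma glue (N : lmodType k) (f : J -> M -> N) :
  (forall j c u v, W j u -> W j v -> f j (c *: u + v) = c *: f j u + f j v) ->
  exists g : {linear M -> N}, forall j v, W j v -> g v = f j v.
Proof.
move=> f_linear; have f0 j : f j 0 = 0.
  have := @f_linear j (-1) 0 0 (W0 j) (W0 j).
  by rewrite scaler0 addr0 scaleN1r addNr.
pose g m := \sum_(j <- component_supp m) f j (component j m).
have gE s m : uniq s -> {subset component_supp m <= s} ->
    g m = \sum_(j <- s) f j (component j m).
  move=> us sub; have [um Wm m0 _] := component_spec m.
  by rewrite (@sum_widen _ (component_supp m)) // => j /m0 ->.
have gl : linear g.
  move=> c u v.
  pose t := undup (component_supp (c *: u + v) ++ component_supp u ++ component_supp v).
  rewrite !(gE t) ?undup_uniq //;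
    try by move=> i it; rewrite mem_undup !mem_cat it ?orbT.
  rewrite scaler_sumr -big_split; apply: eq_bigr => j _ /=.
  by rewrite component_linear f_linear //; apply: componentW.
exists (HB.pack_for {linear M -> N} g (GRing.isLinear.Build k M N *:%R g gl)).
move=> j v Wv /=; have [um Wm m0 e] := component_spec v.
have [js|js] := boolP (j \in component_supp v); last first.
  have v0 : v = 0 by rewrite -(component_id Wv) m0.
  have -> : f j v = 0 by rewrite v0 f0.
  rewrite /g big1 // => i _; rewrite v0.
  by rewrite (component_unique (s := [::]) (h := fun=> 0)) ?big_nil ?f0.
rewrite /g (bigD1_seq j) //= component_id // big1 ?addr0 // => i ij.
by rewrite (component_neq ij Wv).
Qed.

Lemma sum_ext (N : lmodType k) (f g : M -> N) : linear f -> linear g ->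
  (forall j v, W j v -> f v = g v) -> f =1 g.
Proof.
move=> fl gl fg m; have [_ Wm _ ->] := component_spec m.
pose F : {linear M -> N} := HB.pack_for {linear M -> N} f (GRing.isLinear.Build k M N *:%R f fl).
pose G : {linear M -> N} := HB.pack_for {linear M -> N} g (GRing.isLinear.Build k M N *:%R g gl).
rewrite -[f]/(F : M -> N) -[g]/(G : M -> N) !linear_sum.
by apply: eq_bigr => j _; apply: fg.
Qed.
End Glue.

Local Notation "x %:F" := (tofrac x).

(** * Rational functions *)

Lemma fraction_rep (R : idomainType) (f : {fraction R}) :
  exists p q : R, q != 0 /\ f = p%:F / q%:F.
Proof.
elim/quotW: f => x; exists (\n_x), (\d_x); split; first exact: denom_ratioP.
have d0 : (\d_x)%:F != 0 by rewrite tofrac_eq0 denom_ratioP.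
apply: (mulIf d0); rewrite divfK //; unlock tofrac.
rewrite -[LHS]FracField.pi_mul; apply/eqmodP; rewrite /= FracField.equivfE.
by rewrite /FracField.mulf !numden_Ratio ?oner_neq0 ?mulf_neq0 ?denom_ratioP ?oner_neq0 // !mulr1 mulrC.
Qed.

Section RationalFunctions.
Variables (k : fieldType) (n : nat).
Local Notation F := {fraction {mpoly k[n]}}.
Implicit Types (p q : {mpoly k[n]}) (f g : F) (s : 'S_n).

Lemma frac_eq p q p' q' : q != 0 -> q' != 0 ->
  (p%:F / q%:F = p'%:F / q'%:F :> F) <-> p * q' = p' * q.
Proof.
move=> q0 q0'; split=> [/eqP|e].
  by rewrite eqr_div ?tofrac_eq0 // -!tofracM tofrac_eq => /eqP.
by apply/eqP; rewrite eqr_div ?tofrac_eq0 // -!tofracM e.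
Qed.

Lemma msym_XU s i : msym s 'X_i = 'X_(s i) :> {mpoly k[n]}.
Proof. by rewrite /msym mmapX mmap1U. Qed.

Lemma msym_C s c : msym s c%:MP = c%:MP :> {mpoly k[n]}.
Proof. by rewrite /msym mmapC. Qed.

Lemma msym_comp s t p : msym s (msym t p) = msym (t * s)%g p.
Proof.
elim/mpoly_ring_ind: p => [c|i|p q hp hq|p q hp hq].
- by rewrite !msym_C.
- by rewrite !msym_XU permM.
- by rewrite !msymD hp hq.
- by rewrite !msymM hp hq.
Qed.

Lemma msym_id p : msym 1%g p = p.
Proof.
elim/mpoly_ring_ind: p => [c|i|p q hp hq|p q hp hq].
- by rewrite msym_C.
- by rewrite msym_XU perm1.
- by rewrite msymD hp hq.
- by rewrite msymM hp hq.
Qed.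

Lemma msym_eq0 s p : (msym s p == 0) = (p == 0).
Proof.
apply/eqP/eqP => [e|->]; last exact: msym0.
by rewrite -[p]msym_id -[1%g](mulgV s) -msym_comp e msym0.
Qed.

Lemma meval_msym s p a : (msym s p).@[a] = p.@[a \o s].
Proof.
elim/mpoly_ring_ind: p => [c|i|p q hp hq|p q hp hq].
- by rewrite msym_C !mevalC.
- by rewrite msym_XU !mevalXU.
- by rewrite msymD !mevalD hp hq.
- by rewrite msymM !mevalM hp hq.
Qed.

(** The permutation of the variables of [k(X_1, ..., X_n)], computed on a chosen
    numerator and denominator; by [frac_symE] any other choice gives the same. *)
Definition frac_sym s f : F := (msym s (\n_(repr f)))%:F / (msym s (\d_(repr f)))%:F.

Lemma frac_symE s p q : q != 0 -> frac_sym s (p%:F / q%:F) = (msym s p)%:F / (msym s q)%:F.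
Proof.
move=> q0; rewrite /frac_sym; set f := p%:F / q%:F; set x := repr f.
have d0 := denom_ratioP x.
have : (\n_x)%:F / (\d_x)%:F = p%:F / q%:F :> F.
  rewrite -/f -[f]reprK -/x; apply/(canLR (mulfK _)); first by rewrite tofrac_eq0.
  symmetry; unlock tofrac.
  rewrite -[LHS]FracField.pi_mul; apply/eqmodP; rewrite /= FracField.equivfE.
  by rewrite /FracField.mulf !numden_Ratio ?oner_neq0 ?mulf_neq0 ?denom_ratioP ?oner_neq0 // !mulr1 mulrC.
move/(frac_eq _ _ d0 q0) => e; apply/frac_eq; rewrite ?msym_eq0 //.
by rewrite -!msymM e.
Qed.

Lemma frac_sym_poly s p : frac_sym s p%:F = (msym s p)%:F.
Proof. by rewrite -[p%:F]divr1 -tofrac1 frac_symE ?oner_neq0 // msym1 tofrac1 divr1. Qed.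

Fact frac_sym_zmod_morphism s : zmod_morphism (frac_sym s).
Proof.
move=> f g; have [p [q [q0 ->]]] := fraction_rep f.
have [p' [q' [q0' ->]]] := fraction_rep g.
rewrite -mulNr addf_div ?tofrac_eq0 // -tofracN -!tofracM -tofracD.
rewrite !frac_symE ?mulf_neq0 // msymD !msymM msymN tofracD !tofracM tofracN.
by rewrite -[in RHS]mulNr addf_div // tofrac_eq0 msym_eq0.
Qed.

HB.instance Definition _ s := GRing.isZmodMorphism.Build F F (frac_sym s)
  (frac_sym_zmod_morphism s).

Fact frac_sym_monoid_morphism s : monoid_morphism (frac_sym s).
Proof.
split=> [|f g]; first by rewrite -tofrac1 frac_sym_poly msym1.
have [p [q [q0 ->]]] := fraction_rep f.
have [p' [q' [q0' ->]]] := fraction_rep g.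
rewrite mulf_div -!tofracM !frac_symE ?mulf_neq0 // !msymM !tofracM.
by rewrite mulf_div.
Qed.

HB.instance Definition _ s := GRing.isMonoidMorphism.Build F F (frac_sym s)
  (frac_sym_monoid_morphism s).

(** Membership in the local ring of the affine space at [a]. *)
Definition regular (a : 'I_n -> k) f : Prop :=
  exists p q, q.@[a] != 0 /\ f = p%:F / q%:F.

Lemma meval_neq0 a q : q.@[a] != 0 -> q != 0.
Proof. by apply: contraNneq => ->; rewrite meval0. Qed.

Lemma regular_poly a p : regular a p%:F.
Proof. by exists p, 1; rewrite meval1 oner_neq0 tofrac1 divr1. Qed.

Lemma regular0 a : regular a 0.
Proof. by rewrite -tofrac0; apply: regular_poly. Qed.

Lemma regular1 a : regular a 1.
Proof. by rewrite -tofrac1; apply: regular_poly. Qed.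

Lemma regularD a f g : regular a f -> regular a g -> regular a (f + g).
Proof.
move=> [p [q [q0 ->]]] [p' [q' [q0' ->]]].
exists (p * q' + p' * q), (q * q'); rewrite mevalM mulf_neq0 //; split=> //.
by rewrite addf_div ?tofrac_eq0 ?(meval_neq0 (a := a)) // tofracD !tofracM.
Qed.

Lemma regularM a f g : regular a f -> regular a g -> regular a (f * g).
Proof.
move=> [p [q [q0 ->]]] [p' [q' [q0' ->]]].
exists (p * p'), (q * q'); rewrite mevalM mulf_neq0 //; split=> //.
by rewrite mulf_div !tofracM.
Qed.

Lemma regularN a f : regular a f -> regular a (- f).
Proof. by rewrite -mulN1r -tofrac1 -tofracN; apply/regularM/regular_poly. Qed.

Lemma regularB a f g : regular a f -> regular a g -> regular a (f - g).
Proof. by move=> hf hg; apply/regularD/regularN. Qed.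

Lemma regularV a p : p.@[a] != 0 -> regular a (p%:F)^-1.
Proof. by exists 1, p; rewrite tofrac1 mul1r. Qed.

Lemma regular_sym s a b f : b \o s =1 a -> regular a f -> regular b (frac_sym s f).
Proof.
move=> ba [p [q [q0 ->]]]; exists (msym s p), (msym s q).
by rewrite frac_symE ?(meval_neq0 q0) // meval_msym (meval_eq _ ba).
Qed.
End RationalFunctions.

Lemma simpleK n (i : 'I_n.-1) : involutive (@simple n i).
Proof. exact: tpermK. Qed.

Lemma lo_neq_hi n (i : 'I_n.-1) : lo i != hi i.
Proof. by rewrite -val_eqE /= neq_ltn ltnSn. Qed.

Section Demazure.
Variables (k : fieldType) (n : nat).
Local Notation F := {fraction {mpoly k[n]}}.
Implicit Types (p q : {mpoly k[n]}) (f g : F) (i : 'I_n.-1).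

Definition rvar (j : 'I_n) : F := ('X_j : {mpoly k[n]})%:F.

Lemma rvar_inj j j' : rvar j = rvar j' -> j = j'.
Proof.
move=> /eqP; rewrite tofrac_eq => /eqP /(congr1 (fun p => p@_U_(j))).
by rewrite !mcoeffXU eqxx; case: eqP => [->//|_] /eqP; rewrite oner_eq0.
Qed.

Lemma rvar_sub_neq0 (j j' : 'I_n) : j != j' -> rvar j - rvar j' != 0.
Proof. by rewrite subr_eq0; apply: contraNneq => /rvar_inj->. Qed.

Definition simple_root i : F := rvar (lo i) - rvar (hi i).

Lemma simple_root_neq0 i : simple_root i != 0.
Proof. exact/rvar_sub_neq0/lo_neq_hi. Qed.

Definition demazure i f : F := (frac_sym (simple i) f - f) / simple_root i.

Lemma frac_sym_rvar s j : frac_sym s (rvar j) = rvar (s j).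
Proof. by rewrite frac_sym_poly msym_XU. Qed.

Lemma demazureD i f g : demazure i (f + g) = demazure i f + demazure i g.
Proof. by rewrite /demazure rmorphD -mulrDl opprD addrACA. Qed.

Lemma demazureM i f g :
  demazure i (f * g) = frac_sym (simple i) f * demazure i g + demazure i f * g.
Proof. by rewrite /demazure rmorphM; ring. Qed.

Lemma demazure_numerator i (f g : F) : g != 0 -> demazure i f =
  frac_sym (simple i) g * demazure i (f / g) + demazure i g * (f / g).
Proof. by move=> g0; rewrite -demazureM mulrC divfK. Qed.

Lemma demazure_poly i p : exists D, D%:F = demazure i p%:F.
Proof.
elim/mpoly_ring_ind: p => [c|j|p q [D hD] [D' hD']|p q [D hD] [D' hD']].
- by exists 0; rewrite /demazure frac_sym_poly msym_C subrr mul0r tofrac0.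
- rewrite /demazure frac_sym_rvar /simple -/(rvar j).
  have [->|->|/eqP jl /eqP jh] := tpermP; last 1 first.
  - by exists 0; rewrite subrr mul0r tofrac0.
  - exists (-1); rewrite -opprB mulNr divff ?simple_root_neq0 // tofracN tofrac1 //.
  - by exists 1; rewrite divff ?simple_root_neq0 // tofrac1.
- by exists (D + D'); rewrite !tofracD hD hD' demazureD.
exists (msym (simple i) p * D' + D * q).
by rewrite tofracD !tofracM demazureM hD hD' frac_sym_poly.
Qed.

(** The quotient [(s f - f) / (X_i - X_{i+1})] keeps its apparent pole out of the
    local ring at [a]: for polynomials the division is exact, and the twisted
    Leibniz rule carries this over to quotients. *)
Lemma regular_demazure i a f : a (lo i) = a (hi i) -> regular a f ->
  regular a (demazure i f).
Proof.
move=> aii [p [q [q0 ->]]]; have [Dp hDp] := demazure_poly i p.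
have [Dq hDq] := demazure_poly i q.
have as_a : a \o simple i =1 a.
  by move=> j /=; rewrite /simple; case: tpermP => [->|->|].
have q0F : q%:F != 0 :> F by rewrite tofrac_eq0 (meval_neq0 q0).
have sq0 : (msym (simple i) q).@[a] != 0 by rewrite meval_msym (meval_eq _ as_a).
have sq0F : frac_sym (simple i) q%:F != 0 by rewrite frac_sym_poly tofrac_eq0 (meval_neq0 sq0).
have -> : demazure i (p%:F / q%:F) =
    (Dp%:F - p%:F / q%:F * Dq%:F) * (frac_sym (simple i) q%:F)^-1.
  apply: (mulIf sq0F); rewrite divfK // hDp (demazure_numerator i p%:F q0F) hDq.
  by rewrite [p%:F / q%:F * _]mulrC addrK mulrC.
apply: regularM; last by rewrite frac_sym_poly; apply: regularV.
apply/regularB/regularM; [exact: regular_poly| |exact: regular_poly].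
by exists p, q.
Qed.
End Demazure.

(** * Rational functions acting on weight vectors *)

Section FractionAction.
Variables (k : fieldType) (n : nat) (V : lmodType k).
Variable pa : alg_action {mpoly k[n]} V.
Local Notation F := {fraction {mpoly k[n]}}.
Implicit Types (a b : 'I_n -> k) (p q : {mpoly k[n]}) (f g : F) (u v : V).

(** The local ring at [a] acts on the generalized eigenspace at [a], since
    denominators act bijectively there.  The point is not an argument: a nonzero
    vector determines it, and zero is sent to zero whatever the point. *)
Definition frac_act f v : V :=
  xget 0 [set u | exists a p q, [/\ wspace pa a v, wspace pa a u, q.@[a] != 0,
                    f = p%:F / q%:F & pa q u = pa p v]].

Local Notation "f ## v" := (frac_act f v) (at level 40, v at next level).

Lemma frac_actP a p q v : wspace pa a v -> q.@[a] != 0 ->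
  wspace pa a ((p%:F / q%:F) ## v) /\ pa q ((p%:F / q%:F) ## v) = pa p v.
Proof.
move=> hv q0; rewrite /frac_act; set S := (X in xget 0 X).
have : S (xget 0 S).
  apply: xgetPex; have [r hr] := wspace_unit hv q0.
  exists (pa r (pa p v)), a, p, q; split=> //; first by do 2!apply: wspace_pa.
  by rewrite paC (paC _ q p) (paC _ r p) hr.
set u := xget 0 S => -[b [p' [q' [hv' hu q0' e hq']]]].
have [v0|/eqP v0] := eqVneq v 0.
  have -> : u = 0 by apply: wspace_inj hu q0' _; rewrite hq' v0 linear0.
  by rewrite v0 !linear0; split=> //; apply: wspace0.
have ab : a =1 b.
  move=> i; apply/eqP; apply: contrapT => /negP ab; exact: v0 (wspace_disjoint ab hv hv').
have hu' : wspace pa a u by move=> r r0; apply: hu; rewrite -(meval_eq r ab).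
split=> //; apply/eqP; rewrite -subr_eq0; apply/eqP.
have q0a : q'.@[a] != 0 by rewrite (meval_eq q' ab).
apply: (@wspace_inj _ _ _ _ a q') => //.
  by apply: wspaceB; apply: wspace_pa.
move/frac_eq: e => /(_ (meval_neq0 q0) (meval_neq0 q0')) e.
by rewrite linearB /= paC hq' -!al_act_mul mulrC -e mulrC subrr.
Qed.

Lemma frac_act_eq a p q u v : wspace pa a v -> wspace pa a u -> q.@[a] != 0 ->
  pa q u = pa p v -> (p%:F / q%:F) ## v = u.
Proof.
move=> hv hu q0 e; have [hf ef] := frac_actP p hv q0.
apply/eqP; rewrite -subr_eq0; apply/eqP; apply: (wspace_inj _ q0).
  by apply: wspaceB; [exact: hf|exact: hu].
by rewrite linearB /= ef e subrr.
Qed.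

Lemma wspace_frac a f v : regular a f -> wspace pa a v -> wspace pa a (f ## v).
Proof. by move=> [p [q [q0 ->]]] hv; have [] := frac_actP p hv q0. Qed.

Lemma frac_act_poly a p v : wspace pa a v -> p%:F ## v = pa p v.
Proof.
move=> hv; rewrite -[p%:F]divr1 -tofrac1; apply: (frac_act_eq hv).
- exact: wspace_pa.
- by rewrite meval1 oner_neq0.
- by rewrite al_act1.
Qed.

Lemma frac_act1 a v : wspace pa a v -> 1 ## v = v.
Proof. by move=> hv; rewrite -tofrac1 (frac_act_poly _ hv) al_act1. Qed.

Lemma frac_act0 a v : wspace pa a v -> 0 ## v = 0.
Proof. by move=> hv; rewrite -tofrac0 (frac_act_poly _ hv) al_act0l. Qed.

Lemma frac_actM a f g v : regular a f -> regular a g -> wspace pa a v ->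
  (f * g) ## v = f ## (g ## v).
Proof.
move=> rf rg hv; have hg := wspace_frac rg hv; have hfg := wspace_frac rf hg.
case: rf rg hg hfg => [p [q [q0 ->]]] [p' [q' [q0' ->]]] hg hfg.
rewrite mulf_div -!tofracM; apply: (frac_act_eq hv) => //.
  by rewrite mevalM mulf_neq0.
have [_ e'] := frac_actP p' hv q0'; have [_ e] := frac_actP p hg q0.
by rewrite mulrC al_act_mul e paC e' al_act_mul.
Qed.

Lemma frac_actDl a f g v : regular a f -> regular a g -> wspace pa a v ->
  (f + g) ## v = f ## v + g ## v.
Proof.
move=> rf rg hv; have hf := wspace_frac rf hv; have hg := wspace_frac rg hv.
case: rf rg hf hg => [p [q [q0 ->]]] [p' [q' [q0' ->]]] hf hg.
rewrite addf_div ?tofrac_eq0 ?(meval_neq0 (a := a)) // -!tofracM -tofracD.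
apply: (frac_act_eq hv); first exact: wspaceD.
  by rewrite mevalM mulf_neq0.
have [_ e'] := frac_actP p' hv q0'; have [_ e] := frac_actP p hv q0.
rewrite linearD /= {1}[q * q']mulrC al_actDl [p * q']mulrC [p' * q]mulrC.
by rewrite !al_act_mul e e'.
Qed.

Lemma frac_actNl a f v : regular a f -> wspace pa a v -> (- f) ## v = - (f ## v).
Proof.
move=> rf hv; apply: (addrI (f ## v)); rewrite subrr.
rewrite -(frac_actDl rf (regularN rf) hv) subrr; exact: frac_act0 hv.
Qed.

Lemma frac_actBl a f g v : regular a f -> regular a g -> wspace pa a v ->
  (f - g) ## v = f ## v - g ## v.
Proof.
by move=> rf rg hv; rewrite (frac_actDl rf (regularN rg) hv) (frac_actNl rg hv).
Qed.

Lemma frac_act_linear a f c u v : regular a f -> wspace pa a u -> wspace pa a v ->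
  f ## (c *: u + v) = c *: (f ## u) + f ## v.
Proof.
move=> rf hu hv; have hfu := wspace_frac rf hu; have hfv := wspace_frac rf hv.
case: rf hfu hfv => [p [q [q0 ->]]] hfu hfv.
apply: (@frac_act_eq a) => //; try by apply: wspaceD => //; apply: wspaceZ.
have [_ eu] := frac_actP p hu q0; have [_ ev] := frac_actP p hv q0.
by rewrite !linearP /= eu ev.
Qed.

Lemma frac_actDr a f u v : regular a f -> wspace pa a u -> wspace pa a v ->
  f ## (u + v) = f ## u + f ## v.
Proof.
by move=> rf hu hv; rewrite -[u]scale1r (frac_act_linear 1 rf hu hv) !scale1r.
Qed.

Lemma frac_act0r f : f ## 0 = 0.
Proof.
rewrite /frac_act; set S := (X in xget 0 X); case: xgetP => // u _ [a [p [q [_ hu q0 _ e]]]].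
by apply: wspace_inj hu q0 _; rewrite e linear0.
Qed.

Lemma frac_actNr a f v : regular a f -> wspace pa a v -> f ## (- v) = - (f ## v).
Proof.
move=> rf hv; rewrite -[- v]addr0 -scaleN1r (frac_act_linear _ rf hv (@wspace0 _ _ _ pa a)).
by rewrite frac_act0r addr0 scaleN1r.
Qed.

Lemma frac_actBr a f u v : regular a f -> wspace pa a u -> wspace pa a v ->
  f ## (u - v) = f ## u - f ## v.
Proof.
by move=> rf hu hv; rewrite (frac_actDr rf hu (wspaceN hv)) (frac_actNr rf hv).
Qed.

(** The commutation rule [t p = s_i(p) t + D_i(p)] of both algebras, where the
    term with the Demazure operator [D_i] is present according to [d].  The
    polynomial [D] is a variable because [demazure] takes values in fractions. *)
Definition twisted i (d : bool) a (t : V -> V) : Prop :=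
  forall p D v, wspace pa a v -> D%:F = demazure i p%:F ->
    t (pa p v) = pa (msym (simple i) p) (t v) + (if d then pa D v else 0).

(** Applying [t] to [q (p / q) v = p v] and cancelling [s_i(q)]. *)
Lemma twisted_frac i (d : bool) a b (t : V -> V) f v :
  (d -> a (lo i) = a (hi i)) -> b \o simple i =1 a ->
  (forall u, wspace pa a u -> wspace pa b (t u)) ->
  twisted i d a t -> regular a f -> wspace pa a v ->
  t (f ## v) = frac_sym (simple i) f ## t v +
               (if d then demazure i f ## v else 0).
Proof.
move=> hd ba tab ht rf hv; have hfv := wspace_frac rf hv.
have rdf : d -> regular a (demazure i f) by move=> /hd e; apply: regular_demazure.
have rsf := regular_sym ba rf.
case: rf hfv rdf rsf => [p [q [q0 ->]]] hfv rdf rsf.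
have [Dp hDp] := demazure_poly i p; have [Dq hDq] := demazure_poly i q.
have q0F : q%:F != 0 :> F by rewrite tofrac_eq0 (meval_neq0 q0).
have sq0 : (msym (simple i) q).@[b] != 0 by rewrite meval_msym (meval_eq _ ba).
have ab : d -> b =1 a.
  move=> /hd e j; rewrite -{1}[j](simpleK i) [LHS]ba.
  by rewrite /simple; case: tpermP => [->|->|].
have [_ e] := frac_actP p hv q0.
have tv : wspace pa b (t v) by apply: tab.
have tfv : wspace pa b (t ((p%:F / q%:F) ## v)) by apply: tab.
have hr : wspace pa b (if d then demazure i (p%:F / q%:F) ## v else 0).
  case: (d) ab rdf => [ab /(_ isT) rdf|_ _]; last exact: wspace0.
  by move=> r; rewrite (meval_eq r (ab isT)); apply: wspace_frac rdf hv r.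
apply/eqP; rewrite -subr_eq0; apply/eqP; apply: (wspace_inj _ sq0).
  exact: (wspaceB tfv (wspaceD (wspace_frac rsf tv) hr)).
have := congr1 t e; rewrite (ht q Dq) // (ht p Dp) // => /(canRL (addrK _)) {}e.
rewrite linearB linearD /= e.
have -> : pa (msym (simple i) q) (frac_sym (simple i) (p%:F / q%:F) ## t v) =
    pa (msym (simple i) p) (t v).
  rewrite frac_symE ?(meval_neq0 q0) //.
  by have [] := frac_actP (msym (simple i) p) tv sq0.
case: (d) ab rdf => [/(_ isT) ab /(_ isT) rdf|_ _]; last first.
  by rewrite !linear0 !addr0 subrr.
have sqa : (msym (simple i) q).@[a] != 0 by rewrite -(meval_eq _ ab).
rewrite -(frac_act_poly (msym _ q) (wspace_frac rdf hv)).
rewrite -(frac_actM (regular_poly _ _) rdf hv).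
have -> : (msym (simple i) q)%:F * demazure i (p%:F / q%:F) =
    Dp%:F - Dq%:F * (p%:F / q%:F).
  by rewrite hDp (demazure_numerator i p%:F q0F) -hDq frac_sym_poly addrK.
have rpq : regular a (p%:F / q%:F) by exists p, q.
rewrite (frac_actBl (regular_poly _ _) (regularM (regular_poly _ _) rpq) hv).
rewrite (frac_actM (regular_poly _ _) rpq hv).
rewrite (frac_act_poly _ hv) (frac_act_poly _ hfv).
by apply/eqP; rewrite subr_eq0 addrA.
Qed.
End FractionAction.

(** * The coefficients of the change of generators *)

(** Everything here takes place in an abstract field [K], which later is the
    field of rational functions in [X_1, ..., X_n]. *)

Section Coefficients.
Variables (k : fieldType) (K : fieldType).
Implicit Types (d : k) (y : K).

(** With [y = X_i - X_{i+1}] and [d = nu_{i+1} - nu_i], the action of [T_i] on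
    [1_nu M] is [tau_coef d y * tau_i + const_coef d y], and [tau_i^2] is
    [klr_quad d y].  For [d] nonzero, [T_i + y^-1] is the intertwiner of the
    Hecke algebra, with square [1 - y^-2], so that [tau_coef] has to satisfy
    [coef_quad]. *)
Definition tau_coef d y : K :=
  if d == 0 then y + 1
  else if d == 1 then (y - 2)^-1
  else if d == - 1 then (y + 2) * (y - 1) / y ^+ 2
  else (y + 1) / y.

Definition const_coef d y : K := if d == 0 then 1 else - y^-1.

Definition klr_quad d y : K :=
  if d == 0 then 0
  else (if d == 1 then - (y + 1) else 1) * (if d == - 1 then y - 1 else 1).

(** The differences of two variables satisfy these conditions, and they make all
    the denominators below nonzero. *)
Definition generic y : Prop := [/\ y != 0, y + 1 != 0, y - 1 != 0, y + 2 != 0 & y - 2 != 0].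

Lemma tau_coef_neq0 d y : generic y -> tau_coef d y != 0.
Proof.
case=> y0 yp1 ym1 yp2 ym2; rewrite /tau_coef.
by do !case: ifP => _; rewrite ?mulf_eq0 ?invr_eq0 ?expf_eq0 /= ?negb_or ?y0 ?yp1 ?ym1 ?yp2.
Qed.

(** In characteristic 2 the cases [d = 1] and [d = - 1] are one case, in which
    [K] has to inherit the characteristic of [k]. *)
Lemma coef_quad d y : (2 = 0 :> k -> 2 = 0 :> K) -> generic y -> d != 0 ->
  klr_quad d y * (tau_coef (- d) y * tau_coef d (- y)) = 1 - y ^- 2.
Proof.
move=> char2 [y0 yp1 ym1 yp2 ym2] d0; rewrite /klr_quad /tau_coef.
rewrite oppr_eq0 (negbTE d0) eqr_opp (can2_eq (@opprK _) (@opprK _)).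
have ny2 : - y - 2 != 0 by rewrite -opprD oppr_eq0.
have [->|d1] := eqVneq d 1; have [e|dN] := eqVneq _ (-1).
- have e2 : 2 = 0 :> K.
    by apply: char2; apply/eqP; rewrite -[2]/(1 + 1) addr_eq0; apply/eqP.
  by rewrite e2 !subr0; field; rewrite ?oppr_eq0 y0.
- by field; rewrite y0 ny2.
- by field; rewrite ?oppr_eq0 y0 ym2.
- by field; rewrite ?oppr_eq0 y0.
Qed.

Lemma genericN y : generic y -> generic (- y).
Proof.
case=> y0 yp1 ym1 yp2 ym2; split; rewrite ?oppr_eq0 //.
- by rewrite addrC -opprB oppr_eq0.
- by rewrite -opprD oppr_eq0.
- by rewrite addrC -opprB oppr_eq0.
- by rewrite -opprD oppr_eq0.
Qed.

Lemma rmorph_tau_coef (s : {rmorphism K -> K}) d y : s (tau_coef d y) = tau_coef d (s y).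
Proof.
rewrite /tau_coef; do !case: ifP => _;
by rewrite ?fmorph_div ?fmorphV ?rmorphM ?rmorphXn ?rmorphB ?rmorphD ?rmorph1 ?rmorph_nat.
Qed.

Lemma rmorph_const_coef (s : {rmorphism K -> K}) d y : s (const_coef d y) = const_coef d (s y).
Proof. by rewrite /const_coef; case: ifP => _; rewrite ?rmorph1 ?rmorphN ?fmorphV. Qed.

(** With [tau f v = s(f) tau v + delta f v], where [delta] is the Demazure
    operator if [d = 0] and zero otherwise, the operator [T = A tau + B] maps
    [f v] to [left_coef f (tau v) + right_coef f v]. *)
Definition left_coef (s : {rmorphism K -> K}) d y f : K := tau_coef d y * s f.
Definition right_coef (s : {rmorphism K -> K}) d y f : K :=
  tau_coef d y * (if d == 0 then (s f - f) / y else 0) + const_coef d y * f.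
End Coefficients.

(** Here [s] exchanges the two variables.  The first equation says that [T^2] has
    no component along [tau], the second that its constant term is [1] exactly
    when [tau^2] is [klr_quad]. *)
Section QuadraticCoefficients.
Variables (k K : fieldType) (s : {rmorphism K -> K}) (d : k) (y : K).
Hypotheses (sy : s y = - y) (gy : generic y) (char2 : 2 = 0 :> k -> 2 = 0 :> K).

Lemma quadratic_coefficients :
  right_coef s (- d) y (tau_coef d y) + left_coef s d y (const_coef d y) = 0 /\
  right_coef s d y (const_coef d y) = 1 - left_coef s (- d) y (tau_coef d y) * klr_quad d y.
Proof.
have [y0 _ _ _ _] := gy.
rewrite /left_coef /right_coef rmorph_tau_coef rmorph_const_coef sy.
have [->|d0] := eqVneq d 0; rewrite ?oppr0 ?oppr_eq0 ?(negbTE d0).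
  by rewrite eqxx /tau_coef /const_coef /klr_quad eqxx; split; field.
have e : tau_coef (- d) y * tau_coef d (- y) * klr_quad d y = 1 - y ^- 2.
  by rewrite mulrC coef_quad.
by rewrite e /const_coef oppr_eq0 (negbTE d0); split; field; rewrite ?oppr_eq0 y0.
Qed.

(** The mixed relations of the two algebras correspond to each other because of
    this identity: the Demazure term of [T] is always present, whereas that of
    [tau] is present for [d = 0] only. *)
Lemma right_coef_hecke f :
  right_coef s d y f = const_coef d y * s f + (s f - f) / y.
Proof.
have [y0 _ _ _ _] := gy; rewrite /right_coef /tau_coef /const_coef.
by case: ifP => _; field.
Qed.
End QuadraticCoefficients.

(** [T1 T2 T1] and [T2 T1 T2] are expanded along the words in [tau1], [tau2]
    without using the braid relation.  The coefficients of each word other than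
    the two of length three agree, except for the empty word, where the
    difference is that of the braid relation for [tau].  The proof treats the
    five possible patterns of equalities between three weights [a], [b], [c]
    with [d1 = b - a] and [d2 = c - b]; the squares of [tau] are eliminated by
    [coef_quad], after which the values of [tau_coef] may be any nonzero
    elements of the field. *)
Section BraidCoefficients.
Variables (k K : fieldType) (s1 s2 : {rmorphism K -> K}) (x1 x2 x3 : K).
Hypotheses (s1x1 : s1 x1 = x2) (s1x2 : s1 x2 = x1) (s1x3 : s1 x3 = x3).
Hypotheses (s2x1 : s2 x1 = x1) (s2x2 : s2 x2 = x3) (s2x3 : s2 x3 = x2).
Hypotheses (g12 : generic (x1 - x2)) (g23 : generic (x2 - x3)) (g13 : generic (x1 - x3)).
Hypothesis char2 : 2 = 0 :> k -> 2 = 0 :> K.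
Variables d1 d2 : k.
Local Notation y1 := (x1 - x2).
Local Notation y2 := (x2 - x3).
Local Notation d3 := (d1 + d2).
Local Notation A := tau_coef.
Local Notation B := const_coef.

(* the first two steps of T1 T2 T1: coefficients of t2 t1, t1, t2 and 1 *)
Let f1 := left_coef s2 d3 y2 (A d1 y1).
Let f2 := right_coef s2 d3 y2 (A d1 y1).
Let f3 := left_coef s2 d2 y2 (B d1 y1).
Let f4 := right_coef s2 d2 y2 (B d1 y1).
(* likewise for T2 T1 T2 *)
Let g1 := left_coef s1 d3 y1 (A d2 y2).
Let g2 := right_coef s1 d3 y1 (A d2 y2).
Let g3 := left_coef s1 d1 y1 (B d2 y2).
Let g4 := right_coef s1 d1 y1 (B d2 y2).

Definition braid_defect : K :=
  if d3 == 0 then (klr_quad d1 (x3 - x2) - klr_quad d1 (x1 - x2)) / (x3 - x1) else 0.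

Definition braid_coefficients : Prop :=
 [/\ left_coef s1 d2 y1 f1 = left_coef s2 d1 y2 g1,
     right_coef s1 d2 y1 f1 = left_coef s2 d3 y2 g3 /\
     right_coef s2 d1 y2 g1 = left_coef s1 d3 y1 f3,
     right_coef s1 (- d1) y1 f2 + left_coef s1 d1 y1 f4 = right_coef s2 d3 y2 g3,
     right_coef s2 (- d2) y2 g2 + left_coef s2 d2 y2 g4 = right_coef s1 d3 y1 f3
   & left_coef s1 (- d1) y1 f2 * klr_quad d1 y1 + right_coef s1 d1 y1 f4
     - (left_coef s2 (- d2) y2 g2 * klr_quad d2 y2 + right_coef s2 d2 y2 g4)
     = left_coef s1 d2 y1 f1 * braid_defect].

Let push (s : {rmorphism K -> K}) := (rmorphM s, rmorphD s, rmorphB s, rmorphN s, fmorphV s, rmorph1 s, rmorph0 s).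

Let tau_coef0 y : A (0 : k) y = y + 1 :> K. Proof. by rewrite /tau_coef eqxx. Qed.
Let const_coef0 y : B (0 : k) y = 1 :> K. Proof. by rewrite /const_coef eqxx. Qed.
Let const_coefN (d : k) y : d != 0 -> B d y = - y^-1 :> K. Proof. by rewrite /const_coef => /negbTE->. Qed.

Let quadE (d : k) y y' : d != 0 -> y' = - y -> generic y ->
  klr_quad d y = (1 - y ^- 2) / (A (- d) y * A d y') :> K.
Proof.
move=> d0 -> gy; rewrite -(coef_quad char2 gy d0) mulfK //.
by rewrite mulf_neq0 ?tau_coef_neq0 //; apply: genericN.
Qed.

Lemma braid_coefficientsP : braid_coefficients.
Proof.
have [n12 _ _ _ _] := g12; have [n23 _ _ _ _] := g23; have [n13 _ _ _ _] := g13.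
have g21 : generic (x2 - x1) by rewrite -opprB; apply: genericN.
have g32 : generic (x3 - x2) by rewrite -opprB; apply: genericN.
have g31 : generic (x3 - x1) by rewrite -opprB; apply: genericN.
have [n21 _ _ _ _] := g21; have [n32 _ _ _ _] := g32; have [n31 _ _ _ _] := g31.
pose nA (d : k) := (tau_coef_neq0 d g12, tau_coef_neq0 d g23, tau_coef_neq0 d g13,
                tau_coef_neq0 d g21, tau_coef_neq0 d g32, tau_coef_neq0 d g31).
rewrite /braid_coefficients /f1 /f2 /f3 /f4 /g1 /g2 /g3 /g4 /left_coef /right_coef /braid_defect.
have [e1|d1n] := eqVneq d1 0; have [e2|d2n] := eqVneq d2 0.
- rewrite e1 e2 addr0 !oppr0 !eqxx !tau_coef0 !const_coef0 /klr_quad eqxx.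
  do !rewrite ?(push s1) ?(push s2) ?s1x1 ?s1x2 ?s1x3 ?s2x1 ?s2x2 ?s2x3.
  split; [|split| | |]; by field; rewrite ?nA ?n12 ?n21 ?n23 ?n32 ?n13 ?n31.
- rewrite e1 !add0r !oppr0 !oppr_eq0 !eqxx (negbTE d2n).
  rewrite !tau_coef0 !const_coef0 !const_coefN ?oppr_eq0 // (@quadE d2 y2 (x3 - x2)) ?opprB //.
  rewrite /klr_quad !eqxx.
  do !rewrite ?(push s1) ?(push s2) ?rmorph_tau_coef ?s1x1 ?s1x2 ?s1x3 ?s2x1 ?s2x2 ?s2x3.
  split; [|split| | |]; by field; rewrite ?nA ?n12 ?n21 ?n23 ?n32 ?n13 ?n31.

- rewrite e2 !addr0 !oppr0 !oppr_eq0 !eqxx (negbTE d1n).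
  rewrite !tau_coef0 !const_coef0 !const_coefN ?oppr_eq0 // (@quadE d1 y1 (x2 - x1)) ?opprB //.
  rewrite /klr_quad !eqxx.
  do !rewrite ?(push s1) ?(push s2) ?rmorph_tau_coef ?s1x1 ?s1x2 ?s1x3 ?s2x1 ?s2x2 ?s2x3.
  split; [|split| | |]; by field; rewrite ?nA ?n12 ?n21 ?n23 ?n32 ?n13 ?n31.

have [e3|d3n] := eqVneq d3 0.
  have e2 : d2 = - d1 by apply/eqP; rewrite -addr_eq0 addrC e3.
  rewrite e2 subrr !oppr_eq0 (negbTE d1n) opprK.
  rewrite !tau_coef0 !const_coef0 !const_coefN ?oppr_eq0 //.
  rewrite (@quadE d1 y1 (x2 - x1)) ?opprB // (@quadE d1 (x3 - x2) y2) ?opprB //.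
  rewrite (@quadE (- d1) y2 (x3 - x2)) ?opprB ?oppr_eq0 // opprK.
  do !rewrite ?(push s1) ?(push s2) ?rmorph_tau_coef ?s1x1 ?s1x2 ?s1x3 ?s2x1 ?s2x2 ?s2x3.
  split; [|split| | |]; by field; rewrite ?nA ?n12 ?n21 ?n23 ?n32 ?n13 ?n31.

rewrite !oppr_eq0 (negbTE d1n) (negbTE d2n) !const_coefN ?oppr_eq0 //.
rewrite (@quadE d1 y1 (x2 - x1)) ?opprB // (@quadE d2 y2 (x3 - x2)) ?opprB //.
do !rewrite ?(push s1) ?(push s2) ?rmorph_tau_coef ?s1x1 ?s1x2 ?s1x3 ?s2x1 ?s2x2 ?s2x3.
split; [|split| | |]; by field; rewrite ?nA ?n12 ?n21 ?n23 ?n32 ?n13 ?n31.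

Qed.
End BraidCoefficients.

(** * Permuting the entries of weights *)

Section WeightPermutation.
Variables (k : fieldType) (I : {pred k}) (n : nat).
Implicit Types (nu : weight I n) (i j : 'I_n.-1).

Definition diff i nu : k := coordinate nu (hi i) - coordinate nu (lo i).

Lemma coordinate_permute i nu a :
  coordinate (permute i nu) a = coordinate nu (simple i a).
Proof. by rewrite /coordinate ffunE. Qed.

Lemma coordinate_inj nu mu : coordinate nu =1 coordinate mu -> nu = mu.
Proof. by move=> h; apply/ffunP => a; apply: val_inj; apply: h. Qed.

Lemma permuteK i : involutive (@permute k I n i).
Proof. by move=> nu; apply/ffunP => a; rewrite !ffunE simpleK. Qed.

Lemma permute_far i j nu : far i j ->
  permute i (permute j nu) = permute j (permute i nu).
Proof.
move=> ij; apply/ffunP => a; rewrite !ffunE.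
by have := congr1 (fun s : 'S_n => s a) (simple_far ij); rewrite !permM => ->.
Qed.

Lemma permute_braid i j nu : j = i.+1 :> nat ->
  permute i (permute j (permute i nu)) = permute j (permute i (permute j nu)).
Proof.
move=> ij; apply/ffunP => a; rewrite !ffunE.
by have := congr1 (fun s : 'S_n => s a) (simple_braid ij); rewrite !permM => ->.
Qed.

Lemma diff_permute i nu : diff i (permute i nu) = - diff i nu.
Proof. by rewrite /diff !coordinate_permute simple_lo simple_hi opprB. Qed.

Lemma diff_eq0 i nu : (diff i nu == 0) = (nu (lo i) == nu (hi i)).
Proof. by rewrite /diff subr_eq0 eq_sym /coordinate val_eqE. Qed.

Lemma permute_diff0 i nu : diff i nu = 0 -> permute i nu = nu.
Proof.
move=> /eqP; rewrite diff_eq0 => /eqP e; apply/ffunP => a; rewrite ffunE /simple.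
by case: tpermP => [->|->|].
Qed.

Lemma diff_far i j nu : far i j -> diff i (permute j nu) = diff i nu.
Proof. by move=> ij; rewrite /diff !coordinate_permute far_lo ?far_hi 1?far_sym. Qed.

Section Adjacent.
Variables (i j : 'I_n.-1) (nu : weight I n).
Hypothesis ij : j = i.+1 :> nat.

Lemma diff_adj1 : diff j (permute i nu) = diff i nu + diff j nu.
Proof.
rewrite /diff !coordinate_permute (lo_succ ij) simple_hi succ_simple_hi //.
by rewrite [RHS]addrC addrA subrK.
Qed.

Lemma diff_adj2 : diff i (permute j nu) = diff i nu + diff j nu.
Proof.
rewrite /diff !coordinate_permute succ_simple_lo // -(lo_succ ij) simple_lo.
by rewrite [RHS]addrC addrA subrK.
Qed.
End Adjacent.

Lemma diff_adj3 i j nu : j = i.+1 :> nat ->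
  diff i (permute j (permute i nu)) = diff j nu.
Proof. by move=> ij; rewrite (diff_adj2 _ ij) (diff_adj1 _ ij) diff_permute addKr. Qed.

Lemma diff_adj4 i j nu : j = i.+1 :> nat ->
  diff j (permute i (permute j nu)) = diff i nu.
Proof. by move=> ij; rewrite (diff_adj1 _ ij) (diff_adj2 _ ij) diff_permute addrK. Qed.

Lemma diff_adj0 i j nu : j = i.+1 :> nat ->
  (diff i nu + diff j nu == 0) = (nu (lo i) == nu (hi j)).
Proof.
move=> ij; rewrite /diff (lo_succ ij) addrC addrA subrK subr_eq0 eq_sym.
by rewrite /coordinate val_eqE.
Qed.
End WeightPermutation.

(** * Regularity of the coefficients *)

Section CoefficientRegularity.
Variables (k : fieldType) (n : nat).
Local Notation F := {fraction {mpoly k[n]}}.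
Local Notation rvar := (@rvar k n).
Local Notation root := (@simple_root k n).

Lemma rvar_sub_const_neq0 (a b : 'I_n) (c : k) : a != b ->
  rvar a - rvar b + c%:MP%:F != 0.
Proof.
move=> ab; rewrite -tofracB -tofracD tofrac_eq0; apply/eqP.
move/(congr1 (fun p => p@_U_(a))); rewrite mcoeffD mcoeffB !mcoeffXU eqxx.
rewrite eq_sym in ab; rewrite (negbTE ab) mcoeffC mcoeff0.
have /negbTE-> : U_(a)%MM != 0%MM :> 'X_{1..n}.
  by apply/eqP => /mnmP /(_ a); rewrite mnm1E eqxx mnm0E.
by rewrite mulr0 subr0 addr0 => /eqP; rewrite oner_eq0.
Qed.

Lemma const1F : (1 : k)%:MP%:F = 1 :> F. Proof. by rewrite mpolyC1 tofrac1. Qed.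
Lemma const2F : (2 : k)%:MP%:F = 2 :> F.
Proof. by rewrite -[2 in LHS]/(1 + 1) mpolyCD tofracD const1F. Qed.

Lemma constN1F : (- 1 : k)%:MP%:F = - 1 :> F. Proof. by rewrite mpolyCN tofracN const1F. Qed.
Lemma constN2F : (- 2 : k)%:MP%:F = - 2 :> F. Proof. by rewrite mpolyCN tofracN const2F. Qed.

Lemma char2F : 2 = 0 :> k -> 2 = 0 :> F.
Proof. by move=> e; rewrite -const2F e mpolyC0 tofrac0. Qed.

Lemma generic_rvar (a b : 'I_n) : a != b -> generic (rvar a - rvar b).
Proof.
move=> ab; split; first exact: rvar_sub_neq0.
- by rewrite -const1F; apply: rvar_sub_const_neq0.
- by rewrite -constN1F; apply: rvar_sub_const_neq0.
- by rewrite -const2F; apply: rvar_sub_const_neq0.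
- by rewrite -constN2F; apply: rvar_sub_const_neq0.
Qed.

Lemma generic_root i : generic (root i).
Proof. exact/generic_rvar/lo_neq_hi. Qed.

Lemma regular_root_add (a : 'I_n -> k) i (c : k) : regular a (root i + c%:MP%:F).
Proof. by rewrite /simple_root -tofracB -tofracD; apply: regular_poly. Qed.

Lemma regular_root_inv (a : 'I_n -> k) i (c : k) : a (lo i) - a (hi i) + c != 0 ->
  regular a (root i + c%:MP%:F)^-1.
Proof.
move=> h; rewrite /simple_root -tofracB -tofracD; apply: regularV.
by rewrite mevalD mevalB !mevalXU mevalC.
Qed.

(** The value of [X_i - X_{i+1}] at [a] is [d], and [tau_coef d] has neither a zero
    nor a pole at [d]; this is why [tau] can be recovered from [T]. *)
Lemma regular_tau_coef (a : 'I_n -> k) i :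
  regular a (tau_coef (a (lo i) - a (hi i)) (root i) : F) /\
  regular a (tau_coef (a (lo i) - a (hi i)) (root i) : F)^-1.
Proof.
set d := a _ - a _.
have R0 : regular a (root i) by rewrite -[root i]addr0 -tofrac0 -mpolyC0; apply: regular_root_add.
have Rp1 : regular a (root i + 1) by rewrite -const1F; apply: regular_root_add.
have Rm1 : regular a (root i - 1).
  by rewrite -constN1F; apply: regular_root_add.
have Rp2 : regular a (root i + 2) by rewrite -const2F; apply: regular_root_add.
have Rm2 : regular a (root i - 2).
  by rewrite -constN2F; apply: regular_root_add.
have V0 : d != 0 -> regular a (root i)^-1.
  by move=> h; rewrite -[root i]addr0 -tofrac0 -mpolyC0; apply: regular_root_inv; rewrite addr0.
have Vp1 : d + 1 != 0 -> regular a (root i + 1)^-1.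
  by move=> h; rewrite -const1F; apply: regular_root_inv.
have Vm1 : d - 1 != 0 -> regular a (root i - 1)^-1.
  by move=> h; rewrite -constN1F; apply: regular_root_inv.
have Vp2 : d + 2 != 0 -> regular a (root i + 2)^-1.
  by move=> h; rewrite -const2F; apply: regular_root_inv.
have Vm2 : d - 2 != 0 -> regular a (root i - 2)^-1.
  by move=> h; rewrite -constN2F; apply: regular_root_inv.
have n1 : 1 - 2 = -1 :> k by ring.
have n2 : -1 + 2 = 1 :> k by ring.
have n1k : (-1 : k) != 0 by rewrite oppr_eq0 oner_neq0.
rewrite /tau_coef; case: eqP => [d0|/eqP d0].
  by split=> //; apply: Vp1; rewrite d0 add0r oner_neq0.
case: eqP => [d1|/eqP d1].
  by rewrite invrK; split=> //; apply: Vm2; rewrite d1 n1.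
case: eqP => [dN|/eqP dN].
  have d10 : d - 1 != 0 by rewrite subr_eq0.
  split.
    apply: regularM; first exact: regularM.
    by rewrite expr2 invfM; apply: regularM; apply: V0.
  rewrite invfM invrK invfM; apply: regularM; last by rewrite expr2; apply: regularM.
  by apply: regularM; [apply: Vp2; rewrite dN n2 oner_neq0|apply: Vm1].
have d1' : d + 1 != 0 by rewrite addr_eq0.
by split; rewrite ?invfM ?invrK; apply: regularM => //; [apply: V0|apply: Vp1].
Qed.

Lemma regular_const_coef (a : 'I_n -> k) (i : 'I_n.-1) : regular a (const_coef (a (hi i) - a (lo i)) (@simple_root k n i) : F).
Proof.
rewrite /const_coef; case: eqP => [_|/eqP d0]; first exact: regular1.
apply: regularN; rewrite -[root i]addr0 -tofrac0 -mpolyC0; apply: regular_root_inv.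
by rewrite addr0 -opprB oppr_eq0.
Qed.
End CoefficientRegularity.

(** * The change of generators on weight modules *)

Lemma solve_quad (K : fieldType) (u q r : K) :
  u != 0 -> r = 1 - u * q -> q = u^-1 * (1 - r).
Proof. by move=> u0 ->; rewrite opprB addrC subrK mulKf. Qed.

Section QuiverPolynomialsAsFractions.
Variables (k : fieldType) (n : nat).
Local Notation F := {fraction {mpoly k[n]}}.

Lemma klr_Q_morph (R S : comNzRingType) (f : {rmorphism R -> S}) (a b : k) u v :
  f (klr_Q a b u v) = klr_Q a b (f u) (f v).
Proof.
rewrite /klr_Q; case: ifP => _; first exact: rmorph0.
by rewrite rmorphM /klr_P !rmorphXn !rmorphB.
Qed.

(** In the shifted variables [x_j = X_j - nu_j] the quiver polynomial only
    depends on the difference of the [X]'s. *)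
Lemma klr_QF (a b : k) (X Y : F) :
  klr_Q a b (X - a%:MP%:F) (Y - b%:MP%:F) = klr_quad (b - a) (X - Y).
Proof.
rewrite /klr_Q /klr_quad subr_eq0 [b == a]eq_sym; case: eqP => // _.
have -> : (b - a == 1) = (b == a + 1) by rewrite subr_eq addrC.
have -> : (b - a == - 1) = (a == b + 1) by rewrite -(opprB a b) eqr_opp subr_eq addrC.
rewrite /klr_P /arrows; congr (_ * _); case: eqP => [->|_]; rewrite ?expr0 // expr1.
  by rewrite mpolyCD tofracD const1F opprB; ring.
by rewrite mpolyCD tofracD const1F; ring.
Qed.
End QuiverPolynomialsAsFractions.

(* the bookkeeping of the eight terms on each side of the braid relation *)
Lemma braid_sum (V : zmodType) (w1 w2 p q e1 e4 e1' e4' r2 l4 r3 r2' l4' r3' z : V) :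
  r2 + l4 = r3' -> r2' + l4' = r3 -> e1 + e4 = z + (e1' + e4') ->
  w1 + p + (e1 + r2) + (q + r3 + (l4 + e4)) + w2 =
  w2 + q + (e1' + r2') + (p + r3' + (l4' + e4')) + (w1 + z).
Proof.
move=> <- <- e; rewrite !addrA [LHS](ACl ((3*9)*1*2*4*5*6*7*8*10))/= e !addrA.
by rewrite [LHS](ACl (11*7*2*8*5*6*10*9*3*4*1))/=.
Qed.

Section ChangeOfGenerators.
Variables (k : fieldType) (I : {pred k}) (n : nat) (V : lmodType k).
Variable pa : alg_action {mpoly k[n]} V.
Local Notation L := (weight I n).
Local Notation F := {fraction {mpoly k[n]}}.
Local Notation W nu := (wspace pa (coordinate nu)).
Local Notation "f ## v" := (frac_act pa f v) (at level 40, v at next level).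
Implicit Types (nu mu : L) (i j : 'I_n.-1) (f g : F) (u v : V).

Definition fsym i : {rmorphism F -> F} := frac_sym (simple i).
Definition tau_coef_at i nu : F := tau_coef (diff i nu) (simple_root k i).
Definition const_coef_at i nu : F := const_coef (diff i nu) (simple_root k i).
Definition quad_at i nu : F := klr_quad (diff i nu) (simple_root k i).
Definition left_at i nu f : F := left_coef (fsym i) (diff i nu) (simple_root k i) f.
Definition right_at i nu f : F := right_coef (fsym i) (diff i nu) (simple_root k i) f.
Definition braid_at i j nu : F :=
  braid_defect (rvar k (lo i)) (rvar k (hi i)) (rvar k (hi j)) (diff i nu) (diff j nu).

(** The polynomial in the [X]'s that acts as [x_a] on [1_nu M]. *)
Definition shifted_var nu (a : 'I_n) : {mpoly k[n]} := 'X_a - (coordinate nu a)%:MP.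

Lemma shifted_varF nu a : (shifted_var nu a)%:F = rvar k a - (coordinate nu a)%:MP%:F.
Proof. exact: tofracB. Qed.

Lemma klr_Q_shifted (c d : k) nu (a b : 'I_n) :
  (klr_Q c d (shifted_var nu a) (shifted_var nu b))%:F =
  klr_Q c d (rvar k a - (coordinate nu a)%:MP%:F) (rvar k b - (coordinate nu b)%:MP%:F).
Proof. by rewrite klr_Q_morph -!shifted_varF. Qed.

Lemma quad_at_poly i nu : quad_at i nu =
  (klr_Q (coordinate nu (lo i)) (coordinate nu (hi i))
     (shifted_var nu (lo i)) (shifted_var nu (hi i)))%:F.
Proof. by rewrite klr_Q_shifted klr_QF. Qed.

Lemma braid_at_poly i j nu (D : {mpoly k[n]}) : j = i.+1 :> nat ->
  nu (lo i) = nu (hi j) ->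
  (shifted_var nu (hi j) - shifted_var nu (lo i)) * D =
    klr_Q (coordinate nu (lo i)) (coordinate nu (hi i))
      (shifted_var nu (hi j)) (shifted_var nu (hi i)) -
    klr_Q (coordinate nu (lo i)) (coordinate nu (hi i))
      (shifted_var nu (lo i)) (shifted_var nu (hi i)) ->
  braid_at i j nu = D%:F.
Proof.
move=> ij e /(congr1 (@tofrac _)).
have ec : coordinate nu (hi j) = coordinate nu (lo i) by rewrite /coordinate e.
rewrite tofracM (tofracB (shifted_var nu (hi j))) (tofracB (klr_Q _ _ _ _)).
rewrite !klr_Q_shifted !shifted_varF ec !klr_QF => eD.
rewrite /braid_at /braid_defect (diff_adj0 _ ij) e eqxx -eD.
rewrite opprB addrA subrK mulrC mulKf //; apply: rvar_sub_neq0.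
by rewrite -val_eqE /= ij; lia.
Qed.

Lemma regular_braid_at i j nu : j = i.+1 :> nat -> regular (coordinate nu) (braid_at i j nu).
Proof.
move=> ij; have [e|ne] := eqVneq (nu (lo i)) (nu (hi j)); last first.
  by rewrite /braid_at /braid_defect (diff_adj0 _ ij) (negbTE ne); apply: regular0.
have [D hD] := klr_Q_divided_difference (coordinate nu (lo i)) (coordinate nu (hi i))
  (shifted_var nu (lo i)) (shifted_var nu (hi i)) (shifted_var nu (hi j)).
by rewrite (braid_at_poly ij e hD); apply: regular_poly.
Qed.

(** The relations of the quiver Hecke algebra and of the degenerate affine Hecke
    algebra, for operators on a module over polynomials in [X_1, ..., X_n].  The
    former are stated weight by weight, in the variables [X] instead of
    [x_j = X_j - nu_j]. *)
Record klr_operators (t : 'I_n.-1 -> V -> V) : Prop := KlrOperators {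
  klr_op_linear : forall i, linear (t i);
  klr_op_wspace : forall i nu v, W nu v -> W (permute i nu) (t i v);
  klr_op_twisted : forall i nu, twisted pa i (diff i nu == 0) (coordinate nu) (t i);
  klr_op_quad : forall i nu v, W nu v -> t i (t i v) = quad_at i nu ## v;
  klr_op_far : forall i j v, far i j -> t i (t j v) = t j (t i v);
  klr_op_braid : forall i j nu v, j = i.+1 :> nat -> W nu v ->
    t j (t i (t j v)) - t i (t j (t i v)) = braid_at i j nu ## v }.

Record hecke_operators (T : 'I_n.-1 -> V -> V) : Prop := HeckeOperators {
  hecke_op_linear : forall i, linear (T i);
  hecke_op_twisted : forall i p D v, D%:F = demazure i p%:F ->
    T i (pa p v) = pa (msym (simple i) p) (T i v) + pa D v;
  hecke_op_quad : forall i v, T i (T i v) = v;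
  hecke_op_far : forall i j v, far i j -> T i (T j v) = T j (T i v);
  hecke_op_braid : forall i j v, j = i.+1 :> nat ->
    T j (T i (T j v)) = T i (T j (T i v)) }.

Definition related (t T : 'I_n.-1 -> V -> V) : Prop :=
  forall i nu v, W nu v -> T i v = tau_coef_at i nu ## t i v + const_coef_at i nu ## v.

Lemma regular_tau_coef_at i nu : regular (coordinate (permute i nu)) (tau_coef_at i nu).
Proof.
have [h _] := regular_tau_coef (coordinate (permute i nu)) i; move: h.
by rewrite !coordinate_permute simple_lo simple_hi.
Qed.

Lemma regular_tau_coef_inv i nu : regular (coordinate (permute i nu)) (tau_coef_at i nu)^-1.
Proof.
have [_ h] := regular_tau_coef (coordinate (permute i nu)) i; move: h.
by rewrite !coordinate_permute simple_lo simple_hi.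
Qed.

Lemma regular_const_coef_at i nu : regular (coordinate nu) (const_coef_at i nu).
Proof. exact: regular_const_coef. Qed.

Lemma tau_coef_at_neq0 i nu : tau_coef_at i nu != 0.
Proof. exact/tau_coef_neq0/generic_root. Qed.

Lemma regular_fsym i nu f : regular (coordinate nu) f ->
  regular (coordinate (permute i nu)) (fsym i f).
Proof. by apply: regular_sym => a; rewrite /= coordinate_permute simpleK. Qed.

Lemma regular_left i nu f : regular (coordinate nu) f ->
  regular (coordinate (permute i nu)) (left_at i nu f).
Proof. by move=> h; apply: regularM; [exact: regular_tau_coef_at|exact: regular_fsym]. Qed.

Lemma regular_right i nu f : regular (coordinate nu) f ->
  regular (coordinate nu) (right_at i nu f).
Proof.
move=> h; apply: regularD; last by apply: regularM => //; exact: regular_const_coef_at.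
case: eqP => [d0|_]; last by rewrite mulr0; apply: regular0.
apply: regularM.
  by have := regular_tau_coef_at i nu; rewrite (permute_diff0 d0).
apply: regular_demazure => //; apply/eqP; rewrite /coordinate val_eqE -diff_eq0.
exact/eqP.
Qed.

Lemma left_at_neq0 i nu f : f != 0 -> left_at i nu f != 0.
Proof. by move=> f0; apply: mulf_neq0; [exact: tau_coef_at_neq0|rewrite fmorph_eq0]. Qed.

(* the terms of degree zero in the braid relation *)
Lemma frac_act_combine nu (f q r f' q' r' g b : F) v : W nu v ->
  regular (coordinate nu) f -> regular (coordinate nu) q -> regular (coordinate nu) r ->
  regular (coordinate nu) f' -> regular (coordinate nu) q' -> regular (coordinate nu) r' ->
  (g * b) ## v = g ## (b ## v) -> f * q + r - (f' * q' + r') = g * b ->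
  f ## (q ## v) + r ## v = g ## (b ## v) + (f' ## (q' ## v) + r' ## v).
Proof.
move=> hv rf rq rr rf' rq' rr' <- <-.
rewrite -(frac_actM rf rq hv) -(frac_actM rf' rq' hv).
rewrite -(frac_actDl (regularM rf rq) rr hv) -(frac_actDl (regularM rf' rq') rr' hv).
have rD := regularD (regularM rf rq) rr; have rD' := regularD (regularM rf' rq') rr'.
by rewrite (frac_actBl rD rD' hv) subrK.
Qed.

(** From here on only the weights and the commutation rule of [t] are assumed.
    Each remaining relation for [T] is equivalent to the same relation for [t],
    because the defect of the one is an invertible rational function times the
    defect of the other. *)
Section Related.
Variables t T : 'I_n.-1 -> V -> V.
Hypothesis t_wspace : forall i nu v, W nu v -> W (permute i nu) (t i v).
Hypothesis t_twisted : forall i nu,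
  twisted pa i (diff i nu == 0) (coordinate nu) (t i).
Hypothesis T_linear : forall i, linear (T i).
Hypothesis tT : related t T.

Lemma related_frac i nu f v : regular (coordinate nu) f -> W nu v ->
  T i (f ## v) = left_at i nu f ## t i v + right_at i nu f ## v.
Proof.
move=> rf hv; have hfv := wspace_frac rf hv; have htv := @t_wspace i _ _ hv.
rewrite (tT i hfv) (twisted_frac (b := coordinate (permute i nu)) _ _ _ (@t_twisted i nu)) //; first last.
- by move=> u; apply: t_wspace.
- by move=> a; rewrite /= coordinate_permute simpleK.
- by rewrite diff_eq0 => /eqP e; rewrite /coordinate e.
have rs := regular_fsym i rf.
have rt := regular_tau_coef_at i nu; have rc := regular_const_coef_at i nu.
rewrite /right_at /right_coef; case: eqP => [d0|_].
  have rd : regular (coordinate nu) (demazure i f).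
    apply: regular_demazure => //; apply/eqP.
    by rewrite /coordinate val_eqE -diff_eq0; apply/eqP.
  have hd := wspace_frac rd hv; move: rs rt htv; rewrite (permute_diff0 d0) => rs rt htv.
  rewrite (frac_actDr rt (wspace_frac rs htv) hd) -(frac_actM rt rs htv).
  rewrite -(frac_actM rt rd hv) -addrA; congr (_ + _).
  by rewrite -(frac_actM rc rf hv) -(frac_actDl (regularM rt rd) (regularM rc rf) hv).
by rewrite addr0 mulr0 add0r (frac_actM rt rs htv) (frac_actM rc rf hv).
Qed.

(** Rational functions that are units act injectively. *)
Lemma frac_unit_inj nu f v : f != 0 -> regular (coordinate nu) f ->
  regular (coordinate nu) f^-1 -> W nu v -> f ## v = 0 -> v = 0.
Proof.
move=> f0 rf rfV hv e; rewrite -(frac_act1 hv) -(mulVf f0) (frac_actM rfV rf hv) e.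
exact: frac_act0r.
Qed.

Let TD i u v : T i (u + v) = T i u + T i v.
Proof. by rewrite -[u in LHS]scale1r T_linear scale1r. Qed.

Lemma related_quad i nu v : W nu v ->
  (T i (T i v) = v) <-> (t i (t i v) = quad_at i nu ## v).
Proof.
move=> hv; have htv := @t_wspace i _ _ hv; have := @t_wspace i _ _ htv; rewrite permuteK => httv.
have rt := regular_tau_coef_at i nu; have rc := regular_const_coef_at i nu.
pose U := left_at i (permute i nu) (tau_coef_at i nu).
have rU : regular (coordinate nu) U by have := regular_left i rt; rewrite permuteK.
have U0 : U != 0 by rewrite mulf_neq0 // ?fmorph_eq0 tau_coef_at_neq0.
have rUV : regular (coordinate nu) U^-1.
  rewrite /U /left_at /left_coef invfM -fmorphV; apply: regularM.
    by have := regular_tau_coef_inv i (permute i nu); rewrite permuteK.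
  by have := regular_fsym i (regular_tau_coef_inv i nu); rewrite permuteK.
have sy : fsym i (simple_root k i) = - simple_root k i.
  by rewrite /fsym /simple_root rmorphB /= !frac_sym_rvar simple_lo simple_hi opprB.
have [e1 e2] : right_at i (permute i nu) (tau_coef_at i nu) +
      left_at i nu (const_coef_at i nu) = 0 /\
    right_at i nu (const_coef_at i nu) = 1 - U * quad_at i nu.
  rewrite /U /right_at /left_at diff_permute.
  exact: quadratic_coefficients sy (generic_root k i) (@char2F k n).
have rr := regular_right i rc; have rr' := regular_right i rt.
have rl := regular_left i rc.
have -> : T i (T i v) = U ## t i (t i v) +
    (right_at i (permute i nu) (tau_coef_at i nu) + left_at i nu (const_coef_at i nu)) ## t i v
    + right_at i nu (const_coef_at i nu) ## v.
  rewrite (frac_actDl rr' rl htv) {1}(tT i hv) TD.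
  by rewrite (related_frac i rt htv) (related_frac i rc hv) -/U !addrA.
clearbody U.
have rq : regular (coordinate nu) (quad_at i nu).
  rewrite (solve_quad U0 e2); apply: regularM => //.
  by apply: regularB; [exact: regular1|exact: rr].
have hq := wspace_frac rq hv.
rewrite e1 (frac_act0 htv) addr0 e2 (frac_actBl (@regular1 _ _ _) (regularM rU rq) hv).
rewrite (frac_act1 hv) (frac_actM rU rq hv) addrCA -(frac_actBr rU httv hq).
split=> [/(canRL (addKr _))|->]; last by rewrite subrr frac_act0r addr0.
rewrite addNr => /(frac_unit_inj U0 rU rUV (wspaceB httv hq)) /eqP.
by rewrite subr_eq0 => /eqP.
Qed.

Let fsym_far i j : far i j -> fsym i (simple_root k j) = simple_root k j.
Proof.
move=> ij; rewrite /fsym /simple_root rmorphB /= !frac_sym_rvar.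
by rewrite far_lo ?far_hi.
Qed.

Let related_far_expand i j nu v : far i j -> W nu v ->
  T i (T j v) = (tau_coef_at i nu * tau_coef_at j nu) ## t i (t j v)
    + (const_coef_at i nu * tau_coef_at j nu) ## t j v
    + ((tau_coef_at i nu * const_coef_at j nu) ## t i v
       + (const_coef_at i nu * const_coef_at j nu) ## v).
Proof.
move=> ij hv; have htv := @t_wspace j _ _ hv.
rewrite {1}(tT j hv) TD (related_frac i (regular_tau_coef_at j nu) htv).
rewrite (related_frac i (regular_const_coef_at j nu) hv).
rewrite /left_at /right_at /left_coef (right_coef_hecke _ _ (generic_root k i)).
rewrite (right_coef_hecke _ _ (generic_root k i)) (diff_far _ ij).
rewrite rmorph_tau_coef rmorph_const_coef (fsym_far ij).
by rewrite !subrr !mul0r !addr0.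
Qed.

Lemma related_far i j nu v : far i j -> W nu v ->
  (T i (T j v) = T j (T i v)) <-> (t i (t j v) = t j (t i v)).
Proof.
move=> ij hv; have ji : far j i by rewrite far_sym.
rewrite (related_far_expand ij hv) (related_far_expand ji hv).
have h1 := @t_wspace i _ _ (@t_wspace j _ _ hv).
have h2 := @t_wspace j _ _ (@t_wspace i _ _ hv).
rewrite -(permute_far _ ij) in h2.
have n1 := tau_coef_at_neq0 i nu; have n2 := tau_coef_at_neq0 j nu.
have r1 : regular (coordinate (permute i (permute j nu))) (tau_coef_at i nu).
  have := regular_tau_coef_at i (permute j nu).
  by rewrite /tau_coef_at (diff_far _ ij).
have r1V : regular (coordinate (permute i (permute j nu))) (tau_coef_at i nu)^-1.
  have := regular_tau_coef_inv i (permute j nu).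
  by rewrite /tau_coef_at (diff_far _ ij).
have r2 : regular (coordinate (permute i (permute j nu))) (tau_coef_at j nu).
  have := regular_tau_coef_at j (permute i nu).
  by rewrite /tau_coef_at (diff_far _ ji) (permute_far _ ji).
have r2V : regular (coordinate (permute i (permute j nu))) (tau_coef_at j nu)^-1.
  have := regular_tau_coef_inv j (permute i nu).
  by rewrite /tau_coef_at (diff_far _ ji) (permute_far _ ji).
rewrite [tau_coef_at j nu * tau_coef_at i nu]mulrC.
rewrite [tau_coef_at j nu * const_coef_at i nu]mulrC.
rewrite [const_coef_at j nu * tau_coef_at i nu]mulrC.
rewrite [const_coef_at j nu * const_coef_at i nu]mulrC.
have n12 := mulf_neq0 n1 n2; have r12 := regularM r1 r2.
have r12V : regular (coordinate (permute i (permute j nu)))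
    (tau_coef_at i nu * tau_coef_at j nu)^-1 by rewrite invfM; apply: regularM.
move: (tau_coef_at i nu * tau_coef_at j nu) n12 r12 r12V => U U0 rU rUV.
move: (_ ## t j v) (_ ## t i v) (_ ## v) => a b c.
rewrite -!addrA [b + (a + c)]addrCA; split=> [/addIr e|->//].
apply/eqP; rewrite -subr_eq0; apply/eqP.
apply: (frac_unit_inj U0 rU rUV (wspaceB h1 h2)).
by rewrite (frac_actBr rU h1 h2) e subrr.
Qed.


Let related_triple i j nu v : W nu v ->
  let f1 := left_at j (permute i nu) (tau_coef_at i nu) in
  let f2 := right_at j (permute i nu) (tau_coef_at i nu) in
  let f3 := left_at j nu (const_coef_at i nu) in
  let f4 := right_at j nu (const_coef_at i nu) in
  T i (T j (T i v)) =
    left_at i (permute j (permute i nu)) f1 ## t i (t j (t i v))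
    + right_at i (permute j (permute i nu)) f1 ## t j (t i v)
    + (left_at i (permute i nu) f2 ## t i (t i v) + right_at i (permute i nu) f2 ## t i v)
    + (left_at i (permute j nu) f3 ## t i (t j v) + right_at i (permute j nu) f3 ## t j v
       + (left_at i nu f4 ## t i v + right_at i nu f4 ## v)).
Proof.
move=> hv f1 f2 f3 f4; have hi := @t_wspace i _ _ hv; have hj := @t_wspace j _ _ hv.
have hji := @t_wspace j _ _ hi.
have rt := regular_tau_coef_at i nu; have rc := regular_const_coef_at i nu.
have r1 := regular_left j rt; have r2 := regular_right j rt.
have r3 := regular_left j rc; have r4 := regular_right j rc.
rewrite {1}(tT i hv) TD (related_frac j rt hi) (related_frac j rc hv) !TD.
rewrite (related_frac i r1 hji) (related_frac i r2 hi).
by rewrite (related_frac i r3 hj) (related_frac i r4 hv).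
Qed.

Section Braid.
Variables (i j : 'I_n.-1) (nu : L).
Hypothesis ij : j = i.+1 :> nat.

Let f1 := left_at j (permute i nu) (tau_coef_at i nu).
Let f2 := right_at j (permute i nu) (tau_coef_at i nu).
Let f3 := left_at j nu (const_coef_at i nu).
Let f4 := right_at j nu (const_coef_at i nu).
Let g1 := left_at i (permute j nu) (tau_coef_at j nu).
Let g2 := right_at i (permute j nu) (tau_coef_at j nu).
Let g3 := left_at i nu (const_coef_at j nu).
Let g4 := right_at i nu (const_coef_at j nu).

Let braid_coefs :
 [/\ left_at i (permute j (permute i nu)) f1 = left_at j (permute i (permute j nu)) g1,
     right_at i (permute j (permute i nu)) f1 = left_at j (permute i nu) g3 /\
     right_at j (permute i (permute j nu)) g1 = left_at i (permute j nu) f3,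
     right_at i (permute i nu) f2 + left_at i nu f4 = right_at j (permute i nu) g3,
     right_at j (permute j nu) g2 + left_at j nu g4 = right_at i (permute j nu) f3
   & left_at i (permute i nu) f2 * quad_at i nu + right_at i nu f4
     - (left_at j (permute j nu) g2 * quad_at j nu + right_at j nu g4)
     = left_at i (permute j (permute i nu)) f1 * braid_at i j nu].
Proof.
rewrite /f1 /f2 /f3 /f4 /g1 /g2 /g3 /g4 /left_at /right_at /tau_coef_at /const_coef_at.
rewrite /quad_at /braid_at !(diff_adj3 _ ij) !(diff_adj4 _ ij) !(diff_adj1 _ ij).
rewrite !(diff_adj2 _ ij) !diff_permute.
have rj : simple_root k j = rvar k (hi i) - rvar k (hi j).
  by rewrite /simple_root (lo_succ ij).
rewrite rj; apply: (@braid_coefficientsP k F (fsym i) (fsym j)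
  (rvar k (lo i)) (rvar k (hi i)) (rvar k (hi j))).
- by rewrite /fsym /= frac_sym_rvar simple_lo.
- by rewrite /fsym /= frac_sym_rvar simple_hi.
- by rewrite /fsym /= frac_sym_rvar succ_simple_hi.
- by rewrite /fsym /= frac_sym_rvar succ_simple_lo.
- by rewrite /fsym /= frac_sym_rvar -(lo_succ ij) simple_lo.
- by rewrite /fsym /= frac_sym_rvar simple_hi (lo_succ ij).
- exact/generic_rvar/lo_neq_hi.
- by rewrite -(lo_succ ij); apply/generic_rvar/lo_neq_hi.
- by apply: generic_rvar; rewrite -val_eqE /= ij; lia.
- exact: char2F.
Qed.

Lemma related_braid v : W nu v ->
  t i (t i v) = quad_at i nu ## v -> t j (t j v) = quad_at j nu ## v ->
  (T j (T i (T j v)) = T i (T j (T i v))) <->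
  (t j (t i (t j v)) - t i (t j (t i v)) = braid_at i j nu ## v).
Proof.
move=> hv qi qj; have hti := @t_wspace i _ _ hv; have htj := @t_wspace j _ _ hv.
have hw1 := @t_wspace i _ _ (@t_wspace j _ _ hti).
have hw2 := @t_wspace j _ _ (@t_wspace i _ _ htj).
rewrite -(permute_braid _ ij) in hw2.
have rti := regular_tau_coef_at i nu; have rtj := regular_tau_coef_at j nu.
have rci := regular_const_coef_at i nu; have rcj := regular_const_coef_at j nu.
have rf2 := regular_right j rti; have rg2 := regular_right i rtj.
have rf4 := regular_right j rci; have rg4 := regular_right i rcj.
have rqi : regular (coordinate nu) (quad_at i nu).
  by rewrite quad_at_poly; apply: regular_poly.
have rqj : regular (coordinate nu) (quad_at j nu).
  by rewrite quad_at_poly; apply: regular_poly.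
have rLi : regular (coordinate nu) (left_at i (permute i nu) f2).
  by have := regular_left i rf2; rewrite permuteK.
have rLj : regular (coordinate nu) (left_at j (permute j nu) g2).
  by have := regular_left j rg2; rewrite permuteK.
have rRi := regular_right i rf4; have rRj := regular_right j rg4.
have rR2i := regular_right i rf2; have rR2j := regular_right j rg2.
have rL4i := regular_left i rf4; have rL4j := regular_left j rg4.
have [c1 [c2 c3] c4 c5 c6] := braid_coefs.
have z4 : right_at i (permute i nu) f2 ## t i v + left_at i nu f4 ## t i v =
    right_at j (permute i nu) g3 ## t i v by rewrite -c4 (frac_actDl rR2i rL4i hti).
have z5 : right_at j (permute j nu) g2 ## t j v + left_at j nu g4 ## t j v =
    right_at i (permute j nu) f3 ## t j v by rewrite -c5 (frac_actDl rR2j rL4j htj).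
pose U := left_at i (permute j (permute i nu)) f1.
have [U0 rU rUV] : [/\ U != 0, regular (coordinate (permute i (permute j (permute i nu)))) U
    & regular (coordinate (permute i (permute j (permute i nu)))) U^-1].
  have r1 := regular_left j rti.
  split; last 1 first.
  - rewrite /U /left_at /left_coef invfM -fmorphV; apply: regularM.
      exact: regular_tau_coef_inv.
    apply: regular_fsym; rewrite /f1 /left_at /left_coef invfM -fmorphV.
    apply: regularM; first exact: regular_tau_coef_inv.
    by apply: regular_fsym; exact: regular_tau_coef_inv.
  - exact/left_at_neq0/left_at_neq0/tau_coef_at_neq0.
  - exact: regular_left.
(* the defect of the braid relation is nonzero only if [nu] is fixed by the
   transposition of its first and third entries *)
have [hd zd] : W (permute i (permute j (permute i nu))) (braid_at i j nu ## v) /\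
    (U * braid_at i j nu) ## v = U ## (braid_at i j nu ## v).
  have [e|ne] := eqVneq (nu (lo i)) (nu (hi j)); last first.
    have -> : braid_at i j nu = 0.
      by rewrite /braid_at /braid_defect (diff_adj0 _ ij) (negbTE ne).
    have z0 := frac_act0 hv; rewrite mulr0 z0 frac_act0r.
    by split; [exact: wspace0|].
  have e' : permute i (permute j (permute i nu)) = nu.
    have /eqP/permute_diff0 ee : diff j (permute i nu) == 0.
      by rewrite (diff_adj1 _ ij) (diff_adj0 _ ij) e eqxx.
    by rewrite ee permuteK.
  rewrite e' in rU *; have rb := regular_braid_at nu ij.
  by split; [exact: wspace_frac rb hv|rewrite (frac_actM rU rb hv)].
have z6 : left_at i (permute i nu) f2 ## t i (t i v) + right_at i nu f4 ## v =
   U ## (braid_at i j nu ## v) +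
   (left_at j (permute j nu) g2 ## t j (t j v) + right_at j nu g4 ## v).
  rewrite qi qj; exact: frac_act_combine hv rLi rqi rRi rLj rqj rRj zd c6.
have eT : T i (T j (T i v)) + U ## t j (t i (t j v)) =
    T j (T i (T j v)) + (U ## t i (t j (t i v)) + U ## (braid_at i j nu ## v)).
  rewrite (@related_triple i j nu v hv) (@related_triple j i nu v hv).
  rewrite -/f1 -/f2 -/f3 -/f4 -/g1 -/g2 -/g3 -/g4 c2 c3 -c1 -/U.
  exact: braid_sum z4 z5 z6.
rewrite -(frac_actDr rU hw1 hd) in eT.
split=> [eTT|eb].
  move: eT; rewrite eTT => /addrI e; apply/eqP; rewrite -subr_eq0 -addrA -opprD subr_eq0.
  rewrite -subr_eq0; apply/eqP.
  apply: (frac_unit_inj U0 rU rUV (wspaceB hw2 (wspaceD hw1 hd))).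
  by rewrite (frac_actBr rU hw2 (wspaceD hw1 hd)) e subrr.
move: eT; rewrite -eb addrCA subrr addr0 => /addIr; exact: esym.
Qed.
End Braid.
End Related.
End ChangeOfGenerators.

Section TransferOfRelations.
Variables (k : fieldType) (I : {pred k}) (n : nat) (V : lmodType k).
Variable pa : alg_action {mpoly k[n]} V.
Local Notation L := (weight I n).
Local Notation F := {fraction {mpoly k[n]}}.
Local Notation W nu := (wspace pa (coordinate nu)).
Local Notation "f ## v" := (frac_act pa f v) (at level 40, v at next level).
Implicit Types (nu mu : L) (i j : 'I_n.-1) (f g : F) (u v : V).

Hypothesis W_sum : direct_sum (fun nu : L => W nu).

Let W0 nu : W nu 0. Proof. exact: wspace0. Qed.
Let W_linear nu c u v : W nu u -> W nu v -> W nu (c *: u + v).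
Proof. by move=> hu hv; apply: wspaceD => //; apply: wspaceZ. Qed.

Let ext (f g : {linear V -> V}) :
  (forall nu v, W nu v -> f v = g v) -> f =1 g.
Proof. by move=> h; apply: (sum_ext W_sum W0 W_linear) => //; apply: linearP. Qed.

Lemma hecke_of_klr (t : 'I_n.-1 -> V -> V) : klr_operators I pa t ->
  exists T : 'I_n.-1 -> {linear V -> V}, hecke_operators pa (fun i => T i) /\
    related I pa t (fun i => T i).
Proof.
move=> kt; have [t_lin t_W t_tw t_quad t_far t_braid] := kt.
have /choice[T TE] : forall i, exists g : {linear V -> V}, forall nu v, W nu v ->
    g v = tau_coef_at i nu ## t i v + const_coef_at i nu ## v.
  move=> i; apply: (glue W_sum W0 W_linear
    (f := fun nu v => tau_coef_at i nu ## t i v + const_coef_at i nu ## v)).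
  move=> nu c u v hu hv; rewrite t_lin.
  rewrite (frac_act_linear _ (regular_tau_coef_at i nu) (t_W i _ _ hu) (t_W i _ _ hv)).
  rewrite (frac_act_linear _ (regular_const_coef_at i nu) hu hv).
  by rewrite scalerDr addrACA.
have T_lin i : linear (T i) by apply: linearP.
have rel : related I pa t (fun i => T i) by [].
exists T; split=> //; split=> //.
- move=> i p D v hD; move: v.
  apply: (ext (f := T i \o pa p) (g := pa (msym (simple i) p) \o T i \+ pa D)) => nu v hv /=.
  have rp := regular_poly (coordinate nu) p; have ht := t_W i _ _ hv.
  have rD := regular_poly (coordinate nu) D.
  have rt := regular_tau_coef_at i nu; have rc := regular_const_coef_at i nu.
  rewrite -{1}(frac_act_poly p hv) (related_frac t_W t_tw rel i rp hv).
  rewrite /left_at /left_coef /right_at (right_coef_hecke _ _ (generic_root k i)).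
  rewrite -/(demazure i p%:F) -hD /fsym /= frac_sym_poly -/(const_coef_at i nu) -/(tau_coef_at i nu).
  have rsp nu' := regular_poly (coordinate nu') (msym (simple i) p).
  rewrite (frac_actDl (regularM rc (rsp _)) rD hv) (frac_act_poly D hv) addrA.
  congr (_ + _); rewrite (TE i nu v hv) linearD /=.
  rewrite -(frac_act_poly _ (wspace_frac rt ht)) -(frac_act_poly _ (wspace_frac rc hv)).
  rewrite -(frac_actM (rsp _) rt ht) -(frac_actM (rsp _) rc hv).
  by rewrite [_%:F * tau_coef_at _ _]mulrC [_%:F * const_coef_at _ _]mulrC.
- move=> i; apply: (ext (f := T i \o T i) (g := idfun)) => nu v hv /=.
  by apply/(related_quad t_W t_tw T_lin rel i hv)/t_quad.
- move=> i j + ij; apply: (ext (f := T i \o T j) (g := T j \o T i)) => nu v hv /=.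
  by apply/(related_far t_W t_tw T_lin rel ij hv)/t_far.
- move=> i j + ij; apply: (ext (f := T j \o T i \o T j) (g := T i \o T j \o T i)) => nu v hv /=.
  by apply/(related_braid t_W t_tw T_lin rel ij hv); [exact: t_quad..|exact: t_braid].
Qed.

(** [T_i - const_coef] obeys the commutation rule of [tau_i] up to the factor
    [tau_coef], hence maps each generalized eigenspace to the permuted one, where
    [tau_coef] can be inverted. *)
Lemma klr_of_hecke (T : 'I_n.-1 -> V -> V) : hecke_operators pa T ->
  exists t : 'I_n.-1 -> {linear V -> V}, klr_operators I pa (fun i => t i) /\
    related I pa (fun i => t i) T.
Proof.
move=> hT; have [T_lin T_tw T_quad T_far T_braid] := hT.
have T0 i : T i 0 = 0.
  by have := T_lin i (-1) 0 0; rewrite scaler0 addr0 scaleN1r addNr.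
pose Phi i nu v := T i v - const_coef_at i nu ## v.
have PhiM i nu p D v : W nu v -> D%:F = demazure i p%:F ->
    Phi i nu (pa p v) = pa (msym (simple i) p) (Phi i nu v) +
      (if diff i nu == 0 then tau_coef_at i nu ## pa D v else 0).
  move=> hv hD; rewrite /Phi (T_tw i p D v hD).
  have rc := regular_const_coef_at i nu; have rt := regular_tau_coef_at i nu.
  have rp q := regular_poly (coordinate nu) q.
  have e : const_coef_at i nu ## pa p v + (if diff i nu == 0 then tau_coef_at i nu ## pa D v else 0)
      = const_coef_at i nu ## pa (msym (simple i) p) v + pa D v.
    rewrite -(frac_act_poly p hv) -(frac_act_poly (msym _ p) hv) -(frac_act_poly D hv).
    rewrite -(frac_actM rc (rp _) hv) -(frac_actM rc (rp _) hv).
    rewrite -(frac_actDl (regularM rc (rp _)) (rp _) hv).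
    have <- : right_at i nu p%:F = const_coef_at i nu * (msym (simple i) p)%:F + D%:F.
      by rewrite /right_at (right_coef_hecke _ _ (generic_root k i)) -/(demazure i p%:F) -hD
        /fsym /= frac_sym_poly.
    rewrite /right_at /right_coef /fsym /= -/(demazure i p%:F) -hD.
    rewrite -/(const_coef_at i nu) -/(tau_coef_at i nu).
    case: eqP => [d0|_]; last by rewrite mulr0 add0r addr0.
    rewrite (permute_diff0 d0) in rt.
    rewrite (frac_actDl (regularM rt (rp _)) (regularM rc (rp _)) hv) addrC.
    by rewrite (frac_actM rt (rp _) hv).
  have hsp : const_coef_at i nu ## pa (msym (simple i) p) v =
      pa (msym (simple i) p) (const_coef_at i nu ## v).
    rewrite -(frac_act_poly _ hv) -(frac_act_poly _ (wspace_frac rc hv)).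
    rewrite -(frac_actM rc (rp _) hv) -(frac_actM (rp _) rc hv).
    by rewrite [const_coef_at _ _ * _]mulrC.
  apply: (addrI (const_coef_at i nu ## pa p v)); rewrite addrCA subrr addr0.
  by rewrite [RHS]addrCA e linearB /= -hsp addrA subrK.
have PhiW i nu v : W nu v -> W (permute i nu) (Phi i nu v).
  move=> hv p p0.
  have sp0 : (msym (simple i) p).@[coordinate nu] = 0.
    rewrite meval_msym -[RHS]p0; apply: meval_eq => a /=.
    by rewrite coordinate_permute.
  have [N hN] := hv _ sp0.
  have [D hD] := demazure_poly i (msym (simple i) p ^+ N).
  have := PhiM i nu _ D v hv hD; rewrite hN rmorphXn /= msym_comp.
  have -> : (simple i * simple i = 1)%g by exact: tperm2.
  rewrite msym_id {1}/Phi T0 frac_act0r subr0; case: eqP => [d0|_]; last first.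
    by rewrite addr0 => e; exists N.
  move: p0; rewrite (permute_diff0 d0) => p0 e.
  have rt := regular_tau_coef_at i nu; rewrite (permute_diff0 d0) in rt.
  have [M hM] := wspace_frac rt (wspace_pa D hv) p0; exists (M + N)%N.
  have {}e : pa (p ^+ N) (Phi i nu v) = - (tau_coef_at i nu ## pa D v).
    by apply/eqP; rewrite -addr_eq0 -e.
  by rewrite exprD al_act_mul e linearN /= hM oppr0.
have PhiL i nu c u v : W nu u -> W nu v -> Phi i nu (c *: u + v) = c *: Phi i nu u + Phi i nu v.
  move=> hu hv; rewrite /Phi T_lin (frac_act_linear _ (regular_const_coef_at i nu) hu hv).
  by rewrite scalerBr opprD addrACA.
have /choice[t tE] : forall i, exists g : {linear V -> V}, forall nu v, W nu v ->
    g v = (tau_coef_at i nu)^-1 ## Phi i nu v.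
  move=> i; apply: (glue W_sum W0 W_linear (f := fun nu v => (tau_coef_at i nu)^-1 ## Phi i nu v)).
  move=> nu c u v hu hv; rewrite (PhiL _ _ _ _ _ hu hv).
  by rewrite (frac_act_linear _ (regular_tau_coef_inv i nu) (PhiW _ _ _ hu) (PhiW _ _ _ hv)).
have t_lin i : linear (t i) by apply: linearP.
have t_W i nu v : W nu v -> W (permute i nu) (t i v).
  by move=> hv; rewrite (tE i nu v hv); apply: (wspace_frac (regular_tau_coef_inv i nu)); apply: PhiW.
have rel : related I pa (fun i => t i) T.
  move=> i nu v hv; rewrite (tE i nu v hv).
  rewrite -(frac_actM (regular_tau_coef_at i nu) (regular_tau_coef_inv i nu) (PhiW i _ _ hv)).
  by rewrite (mulfV (tau_coef_at_neq0 i nu)) (frac_act1 (PhiW i _ _ hv)) subrK.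
have t_tw i nu : twisted pa i (diff i nu == 0) (coordinate nu) (t i).
  move=> p D v hv hD; rewrite (tE i nu _ (wspace_pa p hv)) (tE i nu v hv) (PhiM i nu p D v hv hD).
  have hP := PhiW i _ _ hv; have rV := regular_tau_coef_inv i nu.
  have rp := regular_poly (coordinate (permute i nu)) (msym (simple i) p).
  have ec : (tau_coef_at i nu)^-1 ## pa (msym (simple i) p) (Phi i nu v) =
      pa (msym (simple i) p) ((tau_coef_at i nu)^-1 ## Phi i nu v).
    rewrite -(frac_act_poly _ hP) -(frac_act_poly _ (wspace_frac rV hP)).
    by rewrite -(frac_actM rV rp hP) -(frac_actM rp rV hP) [_^-1 * _]mulrC.
  case: eqP => [d0|_]; last by rewrite !addr0.
  have rt := regular_tau_coef_at i nu; have hpP := wspace_pa (msym (simple i) p) hP.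
  rewrite (permute_diff0 d0) in rV rt hpP.
  have hD' := wspace_pa D hv.
  rewrite (frac_actDr rV hpP (wspace_frac rt hD')) ec -(frac_actM rV rt hD').
  by rewrite (mulVf (tau_coef_at_neq0 i nu)) (frac_act1 hD').
have t_quad i nu v : W nu v -> t i (t i v) = quad_at i nu ## v.
  by move=> hv; apply/(related_quad t_W t_tw T_lin rel i hv).
exists t; split=> //; split=> //.
  move=> i j + ij; apply: (ext (f := t i \o t j) (g := t j \o t i)) => nu v hv /=.
  by apply/(related_far t_W t_tw T_lin rel ij hv)/T_far.
move=> i j nu v ij hv.
by apply/(related_braid t_W t_tw T_lin rel ij hv); [exact: t_quad..|exact: T_braid].
Qed.
End TransferOfRelations.

(** * Twisted derivations are determined on the variables *)

Section TwistedGenerators.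
Variables (k : fieldType) (n : nat) (V : lmodType k).
Variable pa : alg_action {mpoly k[n]} V.
Implicit Types (p q D : {mpoly k[n]}) (i : 'I_n.-1).

Lemma demazure_var i (a : 'I_n) D : D%:F = demazure i ('X_a)%:F ->
  D = if a == lo i then - 1 else if a == hi i then 1 else 0.
Proof.
move=> hD; apply/eqP; rewrite -tofrac_eq hD /demazure -/(rvar k a) frac_sym_rvar.
have n0 := simple_root_neq0 k i.
have [->|al] := eqVneq a (lo i).
  by rewrite simple_lo -opprB mulNr divff // tofracN tofrac1.
have [->|ah] := eqVneq a (hi i); first by rewrite simple_hi divff // tofrac1.
by rewrite simple_out // subrr mul0r tofrac0.
Qed.

Lemma twisted_generators i (d : bool) (S : V -> Prop) (t : V -> V) : linear t ->
  (forall p v, S v -> S (pa p v)) ->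
  (forall a v, S v -> t (pa 'X_a v) = pa 'X_(simple i a) (t v) +
     (if d then pa (if a == lo i then - 1 else if a == hi i then 1 else 0) v else 0)) ->
  forall p D v, S v -> D%:F = demazure i p%:F ->
    t (pa p v) = pa (msym (simple i) p) (t v) + (if d then pa D v else 0).
Proof.
move=> t_lin Spa tX; have t0 : t 0 = 0.
  by have := t_lin (-1) 0 0; rewrite scaler0 addr0 scaleN1r addNr.
have tZ c v : t (c *: v) = c *: t v by have := t_lin c v 0; rewrite t0 !addr0.
have tD u v : t (u + v) = t u + t v by have := t_lin 1 u v; rewrite !scale1r.
elim/mpoly_ring_ind => [c|a|p q hp hq|p q hp hq] D v Sv hD.
- have -> : D = 0.
    by apply/eqP; rewrite -tofrac_eq hD /demazure frac_sym_poly msym_C subrr mul0r tofrac0.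
  by rewrite al_act0l if_same addr0 msym_C !pa_const tZ.
- by rewrite (demazure_var hD) msym_XU; apply: tX.
- have [Dp hDp] := demazure_poly i p; have [Dq hDq] := demazure_poly i q.
  have -> : D = Dp + Dq.
    by apply/eqP; rewrite -tofrac_eq hD !tofracD hDp hDq demazureD.
  rewrite msymD !al_actDl tD (hp Dp) // (hq Dq) // addrACA.
  by case: ifP; rewrite ?addr0.
have [Dp hDp] := demazure_poly i p; have [Dq hDq] := demazure_poly i q.
have -> : D = msym (simple i) p * Dq + Dp * q.
  apply/eqP; rewrite -tofrac_eq hD tofracD !tofracM hDp hDq demazureM.
  by rewrite frac_sym_poly.
rewrite msymM al_actDl !al_act_mul (hp Dp) ?(hq Dq) //; last exact: Spa.
by rewrite linearD /= -addrA; case: ifP; rewrite ?linear0 ?addr0.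
Qed.
End TwistedGenerators.

(** * Modules over the degenerate affine Hecke algebra *)

Section HeckeAlgebra.
Variables (k : fieldType) (n : nat) (A : deg_affine_hecke k n).
Local Notation pol := (dah_pol A).
Local Notation perm := (@dah_perm _ _ A).
Local Notation X := (@dah_X _ _ A).
Local Notation T := (@dah_T _ _ A).

Lemma dah_ind (P : A -> Prop) : (forall c, P (pol c%:MP)) -> (forall j, P (X j)) ->
  (forall i, P (T i)) -> (forall a b, P a -> P b -> P (a + b)) ->
  (forall a b, P a -> P b -> P (a * b)) -> forall a, P a.
Proof.
move=> PC PX PT PD PM a; have [c [-> _]] := dah_basis a.
have Ppol p : P (pol p).
  elim/mpoly_ring_ind: p => [//|//|p q hp hq|p q hp hq]; rewrite ?rmorphD ?rmorphM;
  [exact: PD|exact: PM].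
have Pperm w : P (perm w).
  elim/perm_simple_ind: w => [|i w hw].
    by rewrite dah_perm1 -(rmorph1 pol) -mpolyC1; apply: PC.
  by rewrite dah_permM; apply: PM (PT i) hw.
elim/big_ind: _ => [|a1 a2|w _]; [|exact: PD|exact: PM].
by rewrite -(rmorph0 pol) -mpolyC0; apply: PC.
Qed.

Lemma dah_T2 i : T i * T i = 1.
Proof. by rewrite /dah_T -dah_permM [(_ * _)%g]tperm2 dah_perm1. Qed.

(** Obtained from the defining relation by multiplying it by [T_i] on both sides. *)
Lemma dah_T_lo i : T i * X (lo i) = X (hi i) * T i - 1.
Proof.
have /(congr1 (fun a => T i * a * T i)) := dah_TX A i; rewrite -/(X _) -/(X _) -/(T i).
rewrite mulr1 dah_T2 mulrBr mulrBl !mulrA dah_T2 mul1r -!mulrA dah_T2 mulr1.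
by move=> <-; rewrite opprB addrC subrK.
Qed.

Lemma dah_T_hi i : T i * X (hi i) = X (lo i) * T i + 1.
Proof. by rewrite -[1](dah_TX A i) addrC subrK. Qed.

Lemma hecke_operators_of_action (M : lmodType k) (act : alg_action A M) :
  hecke_operators (pol_action act) (fun i => act (T i)).
Proof.
split=> [i|i p D v hD|i v|i j v ij|i j v ij].
- exact: al_act_linear_r.
- apply: (@twisted_generators _ _ _ (pol_action act) i true (fun=> True)) => //.
    exact: al_act_linear_r.
  move=> a {}v _; rewrite /= /pol_act -!al_act_mul -/(X _) -/(X _).
  have [->|al] := eqVneq a (lo i).
    by rewrite simple_lo dah_T_lo rmorphN rmorph1 al_actBl al_actNl.
  have [->|ah] := eqVneq a (hi i).
    by rewrite simple_hi dah_T_hi rmorph1 al_actDl.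
  by rewrite simple_out // rmorph0 al_act0l addr0 [_ * X a]dah_TX_comm.
- by rewrite -al_act_mul dah_T2 al_act1.
- by rewrite -!al_act_mul /dah_T -!dah_permM simple_far.
by rewrite -!al_act_mul /dah_T -!dah_permM (simple_braid ij).
Qed.

(** The regular module yields the commutation relation inside the algebra. *)
Fact regular_linear_l (a : A) : linear (fun b : A => b * a).
Proof. by move=> c u v; rewrite mulrDl scalerAl. Qed.
Fact regular_linear_r (a : A) : linear (fun b : A => a * b).
Proof. by move=> c u v; rewrite mulrDr scalerAr. Qed.
Fact regular_mulA (a b c : A) : a * b * c = a * (b * c).
Proof. by rewrite mulrA. Qed.

Definition regular_action : alg_action A A :=
  AlgAction regular_linear_r regular_linear_l (@mul1r A) regular_mulA.

Lemma dah_T_pol i p D : D%:F = demazure i p%:F ->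
  T i * pol p = pol (msym (simple i) p) * T i + pol D.
Proof.
move=> hD; have [_ h _ _ _] := hecke_operators_of_action regular_action.
by have := h i p D 1 hD; rewrite /= /pol_act /= !mulr1.
Qed.

Section ActionOfOperators.
Variables (V : lmodType k) (pa : alg_action {mpoly k[n]} V).
Variable t : 'I_n.-1 -> V -> V.
Hypothesis ht : hecke_operators pa t.

Let coef (h : A) : {ffun 'S_n -> {mpoly k[n]}} := sval (cid (dah_basis h)).

Let coefE h : h = \sum_w pol (coef h w) * perm w.
Proof. by rewrite /coef; have [] := svalP (cid (dah_basis h)). Qed.

Let coef_unique h (c : {ffun 'S_n -> {mpoly k[n]}}) : h = \sum_w pol (c w) * perm w -> coef h = c.
Proof. by rewrite /coef; have [_ u] := svalP (cid (dah_basis h)) => /u. Qed.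

(** The symmetric group acts through its Coxeter presentation, and an element of
    the algebra acts through its coordinates in the basis.  Multiplicativity only
    has to be checked for left multiplication by polynomials and by the [T_i]. *)
Lemma action_of_operators : exists act : alg_action A V,
  (forall p v, act (pol p) v = pa p v) /\ (forall i v, act (T i) v = t i v).
Proof.
have [t_lin t_tw t_quad t_far t_braid] := ht.
have [rho [rho1 rhoM rhoT]] := coxeter_representation t_quad t_far t_braid.
have rho_lin w : linear (rho w).
  elim/perm_simple_ind: w => [|i w hw] c u v; first by rewrite !rho1.
  by rewrite !rhoM !rhoT hw t_lin.
pose F h v := \sum_w pa (coef h w) (rho w v).
have F_lin_r h : linear (F h).
  move=> c u v; rewrite /F scaler_sumr -big_split; apply: eq_bigr => w _.
  by rewrite rho_lin linearP.
have F_lin_l v : linear (F^~ v).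
  move=> c h h'; have -> : F (c *: h + h') v =
      \sum_w pa (c *: coef h w + coef h' w) (rho w v).
    rewrite /F; apply: eq_bigr => w _; congr (pa _ _).
    rewrite (@coef_unique _ [ffun w => c *: coef h w + coef h' w]) ?ffunE //.
    rewrite {1}(coefE h) {1}(coefE h') scaler_sumr -big_split.
    by apply: eq_bigr => u _; rewrite ffunE linearP mulrDl scalerAl.
  rewrite /F scaler_sumr -big_split; apply: eq_bigr => w _.
  by rewrite al_actDl al_actZl.
have FD h h' v : F (h + h') v = F h v + F h' v.
  by have := F_lin_l v 1 h h'; rewrite /= !scale1r.
have F0 v : F 0 v = 0 by apply: (addrI (F 0 v)); rewrite -FD !addr0.
have Fsum (G : 'S_n -> A) v : F (\sum_w G w) v = \sum_w F (G w) v.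
  exact: (big_morph (F^~ v) (fun a b => FD a b v) (F0 v)).
have F1 p u v : F (pol p * perm u) v = pa p (rho u v).
  rewrite /F (@coef_unique _ [ffun w => if w == u then p else 0]).
    rewrite (bigD1 u) //= ffunE eqxx big1 ?addr0 // => w /negbTE wu.
    by rewrite ffunE wu al_act0l.
  rewrite (bigD1 u) //= ffunE eqxx big1 ?addr0 // => w /negbTE wu.
  by rewrite ffunE wu rmorph0 mul0r.
have Fpol p h v : F (pol p * h) v = pa p (F h v).
  rewrite {1}(coefE h) mulr_sumr Fsum [in RHS]/F linear_sum; apply: eq_bigr => w _ /=.
  by rewrite mulrA -rmorphM F1 al_act_mul.
have FT i h v : F (T i * h) v = t i (F h v).
  have t0 : t i 0 = 0.
    by have := t_lin i (-1) 0 0; rewrite scaler0 addr0 scaleN1r addNr.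
  have tD u w : t i (u + w) = t i u + t i w by have := t_lin i 1 u w; rewrite !scale1r.
  rewrite {1}(coefE h) mulr_sumr Fsum [in RHS]/F (big_morph (t i) tD t0).
  apply: eq_bigr => w _; have [D hD] := demazure_poly i (coef h w).
  rewrite mulrA (dah_T_pol hD) mulrDl -mulrA -dah_permM FD !F1 (t_tw _ _ D) //.
  by rewrite rhoM rhoT.
have Fperm w h v : F (perm w * h) v = rho w (F h v).
  elim/perm_simple_ind: w => [|i w hw]; first by rewrite dah_perm1 mul1r rho1.
  by rewrite dah_permM -mulrA -/(T i) FT hw rhoM rhoT.
have FM h h' v : F (h * h') v = F h (F h' v).
  rewrite {1}(coefE h) mulr_suml Fsum [in RHS]/F; apply: eq_bigr => w _.
  by rewrite -mulrA Fpol Fperm.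
have F1v v : F 1 v = v.
  have -> : 1 = pol 1 * perm 1%g :> A by rewrite rmorph1 dah_perm1 mulr1.
  by rewrite F1 al_act1 rho1.
exists (AlgAction F_lin_r F_lin_l F1v FM); split=> [p v|i v] /=.
  by rewrite -[pol p]mulr1 Fpol F1v.
by rewrite -[T i]mulr1 FT F1v.
Qed.
End ActionOfOperators.
End HeckeAlgebra.

(** * The algebra of endomorphisms *)

(** Actions of the quiver Hecke algebra are produced by its universal property,
    applied to this algebra. *)
Section Endomorphisms.
Variables (k : fieldType) (V : lmodType k).

Definition endo := {f : V -> V | linear f}.

HB.instance Definition _ := gen_eqMixin endo.
HB.instance Definition _ := gen_choiceMixin endo.

Lemma endo_ext (f g : endo) : sval f =1 sval g -> f = g.
Proof.
case: f g => [f hf] [g hg] /= /funext e; case: _ / e hg => hg.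
by congr exist; apply: Prop_irrelevance.
Qed.

Fact endo_zero_linear : linear (fun _ : V => 0 : V).
Proof. by move=> c u v; rewrite scaler0 addr0. Qed.
Fact endo_add_linear (f g : endo) : linear (fun v => sval f v + sval g v).
Proof.
case: f g => [f hf] [g hg] c u v /=.
by rewrite hf hg scalerDr addrACA.
Qed.
Fact endo_opp_linear (f : endo) : linear (fun v => - sval f v).
Proof. by case: f => f hf c u v /=; rewrite hf opprD scalerN. Qed.
Fact endo_scale_linear a (f : endo) : linear (fun v => a *: sval f v).
Proof.
by case: f => f hf c u v /=; rewrite hf scalerDr !scalerA mulrC.
Qed.
Fact endo_comp_linear (f g : endo) : linear (sval f \o sval g).
Proof. by case: f g => [f hf] [g hg] c u v /=; rewrite hg hf. Qed.

Definition endo_zero : endo := exist _ _ endo_zero_linear.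
Definition endo_add f g : endo := exist _ _ (endo_add_linear f g).
Definition endo_opp f : endo := exist _ _ (endo_opp_linear f).
Definition endo_scale a f : endo := exist _ _ (endo_scale_linear a f).
Definition endo_comp f g : endo := exist _ _ (endo_comp_linear f g).

Fact endo_addA : associative endo_add.
Proof. by move=> f g h; apply: endo_ext => v /=; rewrite addrA. Qed.
Fact endo_addC : commutative endo_add.
Proof. by move=> f g; apply: endo_ext => v /=; rewrite addrC. Qed.
Fact endo_add0 : left_id endo_zero endo_add.
Proof. by move=> f; apply: endo_ext => v /=; rewrite add0r. Qed.
Fact endo_addN : left_inverse endo_zero endo_opp endo_add.
Proof. by move=> f; apply: endo_ext => v /=; rewrite addNr. Qed.

HB.instance Definition _ :=
  GRing.isZmodule.Build endo endo_addA endo_addC endo_add0 endo_addN.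

Fact endo_scaleA a b f : endo_scale a (endo_scale b f) = endo_scale (a * b) f.
Proof. by apply: endo_ext => v /=; rewrite scalerA. Qed.
Fact endo_scale1 : left_id 1 endo_scale.
Proof. by move=> f; apply: endo_ext => v /=; rewrite scale1r. Qed.
Fact endo_scaleDr : right_distributive endo_scale endo_add.
Proof. by move=> a f g; apply: endo_ext => v /=; rewrite scalerDr. Qed.
Fact endo_scaleDl f : {morph endo_scale^~ f : a b / a + b >-> a + b}.
Proof. by move=> a b; apply: endo_ext => v /=; rewrite scalerDl. Qed.

HB.instance Definition _ := GRing.Zmodule_isLmodule.Build k endo
  endo_scaleA endo_scale1 endo_scaleDr endo_scaleDl.

Fact endo_compA : associative endo_comp.
Proof. by move=> f g h; apply: endo_ext. Qed.
Fact endo_comp_linear_r f : linear (endo_comp f).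
Proof. by move=> c g h; apply: endo_ext => v /=; case: f => f hf /=; rewrite hf. Qed.
Fact endo_comp_linear_l f : linear (endo_comp^~ f).
Proof. by move=> c g h; apply: endo_ext. Qed.

Definition endo_alg : nualg k := NuAlg endo_compA endo_comp_linear_r endo_comp_linear_l.

Fact endo_action_linear_r (f : endo_alg) : linear (sval (f : endo)).
Proof. exact: svalP f. Qed.
Fact endo_action_linear_l v : linear (fun f : endo_alg => sval (f : endo) v).
Proof. by []. Qed.
Fact endo_action_mul (f g : endo_alg) v :
  sval (f ** g : endo) v = sval (f : endo) (sval (g : endo) v).
Proof. by []. Qed.

Definition endo_action : nualg_action endo_alg V :=
  NuAlgAction endo_action_linear_r endo_action_linear_l endo_action_mul.
End Endomorphisms.

(** * Polynomials in the quiver Hecke algebra *)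

Section KlrPolynomialAction.
Variables (k : fieldType) (I : {pred k}) (n : nat) (V : lmodType k).
Local Notation L := (weight I n).

Lemma klr_poly_act (B : nualg k) (act : nualg_action B V) (e : L -> B)
    (x : 'I_n -> L -> B) nu p v :
  act (klr_poly e x nu p) v = op_poly (fun a => act (x a nu)) p (act (e nu) v).
Proof.
rewrite /klr_poly nu_act_suml; apply: eq_bigr => m _; rewrite nu_actZl; congr (_ *: _).
rewrite /klr_monomial /op_monomial; elim: (enum 'I_n) => //= a r <-.
by elim: (m a) => //= d <-; rewrite nu_act_mul.
Qed.

(** The substitution [x_j = X_j - nu_j]. *)
Definition shift (nu : L) (p : {mpoly k[n]}) : {mpoly k[n]} :=
  p \mPo [tuple shifted_var nu a | a < n].

Lemma shift_var nu a : shift nu 'X_a = shifted_var nu a.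
Proof. by rewrite /shift comp_mpolyXU -tnth_nth tnth_mktuple. Qed.

Lemma shift_klr_Q nu (a b : k) p q :
  shift nu (klr_Q a b p q) = klr_Q a b (shift nu p) (shift nu q).
Proof. exact: klr_Q_morph. Qed.

Lemma op_poly_shift (pa : alg_action {mpoly k[n]} V) (nu : L) (Y : 'I_n -> V -> V)
    (S : V -> Prop) :
  (forall a, linear (Y a)) -> (forall a b v, Y a (Y b v) = Y b (Y a v)) ->
  (forall p v, S v -> S (pa p v)) ->
  (forall a v, S v -> Y a v = pa (shifted_var nu a) v) ->
  forall p v, S v -> op_poly Y p v = pa (shift nu p) v.
Proof.
move=> Y_lin YC Spa YE; pose op := op_poly_action Y_lin YC.
have opX a v : op 'X_a v = Y a v by apply: op_poly_actionX.
suff H p v : S v -> op p v = pa (shift nu p) v by [].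
elim/mpoly_ring_ind: p v => [c|a|p q hp hq|p q hp hq] v Sv.
- by rewrite /shift comp_mpolyC !pa_const.
- by rewrite opX shift_var YE.
- by rewrite /shift comp_mpolyD !al_actDl hp ?hq.
have -> : shift nu (p * q) = shift nu p * shift nu q by exact: rmorphM.
by rewrite !al_act_mul (hq _ Sv) hp //; apply: Spa.
Qed.
End KlrPolynomialAction.

(** * From modules over the quiver Hecke algebra to operators *)

Section OperatorsOfKlrModule.
Variables (k : fieldType) (I : {pred k}) (n : nat) (V : lmodType k).
Local Notation L := (weight I n).
Variable act : nualg_action (klr_alg I n) V.
Implicit Types (nu mu : L) (i j : 'I_n.-1) (v : V).
Local Notation U := (weight_space act).
Local Notation R := (klr_alg_relations I n).

Let act_e nu mu v : act (klr_e nu) (act (klr_e mu) v) = if nu == mu then act (klr_e nu) v else 0.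
Proof.
by rewrite -nu_act_mul (klr_idem R); case: ifP => _ //; rewrite nu_act0l.
Qed.

Lemma weight_spaceE nu v : U nu v <-> act (klr_e nu) v = v.
Proof.
split=> [[w ->]|e]; first by rewrite act_e eqxx.
by exists v.
Qed.

Lemma weight_space_e nu mu v : U mu v -> act (klr_e nu) v = if nu == mu then v else 0.
Proof. by move=> [w ->]; rewrite act_e; case: eqP => [->|]. Qed.

Lemma klr_x_e a nu v : act (klr_x a nu) (act (klr_e nu) v) = act (klr_x a nu) v.
Proof. by rewrite (klr_x_corner R) !nu_act_mul act_e eqxx. Qed.

Lemma klr_t_e i nu v : act (klr_t i nu) (act (klr_e nu) v) = act (klr_t i nu) v.
Proof. by rewrite (klr_t_corner R) !nu_act_mul act_e eqxx. Qed.

Lemma weight_space0 nu : U nu 0.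
Proof. by apply/weight_spaceE; rewrite linear0. Qed.

Lemma weight_space_linear nu c u v : U nu u -> U nu v -> U nu (c *: u + v).
Proof. by rewrite !weight_spaceE linearP /= => -> ->. Qed.

Lemma weight_space_x nu a v : U nu (act (klr_x a nu) v).
Proof. by apply/weight_spaceE; rewrite (klr_x_corner R) !nu_act_mul act_e eqxx. Qed.

Lemma weight_space_t nu i v : U (permute i nu) (act (klr_t i nu) v).
Proof. by apply/weight_spaceE; rewrite (klr_t_corner R) !nu_act_mul act_e eqxx. Qed.

Lemma klr_xC nu a b v : act (klr_x a nu) (act (klr_x b nu) v) =
  act (klr_x b nu) (act (klr_x a nu) v).
Proof. by rewrite -!nu_act_mul (klr_x_comm R). Qed.

Hypothesis U_sum : direct_sum U.
Hypothesis U_nilp : forall nu (a : 'I_n) v, U nu v -> exists N, iter N (act (klr_x a nu)) v = 0.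

Let ext (f g : {linear V -> V}) : (forall nu v, U nu v -> f v = g v) -> f =1 g.
Proof.
by move=> h; apply: (sum_ext U_sum weight_space0 weight_space_linear) => //; apply: linearP.
Qed.

Section WeightSpaces.
Variable pa : alg_action {mpoly k[n]} V.
Hypothesis paX : forall nu v a, U nu v ->
  pa 'X_a v = act (klr_x a nu) v + coordinate nu a *: v.

Lemma shifted_var_act nu v a : U nu v -> pa (shifted_var nu a) v = act (klr_x a nu) v.
Proof. by move=> hv; rewrite al_actBl pa_const (@paX nu v a hv) addrK. Qed.

(** [1_nu M] lies in the generalized eigenspace of the [X_j = x_j + nu_j] by local
    nilpotency, and equality follows by comparing two decompositions of [M]. *)
Lemma weight_space_wspace nu v : U nu v <-> wspace pa (coordinate nu) v.
Proof.
have UW mu w : U mu w -> wspace pa (coordinate mu) w.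
  move=> hw; apply: wspace_coordinates => a; have [N hN] := U_nilp a hw; exists N.
  rewrite -hN {hN}; elim: N w hw => [|N IH] w hw; first by rewrite expr0 al_act1.
  rewrite exprSr al_act_mul iterSr (shifted_var_act a hw) IH //.
  exact: weight_space_x.
split; first exact: UW.
apply: (summand_recognition U_sum weight_space0 weight_space_linear
  (W' := fun nu v => wspace pa (coordinate nu) v)) => //.
  by move=> mu c u w hu hw; apply: wspaceD => //; apply: wspaceZ.
by apply: wspace_indep => mu mu'; apply: coordinate_inj.
Qed.
End WeightSpaces.

Lemma operators_of_klr : exists (pa : alg_action {mpoly k[n]} V) (t : 'I_n.-1 -> {linear V -> V}),
  [/\ forall nu v, U nu v <-> wspace pa (coordinate nu) v,
      forall nu v a, U nu v -> pa 'X_a v = act (klr_x a nu) v + coordinate nu a *: v,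
      forall nu v i, U nu v -> t i v = act (klr_t i nu) v
    & klr_operators I pa (fun i => t i)].
Proof.
have /choice[X XE] : forall a, exists f : {linear V -> V}, forall nu v, U nu v ->
    f v = act (klr_x a nu) v + coordinate nu a *: v.
  move=> a; apply: (glue U_sum weight_space0 weight_space_linear
    (f := fun nu v => act (klr_x a nu) v + coordinate nu a *: v)).
  move=> nu c u v _ _; rewrite linearP /= !scalerDr addrACA; congr (_ + (_ + _)).
  by rewrite !scalerA mulrC.
have /choice[t tE] : forall i, exists f : {linear V -> V}, forall nu v, U nu v ->
    f v = act (klr_t i nu) v.
  move=> i; apply: (glue U_sum weight_space0 weight_space_linear
    (f := fun nu v => act (klr_t i nu) v)) => nu c u v _ _; exact: linearP.
have XU nu a v : U nu v -> U nu (X a v).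
  move=> hv; rewrite (XE a nu v hv) addrC; apply: weight_space_linear => //.
  exact: weight_space_x.
have XC a b v : X a (X b v) = X b (X a v).
  move: v; apply: (ext (f := X a \o X b) (g := X b \o X a)) => nu v hv /=.
  rewrite (XE a nu _ (XU _ _ _ hv)) (XE b nu _ (XU _ _ _ hv)) (XE a nu v hv) (XE b nu v hv).
  rewrite !linearD /= !linearZ /= klr_xC !scalerA -!addrA; congr (_ + _).
  by rewrite addrCA [coordinate nu a * _]mulrC.
have X_lin a : linear (X a) by apply: linearP.
pose pa := op_poly_action X_lin XC.
have paX a v : pa 'X_a v = X a v by apply: op_poly_actionX.
clearbody pa.
have paXE nu v a : U nu v -> pa 'X_a v = act (klr_x a nu) v + coordinate nu a *: v.
  by move=> hv; rewrite paX (XE a nu v hv).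
have UWE := weight_space_wspace paXE.
have UW nu v : U nu v -> wspace pa (coordinate nu) v by move/UWE.
have WU nu v : wspace pa (coordinate nu) v -> U nu v by move/UWE.
have poly_act nu p v : U nu v -> act (klr_poly klr_e klr_x nu p) v = pa (shift nu p) v.
  move=> hv; rewrite klr_poly_act; have /weight_spaceE-> := hv.
  apply: (op_poly_shift (S := U nu)) => //.
  - by move=> a; apply: linearP.
  - exact: klr_xC.
  - by move=> q w hw; apply/WU/wspace_pa/UW.
  - by move=> a w hw; rewrite (shifted_var_act paXE).
have tU nu i v : U nu v -> U (permute i nu) (t i v).
  by move=> hv; rewrite (tE i nu v hv); apply: weight_space_t.
exists pa, t; split=> //; first by move=> nu v i /tE.
split.
- by move=> i; apply: linearP.
- by move=> i nu v /WU hv; apply/UW/tU.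
- move=> i nu p D v hv; apply: (twisted_generators (S := wspace pa (coordinate nu))) => //.
  + exact: linearP.
  + by move=> q w; apply: wspace_pa.
  move=> a {}v /WU {}hv; rewrite !paX (XE a nu v hv) (XE _ (permute i nu) _ (tU nu i v hv)).
  rewrite linearD linearZ /= coordinate_permute simpleK addrAC; congr (_ + _).
  rewrite (tE i nu _ (weight_space_x nu a v)) (tE i nu v hv).
  have := congr1 (act^~ v) (klr_tx R i a nu); rewrite /= nu_actBl !nu_act_mul.
  move=> /(canRL (subrK _)) ->; rewrite addrC diff_eq0; congr (_ + _).
  have /weight_spaceE ev := hv.
  case: ifP => _; last by rewrite nu_act0l.
  case: ifP => _; first by rewrite nu_actNl al_actNl al_act1 ev.
  by case: ifP => _; rewrite ?nu_act0l ?al_act0l // al_act1 ev.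
- move=> i nu v hv; have /WU hv' := hv.
  rewrite (tE i nu v hv') (tE i _ _ (weight_space_t _ _ _)) -nu_act_mul (klr_quadratic R).
  by rewrite poly_act // shift_klr_Q !shift_var quad_at_poly (frac_act_poly _ hv).
- move=> i j + ij; apply: (ext (f := t i \o t j) (g := t j \o t i)) => nu v hv /=.
  rewrite (tE j nu v hv) (tE i nu v hv) (tE i _ _ (weight_space_t _ _ _)).
  by rewrite (tE j _ _ (weight_space_t _ _ _)) -!nu_act_mul (klr_far R).
move=> i j nu v ij hv; have /WU hv' := hv.
rewrite (tE j nu v hv') (tE i nu v hv') (tE i _ _ (weight_space_t _ _ _)).
rewrite (tE j _ _ (weight_space_t _ _ _)) (tE j _ _ (weight_space_t _ _ _)).
rewrite (tE i _ _ (weight_space_t _ _ _)) -!nu_act_mul -nu_actBl.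
have [e|ne] := eqVneq (nu (lo i)) (nu (hi j)).
  have [D hD] := klr_Q_divided_difference (coordinate nu (lo i)) (coordinate nu (hi i))
    'X_(lo i) 'X_(hi i) ('X_(hi j) : {mpoly k[n]}).
  have eD : braid_at i j nu = (shift nu D)%:F.
    apply: (braid_at_poly ij e); rewrite -!(shift_var nu) -!shift_klr_Q /shift.
    by rewrite -!rmorphB -rmorphM; congr (_ \mPo _); exact: hD.
  by rewrite (klr_braid_eq R ij e hD) poly_act // eD (frac_act_poly _ hv).
rewrite (klr_braid_neq R ij (elimN eqP ne)) nu_act0l.
by rewrite /braid_at /braid_defect (diff_adj0 _ ij) (negbTE ne) (frac_act0 hv).
Qed.
End OperatorsOfKlrModule.

(** * From operators to modules over the quiver Hecke algebra *)

Section KlrModuleOfOperators.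
Variables (k : fieldType) (I : {pred k}) (n : nat) (V : lmodType k).
Variable pa : alg_action {mpoly k[n]} V.
Local Notation L := (weight I n).
Local Notation W nu := (wspace pa (coordinate nu)).
Variable t : 'I_n.-1 -> {linear V -> V}.
Hypothesis W_sum : direct_sum (fun nu : L => W nu).
Hypothesis ht : klr_operators I pa (fun i => t i).
Implicit Types (nu mu : L) (i j : 'I_n.-1) (v : V).

Let W0 nu : W nu 0. Proof. exact: wspace0. Qed.
Let W_linear nu c u v : W nu u -> W nu v -> W nu (c *: u + v).
Proof. by move=> hu hv; apply: wspaceD => //; apply: wspaceZ. Qed.

Let proj nu : V -> V := component W_sum W0 W_linear nu.
Let projW nu v : W nu (proj nu v). Proof. exact: (componentW W_sum W0 W_linear nu v). Qed.
Let proj_id nu v : W nu v -> proj nu v = v. Proof. exact: (component_id W_sum W0 W_linear). Qed.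
Let proj_neq nu mu v : nu != mu -> W mu v -> proj nu v = 0.
Proof. exact: (component_neq W_sum W0 W_linear). Qed.
Let proj_linear nu : linear (proj nu). Proof. exact: (component_linear W_sum W0 W_linear nu). Qed.

Let x_linear a nu : linear (pa (shifted_var nu a) \o proj nu).
Proof. by move=> c u v /=; rewrite proj_linear linearP. Qed.
Let t_linear i nu : linear (t i \o proj nu).
Proof. by move=> c u v /=; rewrite proj_linear linearP. Qed.

Let e nu : endo_alg V := exist _ _ (proj_linear nu) : endo V.
Let x (a : 'I_n) nu : endo_alg V := exist _ _ (x_linear a nu) : endo V.
Let tau i nu : endo_alg V := exist _ _ (t_linear i nu) : endo V.

Let poly_act nu p v : sval (klr_poly e x nu p : endo V) v = pa (shift nu p) (proj nu v).
Proof.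
rewrite -[LHS]/(endo_action V (klr_poly e x nu p) v) klr_poly_act /=.
apply: (op_poly_shift (S := fun v => W nu v)).
- by move=> a; apply: (x_linear a nu).
- by move=> a b w; rewrite /= !(proj_id (wspace_pa _ (@projW _ _))) paC.
- by move=> q w; apply: wspace_pa.
- by move=> a w hw; rewrite /= proj_id.
exact: projW.
Qed.

Let tW i nu v : W nu v -> W (permute i nu) (t i v).
Proof. exact: klr_op_wspace ht i nu v. Qed.

Lemma klr_relations_of_operators : klr_relations e x tau.
Proof.
have pW nu a v : W nu (pa (shifted_var nu a) (proj nu v)) by apply: wspace_pa.
have ptW i nu v : W (permute i nu) (t i (proj nu v)) by apply: tW.
have p_t i nu v : proj (permute i nu) (t i (proj nu v)) = t i (proj nu v).
  exact: proj_id.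
split.
- move=> nu mu; apply: endo_ext => v; case: eqP => [<-|/eqP ne] /=.
    exact: proj_id.
  exact: proj_neq ne (@projW _ _).
- by move=> i nu; apply: endo_ext => v /=; rewrite (proj_id (@projW nu v)) p_t.
- move=> a nu; apply: endo_ext => v /=.
  by rewrite (proj_id (@projW nu v)) (proj_id (pW _ _ _)).
- by move=> a b nu; apply: endo_ext => v /=; rewrite !(proj_id (pW _ _ _)) paC.
- move=> i nu; apply: endo_ext => v; rewrite poly_act /= p_t.
  rewrite (klr_op_quad ht i (@projW nu v)) quad_at_poly (frac_act_poly _ (@projW nu v)).
  by rewrite shift_klr_Q !shift_var.
- by move=> i j nu ij; apply: endo_ext => v /=; rewrite !p_t; apply: (klr_op_far ht).
- move=> i j nu D ij eij hD; apply: endo_ext => v; rewrite poly_act /= !p_t.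
  rewrite -[RHS](frac_act_poly _ (@projW nu v)).
  have <- : braid_at i j nu = (shift nu D)%:F.
    apply: (braid_at_poly ij eij); rewrite -!(shift_var nu) -!shift_klr_Q /shift.
    by rewrite -!rmorphB -rmorphM; congr (_ \mPo _); exact: hD.
  exact: (klr_op_braid ht ij (@projW nu v)).
- move=> i j nu ij ne; apply: endo_ext => v /=; rewrite !p_t.
  have b0 : braid_at i j nu = 0.
    by rewrite /braid_at /braid_defect (diff_adj0 _ ij) (introF eqP ne).
  by have := klr_op_braid ht ij (@projW nu v); rewrite b0 (frac_act0 (@projW nu v)).
move=> i a nu; apply: endo_ext => v; have hv := @projW nu v.
have ewv b mu w : W mu w -> pa (shifted_var mu b) w = pa 'X_b w - coordinate mu b *: w.
  by move=> _; rewrite al_actBl pa_const.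
have [D hD] := demazure_poly i ('X_a : {mpoly k[n]}).
have := klr_op_twisted ht hv hD; rewrite msym_XU => etX.
have -> : sval (tau i nu ** x a nu - x (simple i a) (permute i nu) ** tau i nu : endo V) v =
    (if diff i nu == 0 then pa D (proj nu v) else 0).
  rewrite -[LHS]/(t i (proj nu (pa (shifted_var nu a) (proj nu v))) -
    pa (shifted_var (permute i nu) (simple i a)) (proj (permute i nu) (t i (proj nu v)))).
  rewrite (proj_id (pW _ _ _)) p_t !(ewv _ _ _ hv) (ewv _ _ _ (ptW i nu v)).
  rewrite linearB linearZ /= etX coordinate_permute simpleK opprB addrA subrK.
  by rewrite addrC addKr.
rewrite (demazure_var hD) diff_eq0.
case: ifP => // _; case: ifP => _; first by rewrite al_actNl al_act1.
by case: ifP => _; rewrite ?al_act1 ?al_act0l.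
Qed.

Lemma klr_of_operators : exists act : nualg_action (klr_alg I n) V,
  [/\ forall nu v, weight_space act nu v <-> W nu v,
      forall nu v a, W nu v -> act (klr_x a nu) v = pa (shifted_var nu a) v
    & forall nu v i, W nu v -> act (klr_t i nu) v = t i v].
Proof.
have R := klr_relations_of_operators.
pose F (b : klr_alg I n) : endo V := klr_interp e x tau b.
have F_lin_l v : linear (fun b => sval (F b) v).
  by move=> c a b; rewrite /F (klr_interp_linear R).
have FM a b v : sval (F (a ** b)) v = sval (F a) (sval (F b) v).
  by rewrite /F (klr_interp_nualg_mul R).
exists (NuAlgAction (fun b => svalP (F b)) F_lin_l FM).
have Fe nu v : sval (F (klr_e nu)) v = proj nu v by rewrite /F (klr_interp_e R).
split=> [nu v|nu v a hv|nu v i hv] /=.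
- split=> [[w ->]|hv]; rewrite ?[nu_act _ _ _]Fe; first exact: projW.
  by exists v; rewrite /= Fe proj_id.
- by rewrite /F (klr_interp_x R) /= proj_id.
by rewrite /F (klr_interp_t R) /= proj_id.
Qed.
End KlrModuleOfOperators.

Section KlrInduction.
Variables (k : fieldType) (I : {pred k}) (n : nat).
Local Notation H := (klr_alg I n).

Lemma klr_alg_ind (P : H -> Prop) : P 0 ->
  (forall a b, P a -> P b -> P (a + b)) -> (forall a, P a -> P (- a)) ->
  (forall c a, P a -> P (c *: a)) -> (forall a b, P a -> P b -> P (a ** b)) ->
  (forall nu, P (klr_e nu)) -> (forall a nu, P (klr_x a nu)) ->
  (forall i nu, P (klr_t i nu)) -> forall b, P b.
Proof.
move=> P0 PD PN PZ PM Pe Px Pt; elim/quotW => r.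
change (P (klr_class r : H)).
elim: r => [|r1 h1 r2 h2|r h|c r h|r1 h1 r2 h2|nu|a nu|i nu].
- exact: P0.
- have -> : klr_class (TAdd r1 r2) = klr_class r1 + klr_class r2 :> H; last exact: PD.
  by apply: klr_ext => B e x t R; rewrite (klr_interpD R) !(klr_interpE _ R).
- have -> : klr_class (TOpp r) = - klr_class r :> H; last exact: PN.
  by apply: klr_ext => B e x t R; rewrite (klr_interpN R) !(klr_interpE _ R).
- have -> : klr_class (TScale c r) = c *: klr_class r :> H; last exact: PZ.
  by apply: klr_ext => B e x t R; rewrite (klr_interpZ R) !(klr_interpE _ R).
- have -> : klr_class (TMul r1 r2) = (klr_class r1 : H) ** klr_class r2 :> H; last exact: PM.
  by apply: klr_ext => B e x t R; rewrite (klr_interp_nualg_mul R) !(klr_interpE _ R).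
- exact: Pe.
- exact: Px.
exact: Pt.
Qed.
End KlrInduction.

(** * The formulas for the action *)

Section FormulasAsFractions.
Variables (k : fieldType) (I : {pred k}) (n : nat) (M : klr_mod0 I n).
Variable pa : alg_action {mpoly k[n]} M.
Local Notation L := (weight I n).
Local Notation act := (klr_act M).
Local Notation U := (weight_space act).
Local Notation W nu := (wspace pa (coordinate nu)).
Local Notation "f ## v" := (frac_act pa f v) (at level 40, v at next level).
Local Notation root i := (@simple_root k n i).
Implicit Types (nu mu : L) (i : 'I_n.-1) (m : M).

Hypothesis paX : forall nu m a, U nu m -> pa 'X_a m = X_formula a nu m.

Let UW nu m : U nu m <-> W nu m.
Proof.
apply: weight_space_wspace => //; first exact: (@klr_mod0_sum _ _ _ M).
exact: (@klr_mod0_nilp _ _ _ M).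
Qed.

(** On the weight [nu], [x_i - x_{i+1} + c] is [lin i (diff i nu + c)], with value
    [c] at [nu]. *)
Definition lin i (c : k) : {fraction {mpoly k[n]}} := root i + c%:MP%:F.

Lemma regular_lin nu i c : regular (coordinate nu) (lin i c).
Proof. exact: regular_root_add. Qed.

Lemma regular_linV nu i c : c != 0 ->
  regular (coordinate nu) (lin i (diff i nu + c))^-1.
Proof.
move=> c0; apply: regular_root_inv; rewrite /diff.
by have -> (a b : k) : a - b + (b - a + c) = c by ring.
Qed.

Lemma lin_neq0 i c : lin i c != 0.
Proof. exact/rvar_sub_const_neq0/lo_neq_hi. Qed.

Lemma xdiffE nu i c m : U nu m -> xdiff i nu c m = lin i (diff i nu + c) ## m.
Proof.
move=> hm; have hW : W nu m by apply/UW.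
have -> : lin i (diff i nu + c) = ('X_(lo i) - 'X_(hi i) + (diff i nu + c)%:MP)%:F.
  by rewrite /lin /simple_root tofracD tofracB.
rewrite (frac_act_poly _ hW) al_actDl al_actBl pa_const !(paX _ hm) /X_formula.
have cancel (p q a b : M) : p + a - (q + b) + (b - a) = p - q.
  by rewrite opprD [p + a + _]addrACA [p - q + _]addrA subrKA addrK.
by rewrite /xdiff /diff scalerDl scalerBl addrA cancel.
Qed.

Lemma xdiff_invE nu i c m : c != 0 -> U nu m ->
  xdiff_inv i nu c m = (lin i (diff i nu + c))^-1 ## m.
Proof.
move=> c0 hm; have hW : W nu m by apply/UW.
have rV := regular_linV nu i c0; have r := regular_lin nu i (diff i nu + c).
apply: xget_unique => [|u [hu <-]].
  have hu := wspace_frac rV hW; split; first by apply/UW.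
  rewrite xdiffE; last by apply/UW.
  by rewrite -(frac_actM r rV hW) mulfV ?lin_neq0 // (frac_act1 hW).
have huW : W nu u by apply/UW.
rewrite (xdiffE _ _ hu) -(frac_actM rV r huW) mulVf ?lin_neq0 //.
exact/esym/(frac_act1 huW).
Qed.

Lemma lin0 i : lin i 0 = root i. Proof. by rewrite /lin mpolyC0 tofrac0 addr0. Qed.
Lemma lin1 i : lin i 1 = root i + 1. Proof. by rewrite /lin const1F. Qed.
Lemma linN1 i : lin i (- 1) = root i - 1. Proof. by rewrite /lin constN1F. Qed.
Lemma lin2 i : lin i 2 = root i + 2. Proof. by rewrite /lin const2F. Qed.
Lemma linN2 i : lin i (- 2) = root i - 2. Proof. by rewrite /lin constN2F. Qed.

Lemma one_sub_frac (K : fieldType) (y : K) : y != 0 -> 1 - (y + 1) / y = - y^-1.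
Proof. by move=> y0; field. Qed.

(** The four cases of the formula are the four cases of [tau_coef], once
    [x_i - x_{i+1}] is rewritten as [X_i - X_{i+1}] plus a constant that depends on
    the weight it acts on. *)
Lemma T_formulaE nu i m : U nu m ->
  T_formula i nu m = tau_coef_at i nu ## act (klr_t i nu) m + const_coef_at i nu ## m.
Proof.
move=> hm; have hW : W nu m by apply/UW.
have ht := weight_space_t act nu i m; set tm := act (klr_t i nu) m in ht *.
have htW : W (permute i nu) tm by apply/UW.
rewrite /T_formula -/tm -[coordinate nu (hi i) - _]/(diff i nu).
rewrite /tau_coef_at /const_coef_at /tau_coef /const_coef.
set d := diff i nu.
have d' : diff i (permute i nu) = - d by rewrite diff_permute.
have UxV mu c w : c != 0 -> U mu w -> U mu (xdiff_inv i mu c w).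
  move=> c0 hw; rewrite (xdiff_invE i c0 hw); apply/UW/wspace_frac; last by apply/UW.
  exact: regular_linV.
have Ux mu c w : U mu w -> U mu (xdiff i mu c w).
  move=> hw; rewrite (xdiffE _ _ hw); apply/UW/wspace_frac; last by apply/UW.
  exact: regular_lin.
have rV mu : diff i mu != 0 -> regular (coordinate mu) (root i)^-1.
  move=> d0; have := @regular_linV mu i (- diff i mu).
  by rewrite subrr lin0; apply; rewrite oppr_eq0.
have rR mu : regular (coordinate mu) (root i) by rewrite -lin0; apply: regular_lin.
have r1 mu : regular (coordinate mu) (root i + 1) by rewrite -lin1; apply: regular_lin.
have n1 : (- 1 : k) != 0 by rewrite oppr_eq0 oner_neq0.
have [d0|dn0] := eqVneq d 0.
  have e : permute i nu = nu by apply: permute_diff0.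
  rewrite -{1}e xdiffE // d' d0 oppr0 add0r lin1 (frac_act1 hW) //.
have mpart : - xdiff i nu (- d + 1) (xdiff_inv i nu (- d) m) + m = - (root i)^-1 ## m.
  have dN0 : - d != 0 by rewrite oppr_eq0.
  rewrite (xdiffE _ _ (UxV _ _ _ dN0 hm)) (xdiff_invE _ dN0 hm) addrA subrr add0r.
  rewrite lin1 lin0 -(frac_actM (r1 nu) (rV nu dn0) hW) -{2}(frac_act1 hW) addrC.
  have rq : regular (coordinate nu) ((root i + 1) / root i).
    by apply: regularM => //; apply: rV.
  rewrite -(frac_actBl (@regular1 _ _ _) rq hW) one_sub_frac //.
  exact: simple_root_neq0.
have r' : regular (coordinate (permute i nu)) (root i)^-1.
  by apply: rV; rewrite d' oppr_eq0.
have [d1|dn1] := eqVneq d 1.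
  rewrite (xdiff_invE _ n1 ht) (xdiff_invE _ n1 hm) d' -/d d1 subrr lin0.
  have -> : -1 + -1 = -2 :> k by ring.
  by rewrite linN2 (frac_actNl (rV nu dn0) hW).
have [dN|dnN] := eqVneq d (- 1).
  rewrite -[LHS]addrA mpart; congr (_ + _).
  have d'1 : diff i (permute i nu) = 1 by rewrite d' dN opprK.
  have h1 := UxV _ _ _ n1 ht; have h2 := UxV _ _ _ n1 h1; have h3 := Ux _ (- 2) _ h2.
  rewrite (xdiffE _ _ h3) (xdiffE _ _ h2) (xdiff_invE _ n1 h1) (xdiff_invE _ n1 ht).
  have hw1 := wspace_frac r' htW; have hw2 := wspace_frac r' hw1.
  have rN1 : regular (coordinate (permute i nu)) (root i - 1).
    by rewrite -linN1; apply: regular_lin.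
  have r2 : regular (coordinate (permute i nu)) (root i + 2).
    by rewrite -lin2; apply: regular_lin.
  rewrite d'1 subrr lin0.
  have -> : 1 + 1 = 2 :> k by [].
  have -> : 1 + -2 = -1 :> k by ring.
  rewrite lin2 linN1 -(frac_actM r' r' htW).
  have r'' := regularM r' r'.
  rewrite -(frac_actM rN1 r'' htW) -(frac_actM r2 (regularM rN1 r'') htW).
  by rewrite expr2 invfM !mulrA.
rewrite -[LHS]addrA mpart; congr (_ + _).
rewrite (xdiffE _ _ (UxV _ _ _ dn0 ht)) (xdiff_invE _ dn0 ht) d' addrA addNr add0r.
by rewrite lin1 lin0 -(frac_actM (r1 _) r' htW).
Qed.
End FormulasAsFractions.

(** * The equivalence *)

Lemma direct_sum_ext (k : fieldType) (M : lmodType k) (J : eqType) (W W' : J -> M -> Prop) :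
  (forall j v, W j v <-> W' j v) -> direct_sum W -> direct_sum W'.
Proof.
move=> WW' [gen indep]; split=> [m|s f us hf].
  by have [s [f [hf e]]] := gen m; exists s, f; split=> // j; apply/WW'.
by apply: indep => // j; apply/WW'.
Qed.

Section MapsOfWeightModules.
Variables (k : fieldType) (n : nat) (V V' : lmodType k).
Variables (pa : alg_action {mpoly k[n]} V) (pa' : alg_action {mpoly k[n]} V').
Variable f : {linear V -> V'}.
Hypothesis f_pa : forall p v, f (pa p v) = pa' p (f v).

Lemma wspace_map a v : wspace pa a v -> wspace pa' a (f v).
Proof. by move=> h p /h[N e]; exists N; rewrite -f_pa e linear0. Qed.

Lemma frac_act_map a g v : regular a g -> wspace pa a v ->
  f (frac_act pa g v) = frac_act pa' g (f v).
Proof.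
move=> rg hv; have hg := wspace_frac rg hv.
case: rg hg => [p [q [q0 ->]]] hg; have [_ e] := frac_actP p hv q0.
symmetry; apply: (frac_act_eq (wspace_map hv) (wspace_map hg) q0).
by rewrite -!f_pa e.
Qed.
End MapsOfWeightModules.

Section EquivalenceOfCategories.
Variables (k : fieldType) (I : {pred k}) (n : nat) (A : deg_affine_hecke k n).
Local Notation L := (weight I n).

Definition compatible (M : klr_mod0 I n) (S : cbar_structure I A M) : Prop :=
  (forall (nu : L) (m : M) (j : 'I_n), weight_space (klr_act M) nu m ->
     S (dah_X A j) m = X_formula j nu m) /\
  (forall (nu : L) (m : M) (i : 'I_n.-1), weight_space (klr_act M) nu m ->
     S (dah_T A i) m = T_formula i nu m).

Lemma wspace_pol_action (V : lmodType k) (pa : alg_action {mpoly k[n]} V)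
    (act : alg_action A V) a v : (forall p v, act (dah_pol A p) v = pa p v) ->
  wspace (pol_action act) a v <-> wspace pa a v.
Proof.
by move=> e; split=> h p /h[N hN]; exists N; move: hN; rewrite /= /pol_act e.
Qed.

Lemma exists_compatible (M : klr_mod0 I n) : exists S : cbar_structure I A M, compatible S.
Proof.
have [pa [t [UWE paX tE kt]]] := operators_of_klr (@klr_mod0_sum _ _ _ M) (@klr_mod0_nilp _ _ _ M).
have W_sum := direct_sum_ext UWE (@klr_mod0_sum _ _ _ M).
have [T [hT rel]] := hecke_of_klr W_sum kt.
have [act [actp actT]] := action_of_operators A hT.
have S_sum : direct_sum (fun nu : L => supported_at act (coordinate nu)).
  apply: direct_sum_ext W_sum => nu v.
  by rewrite supported_atE; apply: iff_sym; apply: wspace_pol_action.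
have actX nu m j : weight_space (klr_act M) nu m ->
    act (dah_X A j) m = X_formula j nu m by move=> hm; rewrite actp (paX _ _ _ hm).
exists (CbarStructure S_sum); split=> [nu m j hm|nu m i hm] /=; first exact: actX.
rewrite actT (T_formulaE (pa := pa) _ _ hm) => [|mu w a hw]; last exact: paX.
by rewrite (rel i nu m (proj1 (UWE _ _) hm)) (tE _ _ _ hm).
Qed.

Section Compatible.
Variables (M : klr_mod0 I n) (S : cbar_structure I A M).
Hypothesis hS : compatible S.
Local Notation pa := (pol_action (cbar_act S)).
Local Notation U := (weight_space (klr_act M)).

Lemma compatible_paX nu m a : U nu m -> pa 'X_a m = X_formula a nu m.
Proof. by move=> hm; apply: hS.1. Qed.

Lemma compatible_weight nu m : U nu m <-> wspace pa (coordinate nu) m.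
Proof.
apply: weight_space_wspace; [exact: (@klr_mod0_sum _ _ _ M)|exact: (@klr_mod0_nilp _ _ _ M)|].
exact: compatible_paX.
Qed.

Lemma compatible_T nu m i : U nu m -> S (dah_T A i) m =
  frac_act pa (tau_coef_at i nu) (klr_act M (klr_t i nu) m) +
  frac_act pa (const_coef_at i nu) m.
Proof. by move=> hm; rewrite (hS.2 nu m i hm) (T_formulaE compatible_paX). Qed.
End Compatible.

Section Maps.
Variables (M M' : klr_mod0 I n) (S : cbar_structure I A M) (S' : cbar_structure I A M').
Hypotheses (hS : compatible S) (hS' : compatible S').
Variable f : {linear M -> M'}.
Local Notation act := (klr_act M).
Local Notation act' := (klr_act M').
Local Notation U := (weight_space act).

Let ext (g h : {linear M -> M'}) : (forall nu v, U nu v -> g v = h v) -> g =1 h.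
Proof.
move=> gh; apply: (sum_ext (@klr_mod0_sum _ _ _ M) (weight_space0 act)
  (@weight_space_linear _ _ _ _ act)) => //; exact: linearP.
Qed.

(** The action of [T_i] on a weight vector only involves rational functions and
    [tau_i], both of which commute with [f]. *)
Lemma hecke_map_of_klr_map : (forall b m, f (act b m) = act' b (f m)) ->
  forall a m, f (S a m) = S' a (f m).
Proof.
move=> f_act.
have fU nu m : U nu m -> weight_space act' nu (f m).
  by move=> /weight_spaceE e; apply/weight_spaceE; rewrite -f_act e.
have fX j m : f (S (dah_X A j) m) = S' (dah_X A j) (f m).
  move: m; apply: (ext (g := f \o S (dah_X A j)) (h := S' (dah_X A j) \o f)) => nu m hm /=.
  by rewrite (hS.1 _ _ _ hm) (hS'.1 _ _ _ (fU _ _ hm)) /X_formula linearD linearZ /= f_act.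
have f_pa p m : f (pol_action S p m) = pol_action S' p (f m).
  elim/mpoly_ring_ind: p m => [c|j|p q hp hq|p q hp hq] m.
  - by rewrite !pa_const linearZ.
  - exact: fX.
  - by rewrite !al_actDl linearD /= hp hq.
  - by rewrite !al_act_mul hp hq.
elim/dah_ind => [c|j|i|a b ha hb|a b ha hb] m.
- exact: f_pa.
- exact: fX.
- move: m; apply: (ext (g := f \o S (dah_T A i)) (h := S' (dah_T A i) \o f)) => nu m hm /=.
  rewrite (compatible_T hS i hm) (compatible_T hS' i (fU _ _ hm)) linearD /=.
  rewrite (frac_act_map f_pa (regular_const_coef_at i nu)); last exact/(compatible_weight hS).
  rewrite (frac_act_map f_pa (regular_tau_coef_at i nu)) ?f_act //.
  exact/(compatible_weight hS)/weight_space_t.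
- by rewrite !al_actDl linearD /= ha hb.
by rewrite !al_act_mul ha hb.
Qed.

(** The idempotents are recovered from the generalized eigenspaces, and [tau_i]
    from [T_i] by inverting [tau_coef]. *)
Lemma klr_map_of_hecke_map : (forall a m, f (S a m) = S' a (f m)) ->
  forall b m, f (act b m) = act' b (f m).
Proof.
move=> f_act; have f_pa p m : f (pol_action S p m) = pol_action S' p (f m) by apply: f_act.
have fU nu m : U nu m -> weight_space act' nu (f m).
  by move=> /(compatible_weight hS) h; apply/(compatible_weight hS'); exact: (wspace_map f_pa h).
have fe nu m : f (act (klr_e nu) m) = act' (klr_e nu) (f m).
  move: m; apply: (ext (g := f \o act (klr_e nu)) (h := act' (klr_e nu) \o f)) => mu m hm /=.
  rewrite (weight_space_e nu hm) (weight_space_e nu (fU _ _ hm)).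
  by case: eqP; rewrite ?linear0.
have fx a nu m : f (act (klr_x a nu) m) = act' (klr_x a nu) (f m).
  rewrite -klr_x_e -[RHS]klr_x_e -fe; set w := act (klr_e nu) m.
  have hw : U nu w by exists m.
  have := f_act (dah_X A a) w.
  rewrite (hS.1 _ _ _ hw) (hS'.1 _ _ _ (fU _ _ hw)) /X_formula linearD linearZ /=.
  exact: addIr.
have ft i nu m : f (act (klr_t i nu) m) = act' (klr_t i nu) (f m).
  rewrite -klr_t_e -[RHS]klr_t_e -fe; set w := act (klr_e nu) m.
  have hw : U nu w by exists m.
  have hwW : wspace (pol_action S) (coordinate nu) w by apply/(compatible_weight hS).
  have htw : wspace (pol_action S) (coordinate (permute i nu)) (act (klr_t i nu) w).
    exact/(compatible_weight hS)/weight_space_t.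
  have hftw : wspace (pol_action S') (coordinate (permute i nu)) (act' (klr_t i nu) (f w)).
    exact/(compatible_weight hS')/weight_space_t.
  have hfw := wspace_map f_pa htw.
  have := f_act (dah_T A i) w.
  rewrite (compatible_T hS i hw) (compatible_T hS' i (fU _ _ hw)) linearD /=.
  rewrite (frac_act_map f_pa (regular_const_coef_at i nu) hwW) => /addIr.
  rewrite (frac_act_map f_pa (regular_tau_coef_at i nu) htw) => e.
  apply/eqP; rewrite -subr_eq0; apply/eqP.
  apply: (frac_unit_inj (tau_coef_at_neq0 i nu) (regular_tau_coef_at i nu)
    (regular_tau_coef_inv i nu) (wspaceB hfw hftw)).
  by rewrite (frac_actBr (regular_tau_coef_at i nu) hfw hftw) e subrr.
elim/klr_alg_ind => [|a b ha hb|a ha|c a ha|a b ha hb|nu|a nu|i nu] m.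
- by rewrite !nu_act0l linear0.
- by rewrite !nu_actDl linearD /= ha hb.
- by rewrite !nu_actNl linearN /= ha.
- by rewrite !nu_actZl linearZ /= ha.
- by rewrite !nu_act_mul ha hb.
- exact: fe.
- exact: fx.
exact: ft.
Qed.
End Maps.

(** The sum type records the conditions under which the action is an object of
    the source category, which then has the same underlying space as [N]. *)
Lemma exists_klr (N : cbar I A) :
  exists K : {a : nualg_action (klr_alg I n) N | direct_sum (weight_space a) /\
      forall nu (i : 'I_n) (m : N), weight_space a nu m ->
        exists d, iter d (a (klr_x i nu)) m = 0},
    @compatible (KlrMod0 (proj1 (svalP K)) (proj2 (svalP K))) (cbar_str N).
Proof.
pose pa := pol_action (cbar_str N).
have W_sum : direct_sum (fun nu : L => wspace pa (coordinate nu)).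
  by apply: direct_sum_ext (cbar_sum (cbar_str N)) => nu v; apply: supported_atE.
have [t [kt rel]] := klr_of_hecke W_sum (hecke_operators_of_action (cbar_str N)).
have [a [UW ax at_]] := klr_of_operators W_sum kt.
have a_sum : direct_sum (weight_space a).
  by apply: direct_sum_ext W_sum => nu v; apply: iff_sym.
have a_nilp nu (i : 'I_n) (m : N) : weight_space a nu m ->
    exists d, iter d (a (klr_x i nu)) m = 0.
  move=> /UW hm; have [|d hd] := hm (shifted_var nu i).
    by rewrite mevalB mevalXU mevalC subrr.
  exists d; rewrite -hd {hd}; elim: d m hm => [|d IH] m hm; first by rewrite expr0 al_act1.
  by rewrite iterSr exprSr al_act_mul ax // IH //; apply: wspace_pa.
exists (exist _ a (conj a_sum a_nilp)) => /=; set K := KlrMod0 _ _.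
have paX nu m j : weight_space (klr_act K) nu m -> pa 'X_j m = X_formula (M := K) j nu m.
  by move=> /UW hm; rewrite /X_formula /= ax // al_actBl pa_const subrK.
split=> [nu m j hm|nu m i hm]; first exact: paX hm.
rewrite (T_formulaE (M := K) (pa := pa) paX i hm) /=.
have hW : wspace pa (coordinate nu) m by apply/UW.
by rewrite (rel i nu m hW) at_.
Qed.
End EquivalenceOfCategories.

Theorem theorem3p16 (k : fieldType) (I : {pred k}) (n : nat) (n_ge1 : (1 <= n)%N)
    (A : deg_affine_hecke k n) :
  exists (S : forall M : klr_mod0 I n, cbar_structure I A M)
         (HS : preserves_maps S),
    [/\ forall (M : klr_mod0 I n) (nu : weight I n) (m : M) (j : 'I_n),
          weight_space (klr_act M) nu m -> S M (dah_X A j) m = X_formula j nu m,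
        forall (M : klr_mod0 I n) (nu : weight I n) (m : M) (i : 'I_n.-1),
          weight_space (klr_act M) nu m -> S M (dah_T A i) m = T_formula i nu m
      & is_equivalence (same_space_functor HS)].
Proof.
pose S (M : klr_mod0 I n) := sval (cid (exists_compatible A M)).
have hS M : compatible (S M) by exact: svalP (cid (exists_compatible A M)).
have linear_of (M N : lmodType k) (f : M -> N) : linear f ->
    exists g : {linear M -> N}, (g : M -> N) = f.
  by move=> fl; exists (HB.pack_for {linear M -> N} f (GRing.isLinear.Build k M N *:%R f fl)).
have HS : preserves_maps S.
  move=> M N [f [fl f_act]] a m /=; have [g eg] := linear_of _ _ _ fl.
  by rewrite -eg; apply: (hecke_map_of_klr_map (hS M) (hS N)); rewrite eg.
exists S, HS; split=> [M nu m j|M nu m i|]; [exact: (hS M).1|exact: (hS M).2|].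
pose K (N : cbar I A) := sval (cid (exists_klr N)).
pose G_obj (N : cbar_category I A) : klr_mod0_category I n :=
  KlrMod0 (proj1 (svalP (K N))) (proj2 (svalP (K N))).
have hG N : @compatible _ _ _ _ (G_obj N) (cbar_str N) by exact: svalP (cid (exists_klr N)).
have G_map (N N' : cbar_category I A) (f : Defs.hom N N') :
    @module_map k (klr_alg I n) (klr_mod0 I n) (@klr_space k I n) (@klr_act k I n)
      (G_obj N) (G_obj N') (sval f).
  case: f => f [fl f_act] /=; split=> // b m; have [g eg] := linear_of _ _ _ fl.
  by rewrite -eg; apply: (klr_map_of_hecke_map (hG N) (hG N')) => {}b {}m; rewrite eg.
pose G_fmap (N N' : cbar_category I A) (f : Defs.hom N N') : Defs.hom (G_obj N) (G_obj N') :=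
  exist _ (sval f) (G_map N N' f).
have G_id N : G_fmap N N (Defs.idm N) = Defs.idm (G_obj N) by apply: module_hom_ext.
have G_comp N N' N'' (f : Defs.hom N' N'') (g : Defs.hom N N') :
    G_fmap N N'' (Defs.comp f g) = Defs.comp (G_fmap N' N'' f) (G_fmap N N' g).
  by apply: module_hom_ext.
exists (@Functor _ _ G_obj G_fmap G_id G_comp); split.
(* both isomorphisms are carried by identity maps *)
- have toM (M : klr_mod0_category I n) : @module_map k (klr_alg I n) (klr_mod0 I n)
      (@klr_space k I n) (@klr_act k I n) (G_obj (same_space_obj S M)) M id.
    by split=> //; apply: (klr_map_of_hecke_map (hG (same_space_obj S M)) (hS M)
      (f := idfun)).
  have ofM (M : klr_mod0_category I n) : @module_map k (klr_alg I n) (klr_mod0 I n)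
      (@klr_space k I n) (@klr_act k I n) M (G_obj (same_space_obj S M)) id.
    by split=> //; apply: (klr_map_of_hecke_map (hS M) (hG (same_space_obj S M))
      (f := idfun)).
  exists (fun M => exist _ id (toM M)), (fun M => exist _ id (ofM M)).
  by split=> [M N f|M]; [|split]; apply: module_hom_ext.
have S_eq (N : cbar_category I A) a m : S (G_obj N) a m = cbar_str N a m.
  by apply: (hecke_map_of_klr_map (hS (G_obj N)) (hG N) (f := idfun)).
have toN (N : cbar_category I A) : @module_map k A (cbar I A) (@cbar_space k I n A)
    (fun N => cbar_str N) (same_space_obj S (G_obj N)) N id.
  by split=> // a m; apply: S_eq.
have ofN (N : cbar_category I A) : @module_map k A (cbar I A) (@cbar_space k I n A)
    (fun N => cbar_str N) N (same_space_obj S (G_obj N)) id.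
  by split=> // a m; apply/esym/S_eq.
exists (fun N => exist _ id (toN N)), (fun N => exist _ id (ofN N)).
by split=> [M N f|N]; [|split]; apply: module_hom_ext.
Qed.
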